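(* Let $(M,\omega)$ be a symplectic surface, and let $F$, $\phi_\rho$ and $H=F\circ\phi_\rho$ be the smooth function, the area preserving homeomorphism, and the smooth function on $M$ described in the context. Suppose that $\rho(r)$ grows like $r^{-a-1}$ as $r\to0^+$, where $a>0$. If $\psi$ is an area preserving homeomorphism of $M$ that conjugates the flows of $H$ and $F$, i.e. $\psi\circ\phi_H^t\circ\psi^{-1}=\phi_F^t$ for all $t$, then $\psi$ is not Lipschitz; consequently no $C^1$-symplectic diffeomorphism conjugates the Hamiltonian vector fields $X_H$ and $X_F$.
   Context: The Hamiltonian vector field $X_G$ of a smooth function $G$ on $M$ is defined by $\iota_{X_G}\omega=dG$, and its flow is denoted $\{\phi_G^t\}$. The function $F$ is a smooth function on $M$ that in local Darboux coordinates near some point of $M$ (corresponding to the origin) has the form $$F(r,\theta)=e^{-f(r,\theta)},\qquad f(r,\theta)=\frac{4}{r^2(1+15\cos^2\theta)}$$ (with value $0$ at the origin), where $(r,\theta)$ are polar coordinates in the plane. Equivalently, $f$ is the composition of the map $(r,\theta)\mapsto 1/r^2$ with the area preserving change of coordinates $(x,y)\mapsto(2x,\frac{y}{2})$, where $x=r\cos\theta$, $y=r\sin\theta$. By cutting off $F$ outside a neighborhood of the origin, it is assumed to be compactly supported in the domain of the Darboux chart. Let $D^2\subset\mathbb R^2$ be a disk contained in the domain of the Darboux chart and centered at the origin, with radial coordinate $0\le r\le1$. Let $\rho\colon(0,1]\to\mathbb R$ be a smooth function with $\rho(r)=0$ near $r=1$, and let $\phi_\rho\colon D^2\to D^2$ be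 the area preserving homeomorphism, compactly supported in the interior of $D^2$, given by $(r,\theta)\mapsto(r,\theta+\rho(r))$ for $r>0$ and $\phi_\rho(0)=0$ at the origin. It is extended by the identity outside $D^2$ to an area preserving homeomorphism of $M$, also denoted $\phi_\rho$. The function $\rho$ is chosen appropriately, so that $\phi_\rho$ is smooth everywhere except at the origin and $H=F\circ\phi_\rho$ is a smooth function on $M$. One has $\phi_\rho\circ\phi_H^t\circ\phi_\rho^{-1}=\phi_F^t$ for all $t$. *)

(* Defs.v *)
From HB Require Import structures.
From mathcomp Require Import all_boot all_order all_algebra.
From mathcomp Require Import all_classical all_reals all_analysis.
From mathcomp Require Import ring.
Set Implicit Arguments.
Unset Strict Implicit.
Unset Printing Implicit Defensive.
Import Order.TTheory GRing.Theory Num.Theory.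
Import numFieldNormedType.Exports.
Local Open Scope classical_set_scope.
Local Open Scope ring_scope.

Notation plane R := (R * R)%type.

(* C^n on an open set, through partial derivatives.  Continuity of f itself
   for n > 0 follows from the continuity of its partial derivatives. *)
Fixpoint Cn_on {R : realType} {V : normedModType R} (n : nat)
    (U : set (plane R)) (f : plane R -> V) : Prop :=
  match n with
  | 0 => forall z, U z -> {for z, continuous f}
  | m.+1 => [/\ forall z, U z -> derivable f z (1, 0) /\ derivable f z (0, 1),
                Cn_on m U ('D_(1, 0) f) & Cn_on m U ('D_(0, 1) f)]
  end.

Definition smooth_on {R : realType} {V : normedModType R}
    (U : set (plane R)) (f : plane R -> V) : Prop :=
  forall n, Cn_on n U f.

(* Values of chart_map outside chart_dom, and of chart_inv outside the image of
   the chart, are irrelevant. *)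
Record chart (R : realType) (T : topologicalType) := Chart {
  chart_dom : set T;
  chart_map :> T -> plane R;
  chart_inv : plane R -> T;
  chart_dom_open : open chart_dom;
  chart_img_open : open (chart_map @` chart_dom);
  chart_mapK : forall p, chart_dom p -> chart_inv (chart_map p) = p;
  chart_map_continuous : forall p, chart_dom p -> {for p, continuous chart_map};
  chart_inv_continuous : forall z, (chart_map @` chart_dom) z ->
    {for z, continuous chart_inv}
}.

Definition chart_img {R : realType} {T : topologicalType} (c : chart R T) :
    set (plane R) := c @` chart_dom c.

(* The local representative c' o g o c^-1 of a map g, and its natural domain,
   which is open when g is continuous. *)
Definition rep {R : realType} {T : topologicalType} (c c' : chart R T)
    (g : T -> T) : plane R -> plane R :=
  fun z => c' (g (chart_inv c z)).

Definition rep_dom {R : realType} {T : topologicalType} (c c' : chart R T)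
    (g : T -> T) : set (plane R) :=
  c @` (chart_dom c `&` g @^-1` chart_dom c').

Definition compatible {R : realType} {T : topologicalType}
    (c c' : chart R T) : Prop :=
  smooth_on (rep_dom c c' id) (rep c c' id) /\
  smooth_on (rep_dom c' c id) (rep c' c id).

(* A smooth surface with a nowhere vanishing smooth 2-form omega (closedness is
   automatic in dimension 2).  In a chart c with coordinates (x, y), omega is
   omega_coef c dx /\ dy. *)
Record symplectic_surface (R : realType) := SymplecticSurface {
  carrier :> ptopologicalType;
  surface_hausdorff : hausdorff_space carrier;
  surface_second_countable : @second_countable carrier;
  atlas : set (chart R carrier);
  atlas_cover : forall p, exists2 c, atlas c & chart_dom c p;
  atlas_compatible : forall c c', atlas c -> atlas c' -> compatible c c';
  atlas_maximal : forall c, (forall c', atlas c' -> compatible c c') -> atlas c;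
  omega_coef : chart R carrier -> plane R -> R;
  omega_smooth : forall c, atlas c -> smooth_on (chart_img c) (omega_coef c);
  omega_nondegenerate : forall c, atlas c ->
    forall z, chart_img c z -> omega_coef c z != 0;
  omega_transition : forall c c', atlas c -> atlas c' ->
    forall z, rep_dom c c' id z -> forall u v : plane R,
      let t := rep c c' id in
      omega_coef c z * (u.1 * v.2 - u.2 * v.1) =
      omega_coef c' (t z) *
        (('D_u t z).1 * ('D_v t z).2 - ('D_u t z).2 * ('D_v t z).1)
}.

Section SymplecticSurface.
Context {R : realType} (M : symplectic_surface R).
Implicit Types (c : chart R M) (z u v X : plane R) (G : M -> R).

Definition omega c z u v : R :=
  omega_coef c z * (u.1 * v.2 - u.2 * v.1).

Definition darboux_chart c : Prop :=
  atlas c /\ forall z, chart_img c z -> omega_coef c z = 1.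

Definition smooth_fun G : Prop :=
  forall c, atlas c -> smooth_on (chart_img c) (G \o chart_inv c).

(* X is the coordinate expression in c of the Hamiltonian vector X_G at the
   point with coordinates z: iota_X omega = dG. *)
Definition ham_vector G c z X : Prop :=
  forall v, omega c z X v = 'D_v (G \o chart_inv c) z.

Definition ham_flow G (phi : R -> M -> M) : Prop :=
  forall p, [/\ phi 0 p = p,
    continuous (phi ^~ p) &
    forall t c, atlas c -> chart_dom c (phi t p) ->
      exists2 X, ham_vector G c (c (phi t p)) X &
        is_derive t 1 (fun s => c (phi s p)) X].

Definition borel : measurableType _ := g_sigma_algebraType (@open M).

(* mu is the Borel measure on M induced by omega. *)
Definition area_measure (mu : {measure set borel -> \bar R}) : Prop :=
  forall c (A : set borel), atlas c -> measurable A -> A `<=` chart_dom c ->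
    mu A = (\int[lebesgue_measure \x lebesgue_measure]_(z in c @` A)
              (`|omega_coef c z|)%:E)%E.

Definition area_preserving (mu : {measure set borel -> \bar R})
    (psi : M -> M) : Prop :=
  forall A : set borel, measurable A -> mu (psi @` A) = mu A.

Definition homeomorphism (psi psi_inv : M -> M) : Prop :=
  [/\ cancel psi psi_inv, cancel psi_inv psi,
      continuous psi & continuous psi_inv].

(* M carries no preferred metric: Lipschitz means locally Lipschitz in charts,
   which any map that is Lipschitz for a Riemannian distance satisfies. *)
Definition Lipschitz (psi : M -> M) : Prop :=
  forall c c', atlas c -> atlas c' -> forall z, rep_dom c c' psi z ->
    lipschitz_on (rep c c' psi) (nbhs (z, z)).

Definition C1_map (psi : M -> M) : Prop :=
  continuous psi /\ forall c c', atlas c -> atlas c' ->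
    Cn_on 1 (rep_dom c c' psi) (rep c c' psi).

Definition C1_symplectic_diffeo (psi psi_inv : M -> M) : Prop :=
  [/\ cancel psi psi_inv, cancel psi_inv psi, C1_map psi, C1_map psi_inv &
      forall c c', atlas c -> atlas c' -> forall z, rep_dom c c' psi z ->
        forall u v, omega c' (rep c c' psi z)
          ('D_u (rep c c' psi) z) ('D_v (rep c c' psi) z) = omega c z u v].

(* psi maps the vector field X_G to X_G' : dpsi (X_G p) = X_G' (psi p). *)
Definition conjugates_ham_fields (psi : M -> M) G G' : Prop :=
  forall c c', atlas c -> atlas c' -> forall z, rep_dom c c' psi z ->
    forall X, ham_vector G c z X ->
      ham_vector G' c' (rep c c' psi z) ('D_X (rep c c' psi) z).

End SymplecticSurface.

Section Twist.
Context {R : realType}.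
Implicit Types (r theta : R) (z : plane R) (rho : R -> R).

Definition polar r theta : plane R := (r * cos theta, r * sin theta).

Definition enorm z : R := Num.sqrt (z.1 ^+ 2 + z.2 ^+ 2).

(* (r, theta) |-> (r, theta + rho r) on the punctured plane, and 0 |-> 0 *)
Definition twist rho z : plane R :=
  let t := rho (enorm z) in
  (z.1 * cos t - z.2 * sin t, z.1 * sin t + z.2 * cos t).

Lemma twist_polar rho r theta : 0 < r ->
  twist rho (polar r theta) = polar r (theta + rho r).
Proof.
move=> r0; have -> : twist rho (polar r theta) =
    let t := rho (enorm (polar r theta)) in
    (r * cos theta * cos t - r * sin theta * sin t,
     r * cos theta * sin t + r * sin theta * cos t) by [].
have -> : enorm (polar r theta) = r.
  rewrite /enorm /polar /= !exprMn -mulrDr cos2Dsin2 mulr1 sqrtr_sqr.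
  by rewrite ger0_norm ?ltW.
by rewrite /polar cosD sinD /=; congr pair; ring.
Qed.

Lemma twist0 rho : twist rho 0 = 0.
Proof. by rewrite /twist /= !mul0r subr0 addr0. Qed.

(* phi_rho is the twist on the disk D^2 in the chart c, the identity off it. *)
Definition phi_rho (M : symplectic_surface R) (c : chart R M) rho (p : M) : M :=
  if `[< chart_dom c p /\ enorm (c p) <= 1 >]
  then chart_inv c (twist rho (c p)) else p.

End Twist.

(* Main.v *)
Require Import Defs.
From HB Require Import structures.
From mathcomp Require Import all_boot all_order all_algebra.
From mathcomp Require Import all_classical all_reals all_analysis.
From mathcomp Require Import measurable_realfun.
From mathcomp Require Import ring lra.
Set Implicit Arguments.
Unset Strict Implicit.
Unset Printing Implicit Defensive.
Import Order.TTheory GRing.Theory Num.Theory.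
Import numFieldNormedType.Exports.
Local Open Scope classical_set_scope.
Local Open Scope ring_scope.

(** Off the origin the orbits of F near it are ellipses, with a period that
    determines the ellipse.  The map g = psi o phi_rho^-1 commutes with the flow
    of F, and the points of a punctured elliptic disk V at the origin, as they
    move under this flow, stay in the compact support K under iteration of g.
    Some power g^n therefore sends a point of V into V: by area if psi preserves
    the measure; if psi is C^1 and conjugates the fields, because F o g - F is
    locally constant, so that two iterates of V near a cluster point of g^k(0)
    must overlap.  By the periods, this power preserves each ellipse in V,
    rotates it, and fixes 0.  For the first m > 0 with g^m(0) = 0, the points
    g^i(0), 0 < i < m, lie in the chart off the origin, where phi_rho is C^1, so
    g^m o phi_rho = g^(m-1) o psi is Lipschitz near 0 if psi is.  This map is
    phi_rho followed by a rotation of each ellipse.  On a circle it compares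
    ellipses of different size, which makes the angle of rotation Lipschitz in
    the logarithm of the size; on a ray r |rho'(r)| must then stay bounded, so
    rho grows at most logarithmically. *)

(** If [F] were radial, [phi_rho] would preserve it, [H] would equal [F] and the identity would
    conjugate the flows. The factor 15 makes the levels of [F] ellipses that cross the circles
    preserved by [phi_rho]: the circle of radius r meets every ellipse [qform = q] with r^2 / 4 <= q
    <= 4 r^2. An angle that depends on the ellipse therefore cannot undo an angle that depends on
    the circle. [F] is prescribed only near the origin, so [psi] may carry this region to another
    part of the support; hence the powers of g. [M] may have infinite area, but the iterates of the
    region stay in a compact subset of one chart, which is what makes recurrence available.
    Recurrence is proved twice because preserving [mu] and preserving [omega] at each point are
    different hypotheses; the infinitesimal one is turned directly into a statement on F o g - F,
    without a change of variables. Angles matter only modulo 2 pi. They are compared through their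
    unit vectors (cos, sin), so no continuous choice of the angle of rotation is made. *)

Section PlaneCalculus.
Context {R : realType}.
Implicit Types (f : plane R -> R) (z p q v : plane R) (U : set (plane R)).

(** * Strict differentiability and the chain rule in the plane *)

Lemma plane_ballE z e p :
  ball z e p <-> `|z.1 - p.1| < e /\ `|z.2 - p.2| < e.
Proof. by case: z p => [z1 z2] [p1 p2]. Qed.

Lemma is_deriveP (V W : normedModType R) (g : V -> W) (t v : V) (X : W) :
  is_derive t v g X <->
  (fun h : R => h^-1 *: (g (h *: v + t) - g t)) @ 0^' --> X.
Proof.
split=> [[gd <-]|gX]; first exact: gd.
by apply: DeriveDef; [apply/cvg_ex; exists X | apply/cvg_lim].
Qed.

Lemma is_derive_pairP (V : normedModType R) (g : V -> plane R) (t v : V) (X : plane R) :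
  is_derive t v g X <->
  is_derive t v (fun s => (g s).1) X.1 /\ is_derive t v (fun s => (g s).2) X.2.
Proof.
rewrite !is_deriveP; split => [gX|[g1 g2]].
  split.
    exact: (cvg_comp _ _ gX (@cvg_fst _ _ (nbhs X.1) (nbhs X.2) _)).
  exact: (cvg_comp _ _ gX (@cvg_snd _ _ (nbhs X.1) (nbhs X.2) _)).
by case: X g1 g2 => X1 X2 g1 g2; exact: (cvg_pair g1 g2).
Qed.

(** Exchanges directional derivatives and derivatives along curves. The base point moves with [t],
    so that the mean value theorem applies along the whole line. *)
Lemma is_derive_line (V W : normedModType R) (g : V -> W) (t : R) (z v : V) (X : W) :
  is_derive (z + t *: v) v g X <-> is_derive t 1 (fun s : R => g (z + s *: v)) X.
Proof.
rewrite !is_deriveP.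
suff -> : (fun h : R => h^-1 *: (g (h *: v + (z + t *: v)) - g (z + t *: v))) =
  (fun h : R => h^-1 *: (g (z + (h *: 1 + t) *: v) - g (z + t *: v))) by [].
apply/funext => h; congr (_ *: (g _ - _)).
by rewrite scaler1 scalerDl addrCA.
Qed.

(* Strict differentiability at z with partial derivatives a and b. *)
Definition sdiff f z (a b : R) := forall e : R, 0 < e -> exists2 d : R, 0 < d &
  forall p q, ball z d p -> ball z d q ->
  `|f p - f q - ((p.1 - q.1) * a + (p.2 - q.2) * b)| <=
    e * (`|p.1 - q.1| + `|p.2 - q.2|).

(** The endpoints come in either order: in the plane the signs of the coordinate increments are
    unknown. *)
Lemma partial_MVT (g dg : R -> R) (x y : R) :
  (forall s, Num.min x y <= s <= Num.max x y -> is_derive s 1 g (dg s)) ->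
  exists2 s, Num.min x y <= s <= Num.max x y & g x - g y = (x - y) * dg s.
Proof.
wlog xy : x y / x <= y => [hw|].
  have [xy|/ltW yx] := leP x y.
    by have := hw x y xy; rewrite (min_idPl xy) (max_idPr xy).
  have := hw y x yx; rewrite (min_idPl yx) (max_idPr yx) => /[apply] -[s sin E].
  by exists s => //; rewrite -opprB E -mulNr opprB.
rewrite (min_idPl xy) (max_idPr xy) => gd.
have [s||s sin E] := @MVT_segment _ g dg x y xy.
- by rewrite in_itv/= => /andP[xs sy]; apply: gd; rewrite !ltW.
- apply: derivable_within_continuous => s; rewrite in_itv/= => sin.
  by have [] := gd s sin.
by move: sin; rewrite in_itv/= => sin; exists s => //; rewrite -opprB E mulrC -mulNr opprB.
Qed.

(** From [p] to [q] one goes through the corner [(q.1, p.2)]. The mean value theorem on each leg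
    gives a partial derivative at a nearby point, and continuity compares it with the one at [z]. *)
Lemma Cn1_sdiff f U z : open U -> U z -> Cn_on 1 U f ->
  sdiff f z ('D_(1, 0) f z) ('D_(0, 1) f z).
Proof.
move=> Uo Uz [fd c1 c2] e e0.
have /nbhs_ballP[d1 /= d10 B1] : \near z, U z by exact: open_nbhs_nbhs.
have /cvgrPdist_le/(_ e e0)/nbhs_ballP[d2 /= d20 B2] := c1 z Uz.
have /cvgrPdist_le/(_ e e0)/nbhs_ballP[d3 /= d30 B3] := c2 z Uz.
exists (Num.min d1 (Num.min d2 d3)); first by rewrite !lt_min d10 d20.
set d := Num.min _ _.
have dd1 : d <= d1 by rewrite /d ge_min lexx.
have dd2 : d <= d2 by rewrite /d !ge_min lexx ?orbT.
have dd3 : d <= d3 by rewrite /d !ge_min lexx ?orbT.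
move=> p q zp zq.
have btw (x y w s : R) : `|w - x| < d -> `|w - y| < d ->
    Num.min x y <= s <= Num.max x y -> `|w - s| < d.
  rewrite !ltr_distlC; case: (leP x y) => _ /andP[? ?] /andP[? ?] /andP[? ?];
  apply/andP; split; lra.
move/plane_ballE: (zp) => [zp1 zp2]; move/plane_ballE: (zq) => [zq1 zq2].
have P1 s : Num.min p.1 q.1 <= s <= Num.max p.1 q.1 -> ball z d (s, p.2).
  by move=> sin; apply/plane_ballE; split => //=; apply: btw sin.
have P2 s : Num.min p.2 q.2 <= s <= Num.max p.2 q.2 -> ball z d (q.1, s).
  by move=> sin; apply/plane_ballE; split => //=; apply: btw sin.
have [s1 s1in E1] : exists2 s, Num.min p.1 q.1 <= s <= Num.max p.1 q.1 &
    f (p.1, p.2) - f (q.1, p.2) = (p.1 - q.1) * 'D_(1, 0) f (s, p.2).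
  apply: (@partial_MVT (fun s => f (s, p.2)) (fun s => 'D_(1, 0) f (s, p.2))).
  move=> s /P1 sin; have /(le_ball dd1)/B1/fd[/derivableP + _] := sin.
  have -> : (s, p.2) = (0, p.2) + s *: (1, 0) :> plane R.
    by congr pair; rewrite /= ?add0r ?scaler1 ?scaler0 ?addr0.
  move=> /is_derive_line; rewrite (_ : (fun _ => _) = (fun s => f (s, p.2)))//.
  by apply/funext => h; congr (f (_, _)); rewrite /= ?add0r ?scaler1 ?scaler0 ?addr0.
have [s2 s2in E2] : exists2 s, Num.min p.2 q.2 <= s <= Num.max p.2 q.2 &
    f (q.1, p.2) - f (q.1, q.2) = (p.2 - q.2) * 'D_(0, 1) f (q.1, s).
  apply: (@partial_MVT (fun s => f (q.1, s)) (fun s => 'D_(0, 1) f (q.1, s))).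
  move=> s /P2 sin; have /(le_ball dd1)/B1/fd[_ /derivableP +] := sin.
  have -> : (q.1, s) = (q.1, 0) + s *: (0, 1) :> plane R.
    by congr pair; rewrite /= ?add0r ?scaler1 ?scaler0 ?addr0.
  move=> /is_derive_line; rewrite (_ : (fun _ => _) = (fun s => f (q.1, s)))//.
  by apply/funext => h; congr (f (_, _)); rewrite /= ?add0r ?scaler1 ?scaler0 ?addr0.
have -> : f p - f q - ((p.1 - q.1) * 'D_(1, 0) f z + (p.2 - q.2) * 'D_(0, 1) f z) =
    (p.1 - q.1) * ('D_(1, 0) f (s1, p.2) - 'D_(1, 0) f z) +
    (p.2 - q.2) * ('D_(0, 1) f (q.1, s2) - 'D_(0, 1) f z).
  rewrite !mulrBr -E1 -E2 -!surjective_pairing; ring.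
have /(le_ball dd2)/B2 /= b2 := P1 _ s1in.
have /(le_ball dd3)/B3 /= b3 := P2 _ s2in.
rewrite [leRHS]mulrDr (le_trans (ler_normD _ _))// !normrM.
by apply: lerD; rewrite mulrC ler_wpM2r// distrC.
Qed.

Lemma sdiff_lip f z a b : sdiff f z a b -> exists d L : R,
  [/\ 0 < d, 0 < L & forall p q, ball z d p -> ball z d q ->
     `|f p - f q| <= L * (`|p.1 - q.1| + `|p.2 - q.2|)].
Proof.
move=> /(_ 1 ltr01) [d d0 H]; exists d, (1 + `|a| + `|b|); split => //.
move=> p q /H{}H /H{}H.
have -> : f p - f q = (f p - f q - ((p.1 - q.1) * a + (p.2 - q.2) * b)) +
   ((p.1 - q.1) * a + (p.2 - q.2) * b) by rewrite subrK.
rewrite (le_trans (ler_normD _ _))// -[1 + _ + _]addrA [leRHS]mulrDl.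
apply: lerD => //.
rewrite (le_trans (ler_normD _ _))// !normrM.
set x := `|p.1 - q.1|; set y := `|p.2 - q.2|.
have -> : (`|a| + `|b|) * (x + y) = (x * `|a| + y * `|b|) + (`|a| * y + `|b| * x).
  by ring.
by rewrite lerDl; apply: addr_ge0; apply: mulr_ge0; apply: normr_ge0.
Qed.

Lemma is_derive1P (V : normedModType R) (k : R -> V) (t : R) (X : V) :
  is_derive t 1 k X <->
  (fun h : R => h^-1 *: (k (h + t) - k t)) @ 0^' --> X.
Proof.
rewrite is_deriveP; suff -> : (fun h : R => h^-1 *: (k (h *: (1 : R) + t) - k t)) =
  (fun h : R => h^-1 *: (k (h + t) - k t)) by [].
by apply/funext => h; congr (_ *: (k (_ + _) - _)); rewrite [LHS]mulr1.
Qed.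

Lemma is_derive_affine (V : normedModType R) (z v : V) (t : R) :
  is_derive t 1 (fun s : R => z + s *: v) v.
Proof.
apply/is_derive1P; apply: cvg_near_cst; near=> h.
rewrite scalerDl opprD addrACA subrr add0r addrK scalerA mulVf ?scale1r//.
by near: h; exact: nbhs_dnbhs_neq.
Unshelve. all: by end_near. Qed.

Lemma is_derive_cvg (g : R -> plane R) (t : R) X : is_derive t 1 g X ->
  {for t, continuous g}.
Proof. by move=> [gd _]; apply/differentiable_continuous/derivable1_diffP. Qed.

(** Strict differentiability bounds the remainder by a small multiple of the increment of [g], which
    is of order [h]. *)
Lemma sdiff_curve f (g : R -> plane R) (t : R) X a b :
  sdiff f (g t) a b -> is_derive t 1 g X ->
  is_derive t 1 (f \o g) (X.1 * a + X.2 * b).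
Proof.
move=> fs gX; have gc := is_derive_cvg gX.
move/is_derive_pairP: gX => [/is_derive1P g1 /is_derive1P g2].
apply/is_derive1P.
have lin : (fun h => h^-1 * ((g (h + t)).1 - (g t).1) * a +
    h^-1 * ((g (h + t)).2 - (g t).2) * b) @ 0^' --> X.1 * a + X.2 * b.
  by apply: cvgD; apply: cvgM => //; apply: cvg_cst.
suff small : (fun h => h^-1 * (f (g (h + t)) - f (g t)) -
    (h^-1 * ((g (h + t)).1 - (g t).1) * a +
    h^-1 * ((g (h + t)).2 - (g t).2) * b)) @ 0^' --> (0 : R).
  have -> : X.1 * a + X.2 * b = 0 + (X.1 * a + X.2 * b) by rewrite add0r.
  by apply: cvg_trans (cvgD small lin); apply: near_eq_cvg; apply: nearW => h /=; rewrite subrK.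
apply/cvgr0Pnorm_le => e e0.
(* The difference quotients of the two coordinates are eventually at most [|X.1| + 1] and
   [|X.2| + 1] in absolute value; [B] is the sum of these bounds. *)
pose B := `|X.1| + `|X.2| + 2.
have B0 : 0 < B by rewrite /B; have := normr_ge0 X.1; have := normr_ge0 X.2; lra.
have [d d0 H] := fs (e / B) (divr_gt0 e0 B0).
have gnear : \forall h \near (0 : R)^', ball (g t) d (g (h + t)).
  have : \forall h \near (0 : R), ball (g t) d (g (h + t)).
    have ct : (fun h => g (h + t)) @ (0 : R) --> g t.
      apply: (@cvg_comp _ _ _ (fun h => h + t) g); last exact: gc.
      have -> : t = 0 + t by rewrite add0r.
      by apply: cvgD; [exact: cvg_id | rewrite add0r; apply: cvg_cst].
    exact: (ct _ (nbhsx_ballx (g t) _ d0)).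
  exact: cvg_within.
have bd1 : \forall h \near (0 : R)^', `|h^-1 * ((g (h + t)).1 - (g t).1)| <= `|X.1| + 1.
  move/cvgrPdist_le: (g1) => /(_ 1 ltr01); apply: filterS => h /= le1.
  by rewrite -[X in `|X|](subKr X.1) (le_trans (ler_normB _ _))// lerD2l.
have bd2 : \forall h \near (0 : R)^', `|h^-1 * ((g (h + t)).2 - (g t).2)| <= `|X.2| + 1.
  move/cvgrPdist_le: (g2) => /(_ 1 ltr01); apply: filterS => h /= le1.
  by rewrite -[X in `|X|](subKr X.2) (le_trans (ler_normB _ _))// lerD2l.
near=> h.
rewrite -!mulrA -mulrDr -mulrBr normrM.
have hb : ball (g t) d (g (h + t)) by near: h.
rewrite (le_trans (ler_wpM2l (normr_ge0 _) (H _ _ hb (ballxx _ d0))))//.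
rewrite mulrCA mulrDr -!normrM.
rewrite -[leRHS](divfK (lt0r_neq0 B0)) ler_wpM2l ?divr_ge0 ?(ltW e0) ?(ltW B0)//.
rewrite /B (_ : _ + 2 = (`|X.1| + 1) + (`|X.2| + 1)); last by ring.
by apply: lerD; near: h.
Unshelve. all: by end_near. Qed.

Lemma sdiff_derive f z v a b : sdiff f z a b ->
  is_derive z v f (v.1 * a + v.2 * b).
Proof.
move=> fs; have zE : z = z + (0 : R) *: v by rewrite scale0r addr0.
rewrite {1}zE; apply/is_derive_line.
apply: (@sdiff_curve f (fun s => z + s *: v)); first by rewrite -zE.
exact: is_derive_affine.
Qed.

End PlaneCalculus.

(** * Rotations and twists of the plane *)

Lemma plane_normE (R : realType) (z : plane R) : `|z| = Num.max `|z.1| `|z.2|.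
Proof. by []. Qed.

Lemma cvg_plane (R : realType) (T : Type) (F : set_system T) (FF : Filter F)
    (f g : T -> R) (a b : R) : f @ F --> a -> g @ F --> b ->
  (fun t => (f t, g t) : plane R) @ F --> ((a, b) : plane R).
Proof. by move=> fa gb; exact: (cvg_pair fa gb). Qed.

Lemma continuous_plane (R : realType) (T : topologicalType) (f g : T -> R) :
  continuous f -> continuous g -> continuous (fun t => (f t, g t) : plane R).
Proof. by move=> fc gc t; apply: cvg_plane; [exact: fc|exact: gc]. Qed.

Section Rotation.
Context {R : realType}.
Implicit Types (z p q v : plane R) (a b r : R) (rho : R -> R).

Definition rot a z : plane R :=
  (z.1 * cos a - z.2 * sin a, z.1 * sin a + z.2 * cos a).

Lemma rotD a b z : rot a (rot b z) = rot (a + b) z.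
Proof. by rewrite /rot cosD sinD /=; congr pair; ring. Qed.

Lemma rot0 z : rot 0 z = z.
Proof. by case: z => x y; rewrite /rot cos0 sin0 /=; congr pair; ring. Qed.

Lemma rotK a : cancel (rot a) (rot (- a)).
Proof. by move=> z; rewrite rotD addNr rot0. Qed.

Lemma rotNK a : cancel (rot (- a)) (rot a).
Proof. by move=> z; rewrite rotD subrr rot0. Qed.

Lemma rotv0 a : rot a 0 = 0.
Proof. by rewrite /rot /= !mul0r subr0 addr0. Qed.

Lemma sqr_rot a z : (rot a z).1 ^+ 2 + (rot a z).2 ^+ 2 = z.1 ^+ 2 + z.2 ^+ 2.
Proof.
rewrite -[RHS]mulr1 -(cos2Dsin2 a) /rot /=; ring.
Qed.

Lemma enorm_rot a z : enorm (rot a z) = enorm z.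
Proof. by rewrite /enorm sqr_rot. Qed.

Lemma enorm_ge0 z : 0 <= enorm z.
Proof. exact: sqrtr_ge0. Qed.

Lemma sqr_enorm z : enorm z ^+ 2 = z.1 ^+ 2 + z.2 ^+ 2.
Proof. by rewrite sqr_sqrtr// addr_ge0// sqr_ge0. Qed.

Lemma enorm_eq0 z : enorm z = 0 -> z = 0.
Proof.
move=> z0; have := sqr_enorm z; rewrite z0 expr0n /= => /esym/eqP.
rewrite paddr_eq0 ?sqr_ge0// !sqrf_eq0 => /andP[/eqP + /eqP].
by case: z {z0} => x y /= -> ->.
Qed.

Lemma enorm_gt0 z : z <> 0 -> 0 < enorm z.
Proof. by move=> z0; rewrite lt0r enorm_ge0 andbT; apply/eqP => /enorm_eq0. Qed.

Lemma enorm0 : enorm (0 : plane R) = 0.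
Proof. by rewrite /enorm /= expr0n /= addr0 sqrtr0. Qed.

Lemma enorm_continuous : continuous (@enorm R).
Proof.
move=> z; apply: (@continuous_comp _ _ _ (fun z => z.1 ^+ 2 + z.2 ^+ 2) Num.sqrt).
  by apply: cvgD; apply: cvgM; first [exact: cvg_fst|exact: cvg_snd].
exact: sqrt_continuous.
Qed.

Lemma rot_continuous a : continuous (rot a).
Proof.
apply: continuous_plane => z; [apply: cvgB|apply: cvgD]; apply: cvgM;
  by [exact: cvg_fst|exact: cvg_snd|exact: cvg_cst].
Qed.

Lemma twistE rho z : twist rho z = rot (rho (enorm z)) z.
Proof. by []. Qed.

Lemma enorm_twist rho z : enorm (twist rho z) = enorm z.
Proof. by rewrite twistE enorm_rot. Qed.

Lemma twistK rho : cancel (twist rho) (twist (\- rho)).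
Proof. by move=> z; rewrite twistE enorm_twist rotK. Qed.

Lemma twistNK rho : cancel (twist (\- rho)) (twist rho).
Proof. by move=> z; rewrite twistE enorm_twist rotNK. Qed.

(** At the origin [rho] may blow up; continuity there only uses that a rotation by any angle has
    entries bounded by 1. *)
Lemma twist_continuous rho : {in [pred r | 0 < r], continuous rho} ->
  continuous (twist rho).
Proof.
move=> rhoc z; have [->|/eqP z0] := eqVneq z 0.
  rewrite /continuous_at twist0; apply/cvgr0Pnorm_lt => e e0.
  have e20 : 0 < e / 2 by rewrite divr_gt0.
  apply: filterS (nbhsx_ballx (0 : plane R) _ e20) => p /plane_ballE[/=].
  rewrite !sub0r !normrN => p1 p2; rewrite plane_normE gt_max.
  rewrite /twist; set t := rho (enorm p).
  have ct : `|cos t| <= 1 by rewrite ler_norml cos_geN1 cos_le1.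
  have st : `|sin t| <= 1 by rewrite ler_norml sin_geN1 sin_le1.
  have bnd (x y : R) : `|x| <= `|p.1| * 1 -> `|y| <= `|p.2| * 1 ->
      `|x + y| < e.
    move=> xp yp; rewrite (le_lt_trans (ler_normD _ _))// (splitr e).
    by rewrite (le_lt_trans (lerD xp yp))// !mulr1 ltrD.
  apply/andP; split; last by apply: bnd; rewrite normrM ler_wpM2l.
  by apply: bnd; rewrite ?normrN normrM ler_wpM2l.
have rc : (fun p => rho (enorm p)) @ z --> rho (enorm z).
  apply: continuous_comp; first exact: enorm_continuous.
  by apply: rhoc; rewrite inE enorm_gt0.
apply: cvg_plane; [apply: cvgB|apply: cvgD]; apply: cvgM;
  try (by [exact: cvg_fst|exact: cvg_snd]);
  by apply: (cvg_comp _ _ rc); first [exact: continuous_cos|exact: continuous_sin].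
Qed.

End Rotation.

(** * Rotations preserve planar Lebesgue measure, and twists do not decrease it on open sets *)

Section PlaneMeasure.
Context {R : realType}.
Local Notation mplane := (measurableTypeR R * measurableTypeR R)%type.
Local Notation leb := (@lebesgue_measure R).
Local Open Scope ereal_scope.
Implicit Types (A U : set mplane).

Definition leb2 : {measure set mplane -> \bar R} := leb \x leb.

(** The sigma-algebra is the product one, so an open set is exhibited as a countable union of
    rational boxes. *)
Lemma open_measurable2 (U : set (plane R)) : open U -> measurable (U : set mplane).
Proof.
move=> Uo.
pose I := ((rat * rat) * (rat * rat))%type.
pose box (i : I) : set mplane :=
  `]ratr i.1.1, ratr i.1.2[%classic `*` `]ratr i.2.1, ratr i.2.2[%classic.
pose F (i : I) : set mplane := if `[< box i `<=` U >] then box i else set0.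
suff -> : U = \bigcup_i F i.
  apply: countable_bigcupT_measurable => [|i]; first exact: countableP.
 rewrite /F; case: ifP => // _.
  by apply: measurableX; exact: measurable_itv.
apply/seteqP; split => [z Uz|z [i _]]; last first.
  by rewrite /F; case: asboolP => // bU /bU.
have /nbhs_ballP[e /= e0 zU] : \near z, U z by exact: open_nbhs_nbhs.
have dl (x : R) : exists q : rat, (x - e < ratr q < x)%R.
  have [|q] := @rat_in_itvoo R (x - e)%R x; first by rewrite ltrBlDr ltrDl.
  by rewrite in_itv/= => ?; exists q.
have dr (x : R) : exists q : rat, (x < ratr q < x + e)%R.
  have [|q] := @rat_in_itvoo R x (x + e)%R; first by rewrite ltrDl.
  by rewrite in_itv/= => ?; exists q.
have [a1 /andP[a1l a1r]] := dl z.1; have [b1 /andP[b1l b1r]] := dr z.1.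
have [a2 /andP[a2l a2r]] := dl z.2; have [b2 /andP[b2l b2r]] := dr z.2.
exists ((a1, b1), (a2, b2)) => //; rewrite /F; case: asboolP => [_|[]].
  by split; rewrite /= in_itv/=; apply/andP.
move=> p [/=]; rewrite !in_itv/= => /andP[? ?] /andP[? ?]; apply: zU.
by apply/plane_ballE; rewrite !ltr_distlC; split; apply/andP; split; lra.
Qed.

Lemma continuous_measurable2 (f : plane R -> plane R) :
  continuous f -> measurable_fun setT (f : mplane -> mplane).
Proof.
move=> fc; apply/measurable_fun_pairP; split => _ /= Y mY; rewrite setTI.
- suff : measurable_fun setT (fst \o f : mplane -> measurableTypeR R).
    by move=> /(_ measurableT Y mY); rewrite setTI.
  apply: (measurability _ (@RGenOpens.measurableE R)) => // _ [_ [a [b ->]] <-].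
  rewrite setTI; apply: open_measurable2; apply: open_comp => [z _|].
    by apply: continuous_comp; [exact: fc|exact: cvg_fst].
  exact: interval_open.
- suff : measurable_fun setT (snd \o f : mplane -> measurableTypeR R).
    by move=> /(_ measurableT Y mY); rewrite setTI.
  apply: (measurability _ (@RGenOpens.measurableE R)) => // _ [_ [a [b ->]] <-].
  rewrite setTI; apply: open_measurable2; apply: open_comp => [z _|].
    by apply: continuous_comp; [exact: fc|exact: cvg_snd].
  exact: interval_open.
Qed.

Lemma measurable_preimage2 (f : plane R -> plane R) A : continuous f ->
  measurable A -> measurable ((f @^-1` A) : set mplane).
Proof.
by move=> /continuous_measurable2 mf mA; rewrite -[X in measurable X]setTI; exact: mf.
Qed.

Lemma lebesgue_translation (k : R) (Y : set (measurableTypeR R)) : measurable Y ->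
  leb ((fun x => x + k)%R @^-1` Y) = leb Y.
Proof.
move=> mY.
pose f : measurableTypeR R -> measurableTypeR R := fun x => (x + k)%R.
have mf : measurable_fun setT f by apply: (@measurable_funD _ _ _ setT id (cst k)).
refine (esym (@lebesgue_measure_unique R (pushforward leb f) _ Y mY)) => //.
move=> _ [[a b]] _ <- /=.
rewrite /pushforward (_ : _ @^-1` _ = `](a - k)%R, (b - k)%R]%classic).
  rewrite !lebesgue_measure_itv/= !lte_fin ltrD2r.
  by case: ifP => // _; rewrite -!EFinD; congr EFin; ring.
by apply/seteqP; split => x /=; rewrite !in_itv/= ltrBlDr lerBrDr.
Unshelve. all: exact: mf. Qed.

(** A shear translates the sections in one direction only. For the other shear the iterated integral
    has to be taken in the other order. *)
Lemma leb2_swap A : measurable A -> leb2 A = (leb \x^ leb) A.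
Proof.
by move=> mA; apply: product_measure_unique => // B C mB mC; exact: product_measure2E.
Qed.

Lemma leb2_shear2 (k : R) A : measurable A ->
  leb2 ((fun z : plane R => (z.1, z.2 + k * z.1)%R) @^-1` A) = leb2 A.
Proof.
move=> mA; rewrite /leb2 /= /product_measure1; apply: eq_integral => x _ /=.
rewrite -(lebesgue_translation (k * x)%R (measurable_xsection x mA)).
by congr (leb _); apply/seteqP; split => y /=; rewrite !xsectionE.
Qed.

Lemma leb2_shear1 (k : R) A : measurable A ->
  leb2 ((fun z : plane R => (z.1 + k * z.2, z.2)%R) @^-1` A) = leb2 A.
Proof.
move=> mA; rewrite !leb2_swap//; last first.
  apply: measurable_preimage2 => //; apply: continuous_plane => z; last exact: cvg_snd.
  by apply: cvgD; [exact: cvg_fst|apply: cvgM; [exact: cvg_cst|exact: cvg_snd]].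
rewrite /product_measure2; apply: eq_integral => y _ /=.
rewrite -(lebesgue_translation (k * y)%R (measurable_ysection y mA)).
by congr (leb _); apply/seteqP; split => x /=; rewrite !ysectionE.
Qed.

(* A rotation whose half angle has nonzero cosine is a product of three shears. *)
Lemma leb2_rot_shear (a : R) A : (cos a != 0)%R -> measurable A ->
  leb2 (rot (a + a) @^-1` A) = leb2 A.
Proof.
move=> ca mA; pose s1 (k : R) (z : plane R) : plane R := (z.1 + k * z.2, z.2)%R.
pose s2 (k : R) (z : plane R) : plane R := (z.1, z.2 + k * z.1)%R.
have s1c k : continuous (s1 k).
  apply: continuous_plane => z; last exact: cvg_snd.
  by apply: cvgD; [exact: cvg_fst|apply: cvgM; [exact: cvg_cst|exact: cvg_snd]].
have s2c k : continuous (s2 k).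
  apply: continuous_plane => z; first exact: cvg_fst.
  by apply: cvgD; [exact: cvg_snd|apply: cvgM; [exact: cvg_cst|exact: cvg_fst]].
have -> : rot (a + a) = s1 (- (sin a / cos a))%R \o s2 (sin (a + a))%R \o
    s1 (- (sin a / cos a))%R.
  apply/funext => -[x y]; rewrite /rot /s1 /s2 /= sinD cosD.
  have c2 := cos2sin2 a.
  congr pair; apply/eqP; rewrite -subr_eq0; apply/eqP.
    rewrite [LHS](_ : _ = (x * (cos a ^+ 2 - (1 - sin a ^+ 2)) -
      y * (sin a / cos a) * (2 * (cos a ^+ 2 - (1 - sin a ^+ 2))))%R).
      by rewrite c2; ring.
    by field.
  rewrite [LHS](_ : _ = (y * (cos a ^+ 2 - (1 - sin a ^+ 2)))%R).
    by rewrite c2; ring.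
  by field.
rewrite !comp_preimage leb2_shear1 ?leb2_shear2 ?leb2_shear1//.
- exact: measurable_preimage2.
- by apply: measurable_preimage2 => //; exact: measurable_preimage2.
Qed.

Lemma leb2_rot (a : R) A : measurable A -> leb2 (rot a @^-1` A) = leb2 A.
Proof.
move=> mA; have aE (x : R) : (x = x / 2 + x / 2)%R by exact: splitr.
have [c0|c0] := eqVneq (cos (a / 2)) 0%R; last first.
  by rewrite (aE a) leb2_rot_shear.
(* The shears are undefined when [cos (a / 2)] vanishes. The rotation is then done in two halves,
   and the double angle formula shows that the halves are not exceptional. *)
have c20 : cos (a / 2 / 2)%R != 0%R.
  apply/eqP => c20; move/eqP: c0; rewrite (aE (a / 2)%R) cosD c20 mul0r sub0r.
  by rewrite oppr_eq0 -expr2 sin2cos2 c20 expr0n/= subr0 oner_eq0.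
have -> : rot a = rot (a / 2)%R \o rot (a / 2)%R.
  by apply/funext => z /=; rewrite rotD -aE.
have m1 : measurable ((rot (a / 2)%R @^-1` A) : set mplane).
  by apply: measurable_preimage2 => //; exact: rot_continuous.
by rewrite comp_preimage (aE (a / 2)%R) !leb2_rot_shear// -?aE.
Qed.

(** Cuts the plane into annuli of width 1 / (n + 1) and numbers them from the centre. *)
Let idx (n : nat) (z : plane R) : nat := Num.truncn (enorm z * n.+1%:R)%R.

Let idx_rot n a z : idx n (rot a z) = idx n z.
Proof. by rewrite /idx enorm_rot. Qed.

Let idx_measurable n k : measurable ([set z | idx n z = k] : set mplane).
Proof.
pose O (x : R) : set (plane R) := [set z | (enorm z < x)%R].
have Oo x : open (O x).
  apply: (@open_comp _ _ (@enorm R) [set y | (y < x)%R]); last exact: open_lt.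
  by move=> z _; exact: enorm_continuous.
suff -> : [set z | idx n z = k] = O (k.+1%:R / n.+1%:R)%R `\` O (k%:R / n.+1%:R)%R.
  by apply: measurableD; exact: open_measurable2.
have n0 : (0 < n.+1%:R :> R)%R by rewrite ltr0n.
apply/seteqP; split => z /=; rewrite /idx /O /=.
  move=> <-; have := @truncn_itv R (enorm z * n.+1%:R)%R.
  rewrite mulr_ge0 ?enorm_ge0// => /(_ isT)/andP[t1 t2].
  rewrite ltr_pdivlMr//; split => //; apply/negP; rewrite -leNgt.
  by rewrite ler_pdivrMr.
rewrite ltr_pdivlMr// => -[t1 /negP]; rewrite -leNgt ler_pdivrMr// => t2.
by apply/eqP; rewrite truncn_eq ?t2// mulr_ge0// enorm_ge0.
Qed.

(** Each annulus is invariant under rotations, so the measure is preserved annulus by annulus,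
    whatever the angles [s]. *)
Lemma leb2_step_twist (s : nat -> R) n U : measurable U ->
  measurable ([set z | U (rot (s (idx n z)) z)] : set mplane) /\
  leb2 [set z | U (rot (s (idx n z)) z)] = leb2 U.
Proof.
move=> mU.
pose A k : set mplane := [set z | idx n z = k].
have triv (B : set mplane) : trivIset setT (fun k => A k `&` B).
  by move=> i j _ _ [z [[<- _] [<- _]]].
have -> : [set z | U (rot (s (idx n z)) z)] =
    \bigcup_k (A k `&` (rot (s k) @^-1` U)).
  apply/seteqP; split => [z Uz|z [k _ [<-]]//].
  by exists (idx n z).
have mrot k : measurable ((A k `&` (rot (s k) @^-1` U)) : set mplane).
  apply: measurableI; first exact: idx_measurable.
  by apply: measurable_preimage2 => //; exact: rot_continuous.
split; first exact: bigcupT_measurable.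
have {2}-> : U = \bigcup_k (A k `&` U).
  apply/seteqP; split => [z Uz|z [k _ [_ ]]//].
  by exists (idx n z).
have mAU k : measurable ((A k `&` U) : set mplane).
  by apply: measurableI => //; exact: idx_measurable.
have trot : trivIset setT (fun k => A k `&` (rot (s k) @^-1` U)).
  by move=> i j _ _ [z [[<- _] [<- _]]].
rewrite [LHS]measure_semi_bigcup; [|exact: mrot|exact: trot|exact: bigcupT_measurable].
rewrite [RHS]measure_semi_bigcup; [|exact: mAU|exact: triv|exact: bigcupT_measurable].
apply: eq_eseriesr => k _; rewrite -(leb2_rot (s k) (mAU k)).
by congr (leb2 _); apply/seteqP; split => z /=; rewrite /A /= idx_rot.
Qed.

Lemma idx_cvg (z : plane R) :
  ((idx n z)%:R / n.+1%:R)%R @[n --> \oo] --> enorm z.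
Proof.
apply/cvgrPdist_le => e e0.
have := @near_infty_natSinv_lt R (PosNum e0); apply: filterS => n /= ne.
have n0 : (0 < n.+1%:R :> R)%R by rewrite ltr0n.
have := @truncn_itv R (enorm z * n.+1%:R)%R.
rewrite mulr_ge0 ?enorm_ge0// => /(_ isT)/andP[t1 t2].
have h1 : ((idx n z)%:R / n.+1%:R <= enorm z)%R by rewrite ler_pdivrMr.
have h2 : (enorm z <= (idx n z)%:R / n.+1%:R + n.+1%:R^-1)%R.
  by rewrite -[X in (_ + X)%R]mul1r -mulrDl ler_pdivlMr// natr1 ltW.
rewrite ger0_norm ?subr_ge0// lerBlDl (le_trans h2)// lerD2l ltW//.
Qed.

(* The twist is a pointwise limit of maps rotating each of the annuli
   k <= n * enorm z < k + 1 by a constant angle, and Fatou's lemma for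
   preimages of an open set gives one inequality. *)
Lemma leb2_twist_le (rho : R -> R) (U : set (plane R)) :
  {in [pred r | (0 < r)%R], continuous rho} -> open U ->
  leb2 (twist rho @^-1` U) <= leb2 U.
Proof.
move=> rhoc Uo.
pose s n k : R := rho (k%:R / n.+1%:R)%R.
pose S n : set mplane := [set z | U (rot (s n (idx n z)) z)].
pose B N : set mplane := \bigcap_(n in [set n | (N <= n)%N]) S n.
have mU := open_measurable2 Uo.
have mS n : measurable (S n) by have [] := leb2_step_twist (s n) n mU.
have mB N : measurable (B N).
  by rewrite /B bigcap_mkcond; apply: bigcapT_measurable => n; case: ifP.
have mUB : measurable (\bigcup_N B N) by exact: bigcupT_measurable.
have ndB : nondecreasing_seq B.
  move=> n m nm; apply/subsetPset => z Bz k /= mk; apply: Bz => /=.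
  exact: leq_trans mk.
(* [U] is open and the approximations converge pointwise: a point twisted into [U] is sent into [U]
   by all late approximations. *)
have sub : twist rho @^-1` U `<=` \bigcup_N B N.
  move=> z /= Uz.
  have cv : rot (s n (idx n z)) z @[n --> \oo] --> twist rho z.
    have [->|/eqP z0] := eqVneq z 0%R.
      rewrite twist0; apply: cvg_near_cst; apply: nearW => n; exact: rotv0.
    have sc : s n (idx n z) @[n --> \oo] --> rho (enorm z).
      have rc : rho @ enorm z --> rho (enorm z) by apply: rhoc; rewrite inE enorm_gt0.
      have := cvg_comp (fun n => (idx n z)%:R / n.+1%:R)%R rho (@idx_cvg z) rc.
      rewrite /comp; apply: cvg_trans; apply: near_eq_cvg; exact: nearW.
    apply: cvg_plane; [apply: cvgB|apply: cvgD]; apply: cvgM;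
      try exact: cvg_cst;
      by apply: (cvg_comp _ _ sc); first [exact: continuous_cos|exact: continuous_sin].
  have [N _ NU] := cv _ (open_nbhs_nbhs (conj Uo Uz)).
  by exists N => // n /= Nn; exact: NU.
have mT : measurable ((twist rho @^-1` U) : set mplane).
  by apply: measurable_preimage2 => //; exact: twist_continuous.
(* The measure of the union is the limit of those of the [B N], and [B N] lies in [S N], which has
   the measure of [U]. *)
have cv := @nondecreasing_cvg_mu _ _ _ leb2 B mB mUB ndB.
apply: (@le_trans _ _ (leb2 (\bigcup_N B N))).
  by apply: le_measure; rewrite ?inE.
apply: (cvge_le _ cv); apply: nearW => N /=.
have [_ <-] := leb2_step_twist (s N) N mU.
apply: le_measure; [rewrite inE; exact: mB|rewrite inE; exact: (mS N)|].
by move=> z; apply => /=.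
Qed.

End PlaneMeasure.

(** * Algebra of locally Lipschitz functions *)

Section LocalLipschitz.
Context {R : realType}.
Implicit Types (f g : plane R -> R) (z p q : plane R).

Definition loclip f z := exists d L : R, [/\ 0 < d, 0 < L &
  forall p q, ball z d p -> ball z d q ->
    `|f p - f q| <= L * (`|p.1 - q.1| + `|p.2 - q.2|)].

Lemma sdiff_loclip f z a b : sdiff f z a b -> loclip f z.
Proof. by move=> /sdiff_lip[d [L [d0 L0 H]]]; exists d, L. Qed.

Lemma loclipS f z (d0 : R) : 0 < d0 -> loclip f z -> exists d L : R,
  [/\ 0 < d, d <= d0, 0 < L & forall p q, ball z d p -> ball z d q ->
    `|f p - f q| <= L * (`|p.1 - q.1| + `|p.2 - q.2|)].
Proof.
move=> d00 [d [L [dp L0 H]]]; exists (Num.min d d0), L; split => //.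
- by rewrite lt_min dp.
- by rewrite ge_min lexx orbT.
- move=> p q zp zq; apply: H.
    by apply: le_ball zp; rewrite ge_min lexx.
  by apply: le_ball zq; rewrite ge_min lexx.
Qed.

Lemma loclip_near f z (e : R) : 0 < e -> loclip f z -> exists2 d : R, 0 < d &
  forall p, ball z d p -> `|f p - f z| <= e.
Proof.
move=> e0 [d [L [d0 L0 H]]]; exists (Num.min d (e / L / 2)).
  by rewrite lt_min d0 !divr_gt0.
move=> p zp.
have zp1 : ball z d p by apply: le_ball zp; rewrite ge_min lexx.
have : ball z (e / L / 2) p by apply: le_ball zp; rewrite ge_min lexx orbT.
move=> /plane_ballE[b1 b2].
rewrite (le_trans (H _ _ zp1 (ballxx _ d0)))//.
have -> : e = L * (e / L / 2 + e / L / 2) by field; rewrite gt_eqF.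
rewrite ler_pM2l// distrC [X in _ + X]distrC.
by rewrite ltW// ltrD.
Qed.

Lemma loclip_bound f z : loclip f z -> exists d B : R,
  [/\ 0 < d, 0 < B & forall p, ball z d p -> `|f p| <= B].
Proof.
move=> /(loclip_near ltr01)[d d0 H]; exists d, (`|f z| + 1); split => //.
move=> p /H; rewrite -[X in `|X| <= _ + _](subrK (f z)) => le1.
by rewrite (le_trans (ler_normD _ _))// addrC lerD2l.
Qed.

Lemma loclipN f z : loclip f z -> loclip (fun p => - f p) z.
Proof.
move=> [d [L [d0 L0 H]]]; exists d, L; split => // p q zp zq.
by rewrite -opprD normrN; exact: H.
Qed.

Lemma loclipM f g z : loclip f z -> loclip g z -> loclip (fun p => f p * g p) z.
Proof.
move=> fl gl; have [d1 [B [d10 B0 fB]]] := loclip_bound fl.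
have [d2 [C [d20 C0 gC]]] := loclip_bound gl.
have [d3 [L [d30 d31 L0 fL]]] := loclipS d10 fl.
have [d4 [K [d40 d42 K0 gK]]] := loclipS d20 gl.
exists (Num.min d3 d4), (B * K + C * L); split => //.
- by rewrite lt_min d30.
- by rewrite addr_gt0// mulr_gt0.
move=> p q zp zq.
have dd3 : Num.min d3 d4 <= d3 by rewrite ge_min lexx.
have dd4 : Num.min d3 d4 <= d4 by rewrite ge_min lexx orbT.
have fpB := fB p (le_ball d31 (le_ball dd3 zp)).
have gqC := gC q (le_ball d42 (le_ball dd4 zq)).
have fpq := fL p q (le_ball dd3 zp) (le_ball dd3 zq).
have gpq := gK p q (le_ball dd4 zp) (le_ball dd4 zq).
have -> : f p * g p - f q * g q = f p * (g p - g q) + g q * (f p - f q) by ring.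
rewrite (le_trans (ler_normD _ _))// !normrM mulrDl -!mulrA.
by apply: lerD; apply: ler_pM.
Qed.

Lemma loclipV f z : f z != 0 -> loclip f z -> loclip (fun p => (f p)^-1) z.
Proof.
move=> fz0 fl; have nf0 : 0 < `|f z| by rewrite normr_gt0.
have nf2 : 0 < `|f z| / 2 by rewrite divr_gt0.
have [d1 d10 fn] := loclip_near nf2 fl.
have [d [L [d0 dd1 L0 fL]]] := loclipS d10 fl.
have big p : ball z d p -> `|f z| / 2 <= `|f p|.
  move=> /(le_ball dd1)/fn; rewrite distrC => h.
  have : `|f z| <= `|f z - f p| + `|f p|.
    by rewrite -{1}(subrK (f p) (f z)) ler_normD.
  lra.
exists d, (L * (2 / `|f z|) * (2 / `|f z|)); split => //.
  by rewrite !mulr_gt0// invr_gt0.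
move=> p q zp zq; have fp0 := big p zp; have fq0 := big q zq.
have pn0 : f p != 0 by rewrite -normr_gt0 (lt_le_trans nf2).
have qn0 : f q != 0 by rewrite -normr_gt0 (lt_le_trans nf2).
have -> : (f p)^-1 - (f q)^-1 = (f q - f p) * ((f p)^-1 * (f q)^-1).
  by field; rewrite pn0 qn0.
rewrite !normrM !normfV distrC.
set N := `|p.1 - q.1| + _.
rewrite (_ : L * _ * _ * N = (L * N) * ((2 / `|f z|) * (2 / `|f z|))); last ring.
have iv x : `|f z| / 2 <= x -> x^-1 <= 2 / `|f z|.
  by move=> hx; rewrite -[leRHS]invf_div lef_pV2// posrE// (lt_le_trans nf2).
apply: ler_pM => //; first exact: fL.
by apply: ler_pM; rewrite ?invr_ge0//; exact: iv.
Qed.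

End LocalLipschitz.

(** * Gronwall's inequality and uniqueness for differential equations *)

Section Gronwall.
Context {R : realType}.

Lemma is_derive_ext (V W : normedModType R) (f g : V -> W) (x v : V) (d d' : W) :
  is_derive x v f d -> f =1 g -> d = d' -> is_derive x v g d'.
Proof. by move=> fd /funext <- <-. Qed.

Lemma is_derive_expRM (k s : R) :
  is_derive s 1 (fun s => expR (k * s)) (k * expR (k * s)).
Proof.
have -> : (fun s => expR (k * s)) = expR \o (fun s => k * s) by [].
have h : is_derive s 1 (fun s : R => k * s) k.
  by have := is_derive_affine (0 : R) k s; under eq_fun do rewrite add0r [_ *: _]mulrC.
apply: is_derive_ext (is_derive1_comp (is_derive_expR (k * s)) h) _ _ => //.
by rewrite mulrC.
Qed.

(** The product [e s * expR (- K * s)] has nonpositive derivative and starts at 0. *)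
Lemma gronwall_right (e de : R -> R) (K t0 t : R) : t0 <= t ->
  (forall s, t0 <= s <= t -> is_derive s 1 e (de s) /\ de s <= K * e s) ->
  e t0 = 0 -> e t <= 0.
Proof.
move=> t0t H e0.
pose dg s := de s * expR (- K * s) + e s * (- K * expR (- K * s)).
have [s|s sin] := @partial_MVT R (fun s => e s * expR (- K * s)) dg t t0.
  rewrite (min_idPr t0t) (max_idPl t0t) => /H[ed _].
  have ex := is_derive_expRM (- K) s.
  apply: is_derive_ext (is_deriveM ed ex) _ _ => //.
  by rewrite /dg -![_ *: _]/(_ * _); ring.
rewrite (min_idPr t0t) (max_idPl t0t) in sin.
have [_ les] := H s sin; rewrite e0 mul0r subr0 => E.
have : e t * expR (- K * t) <= 0.
  rewrite E mulr_ge0_le0 ?subr_ge0// /dg.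
  rewrite (_ : _ + _ = (de s - K * e s) * expR (- K * s)); last ring.
  by rewrite mulr_le0_ge0 ?expR_ge0// subr_le0.
by rewrite pmulr_lle0 ?expR_gt0.
Qed.

Lemma gronwall (e de : R -> R) (K t0 d : R) :
  (forall s, `|s - t0| < d -> is_derive s 1 e (de s) /\ `|de s| <= K * e s) ->
  (forall s, 0 <= e s) -> e t0 = 0 -> forall t, `|t - t0| < d -> e t = 0.
Proof.
move=> H e_ge0 e0 t td; apply/eqP; rewrite eq_le e_ge0 andbT.
have [t0t|/ltW tt0] := leP t0 t.
  apply: (gronwall_right (K := K) (de := de) t0t) => // s /andP[t0s st].
  have [|ed el] := H s.
    by move: td; rewrite !ger0_norm ?subr_ge0//; lra.
  by split => //; exact: le_trans (ler_norm _) el.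
have := @gronwall_right (fun s => e (- s)) (fun s => - de (- s)) K (- t0) (- t).
rewrite lerN2 !opprK; apply => // s /andP[t0s st].
have [|ed el] := H (- s).
  by move: td; rewrite !ler0_norm ?subr_le0//; lra.
split; last by rewrite (le_trans (ler_norm _))// normrN.
have -> : (fun s => e (- s)) = e \o -%R by [].
by apply: is_derive_ext (is_derive1_comp ed (is_deriveNid s (1 : R))) _ _; rewrite ?mulrN1.
Qed.

Lemma ode_local_unique (X : plane R -> plane R) (z : plane R)
    (u v : R -> plane R) (t0 : R) :
  loclip (fun p => (X p).1) z -> loclip (fun p => (X p).2) z ->
  u t0 = z -> v t0 = z ->
  (\forall t \near t0, is_derive (t : R) 1 u (X (u t))) ->
  (\forall t \near t0, is_derive (t : R) 1 v (X (v t))) ->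
  \forall t \near t0, u t = v t.
Proof.
move=> X1 X2 ut vt ud vd.
have [d1 [L1 [d10 L10 XL1]]] := X1; have [d2 [L2 [d20 d21 L20 XL2]]] := loclipS d10 X2.
have ub : \forall t \near t0, ball z d2 (u t).
  have := is_derive_cvg (nbhs_singleton ud).
  by apply; rewrite ut; exact: nbhsx_ballx.
have vb : \forall t \near t0, ball z d2 (v t).
  have := is_derive_cvg (nbhs_singleton vd).
  by apply; rewrite vt; exact: nbhsx_ballx.
have [d /= d0 H] : nbhs_ball t0 (fun t => [/\ is_derive t 1 u (X (u t)),
    is_derive t 1 v (X (v t)), ball z d2 (u t) & ball z d2 (v t)]).
  by apply/nbhs_ballP; near=> t; split; near: t.
pose e t := ((u t).1 - (v t).1) ^+ 2 + ((u t).2 - (v t).2) ^+ 2.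
pose de t := 2 * ((u t).1 - (v t).1) * ((X (u t)).1 - (X (v t)).1) +
             2 * ((u t).2 - (v t).2) * ((X (u t)).2 - (X (v t)).2).
have ez : forall t, `|t - t0| < d -> e t = 0.
  (* With a and b the coordinate distances, the squared distance [e] has derivative at most 2 (L1 +
     L2) (a + b)^2 in absolute value, and (a + b)^2 <= 2 (a^2 + b^2). *)
  apply: (@gronwall e de (4 * (L1 + L2))).
  - move=> s; rewrite distrC => /H[us vs ubs vbs].
    move/is_derive_pairP: us => [u1 u2]; move/is_derive_pairP: vs => [v1 v2].
    split.
      have a1 : is_derive s 1 (fun t => (u t).1 - (v t).1) _ := is_deriveB u1 v1.
      have a2 : is_derive s 1 (fun t => (u t).2 - (v t).2) _ := is_deriveB u2 v2.
      have := is_deriveD (is_deriveM a1 a1) (is_deriveM a2 a2).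
      move=> h; apply: (is_derive_ext h).
        by move=> t; rewrite /e !expr2.
      by rewrite /de -![_ *: _]/(_ * _) /=; ring.
    have := XL1 _ _ (le_ball d21 ubs) (le_ball d21 vbs).
    have := XL2 _ _ ubs vbs; rewrite /de /e.
    set a := (u s).1 - _; set b := (u s).2 - _.
    set x1 := (X _).1 - _; set x2 := (X _).2 - _ => x2L x1L.
    rewrite (le_trans (ler_normD _ _))// !normrM ger0_norm//.
    rewrite -[a ^+ 2]ger0_norm ?sqr_ge0// -[b ^+ 2]ger0_norm ?sqr_ge0// !normrX.
    have a0 := normr_ge0 a; have b0 := normr_ge0 b.
    move: `|a| `|b| `|x1| `|x2| x1L x2L a0 b0 => {}a {}b {}x1 {}x2 x1L x2L a0 b0.
    have ab : (a + b) ^+ 2 <= 2 * (a ^+ 2 + b ^+ 2).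
      have := sqr_ge0 (a - b); rewrite sqrrB sqrrD; lra.
    apply: (@le_trans _ _ (2 * a * (L1 * (a + b)) + 2 * b * (L2 * (a + b)))).
      by apply: lerD; rewrite ler_wpM2l// mulr_ge0.
    apply: (@le_trans _ _ (2 * (L1 + L2) * (a + b) ^+ 2)); last first.
      rewrite (_ : 4 * (L1 + L2) * _ = 2 * (L1 + L2) * (2 * (a ^+ 2 + b ^+ 2))).
        by rewrite ler_wpM2l// mulr_ge0// addr_ge0// ltW.
      by ring.
    rewrite -subr_ge0 (_ : _ - _ = 2 * (a + b) * (L1 * b + L2 * a)); last ring.
    have := ltW L10; have := ltW L20 => ? ?.
    by rewrite !(mulr_ge0, addr_ge0).
  - by move=> s; rewrite addr_ge0// sqr_ge0.
  - by rewrite /e ut vt !subrr expr0n/= addr0.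
apply/nbhs_ballP; exists d => //= t; rewrite /ball/= distrC => /ez/eqP.
rewrite /e paddr_eq0 ?sqr_ge0// !sqrf_eq0 !subr_eq0 => /andP[/eqP + /eqP].
by case: (u t) (v t) => [a b] [a' b'] /= -> ->.
Unshelve. all: by end_near. Qed.

End Gronwall.

(** * Hamiltonian vector fields in charts and uniqueness of their flows *)

Section HamiltonianFlow.
Context {R : realType} (M : symplectic_surface R).
Implicit Types (c : chart R M) (z u v X : plane R) (G : M -> R).

Lemma chart_imgP c p : chart_dom c p -> chart_img c (c p).
Proof. by exists p. Qed.

Lemma chart_invK c z : chart_img c z -> c (chart_inv c z) = z.
Proof. by move=> [p cp <-]; rewrite chart_mapK. Qed.

Lemma chart_inv_dom c z : chart_img c z -> chart_dom c (chart_inv c z).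
Proof. by move=> [p cp <-]; rewrite chart_mapK. Qed.

Lemma near_chart_dom c p : chart_dom c p -> \forall q \near p, chart_dom c q.
Proof. by move=> cp; apply: open_nbhs_nbhs; split => //; exact: chart_dom_open. Qed.

Lemma near_chart_img c z : chart_img c z -> \forall w \near z, chart_img c w.
Proof. by move=> cz; apply: open_nbhs_nbhs; split => //; exact: chart_img_open. Qed.

(** The solution of iota_X omega = dG, read off from the values of both sides on the two basis
    vectors. *)
Definition hvec G c z : plane R :=
  ('D_(0, 1) (G \o chart_inv c) z / omega_coef c z,
   - 'D_(1, 0) (G \o chart_inv c) z / omega_coef c z).

Lemma smooth_sdiff G c z : smooth_fun G -> atlas c -> chart_img c z ->
  sdiff (G \o chart_inv c) z ('D_(1, 0) (G \o chart_inv c) z)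
    ('D_(0, 1) (G \o chart_inv c) z).
Proof.
move=> Gs ca cz; by apply: (Cn1_sdiff (@chart_img_open _ _ c) cz); exact: (Gs c ca 1).
Qed.

Lemma ham_vectorP G c z X : smooth_fun G -> atlas c -> chart_img c z ->
  ham_vector G c z X <-> X = hvec G c z.
Proof.
move=> Gs ca cz; have w0 := omega_nondegenerate ca cz.
have DE v : 'D_v (G \o chart_inv c) z = v.1 * 'D_(1, 0) (G \o chart_inv c) z +
    v.2 * 'D_(0, 1) (G \o chart_inv c) z.
  by have [_ ->] := sdiff_derive v (smooth_sdiff Gs ca cz).
split=> [XH|->].
  rewrite [X]surjective_pairing /hvec; congr pair.
    have <- := XH (0, 1); rewrite /omega /= mulr1 mulr0 subr0.
    by field.
  have <- := XH (1, 0); rewrite /omega /= mulr1 mulr0 sub0r.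
  by field.
move=> v; rewrite DE /omega /hvec /=; by field.
Qed.

Lemma hvec_loclip G c z : smooth_fun G -> atlas c -> chart_img c z ->
  loclip (fun z => (hvec G c z).1) z /\ loclip (fun z => (hvec G c z).2) z.
Proof.
move=> Gs ca cz; have w0 := omega_nondegenerate ca cz.
have [_ d1 d2] := Gs c ca 2.
have o : open (chart_img c) := @chart_img_open _ _ c.
have wl : loclip (fun z => (omega_coef c z)^-1) z.
  apply: loclipV => //; apply: sdiff_loclip.
  exact: (Cn1_sdiff o cz (omega_smooth ca 1)).
have l1 := sdiff_loclip (Cn1_sdiff o cz d1).
have l2 := sdiff_loclip (Cn1_sdiff o cz d2).
by split; [exact: (loclipM l2 wl)|exact: (loclipM (loclipN l1) wl)].
Qed.

Definition solves G (al : R -> M) (t : R) c := [/\ atlas c, chart_dom c (al t) &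
  is_derive t 1 (fun s => c (al s)) (hvec G c (c (al t)))].

Lemma hausdorff_eq_closed (T : topologicalType) (al be : T -> M) :
  continuous al -> continuous be -> closed [set t | al t = be t].
Proof.
move=> alc bec; rewrite -[X in closed X]setCK; apply: open_closedC.
rewrite openE => t /= /eqP ne; rewrite /interior.
have := @surface_hausdorff R M; rewrite open_hausdorff => /(_ _ _ ne)[[A B] /=].
rewrite !inE => -[At Bt] [Ao Bo /eqP AB0].
have An : \forall s \near t, A (al s) by apply: alc; exact: open_nbhs_nbhs.
have Bn : \forall s \near t, B (be s) by apply: bec; exact: open_nbhs_nbhs.
apply: filterS2 An Bn => s As Bs /= E.
have : (A `&` B) (al s) by split => //; rewrite E.
suff -> : A `&` B = set0 by [].
by first [exact: AB0|exact/eqP].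
Qed.

(** The continuity method: both [P] and its negation are relatively open in the connected set [A].
    It carries the global arguments below, on the time line, on segments and on rays. *)
Lemma connected_all (T : topologicalType) (A : set T) (P : T -> Prop) :
  connected A -> (exists2 t, A t & P t) ->
  (forall t, A t -> P t -> \forall s \near t, A s -> P s) ->
  (forall t, A t -> ~ P t -> \forall s \near t, A s -> ~ P s) ->
  forall t, A t -> P t.
Proof.
move=> Ac [t0 At0 Pt0] Po Pc.
suff E : A `&` [set t | P t] = A by move=> t; rewrite -{1}E => -[].
apply: Ac.
- by exists t0.
- exists ([set t | A t -> P t]^°); first exact: open_interior.
  apply/seteqP; split => t [At] /=.
    by move=> Pt; split => //; exact: Po.
  by move=> /interior_subset /= /(_ At).
- exists (~` ([set t | A t -> ~ P t]^°)); first exact/open_closedC/open_interior.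
  apply/seteqP; split => t [At] /=.
    by move=> Pt; split => // /interior_subset /= /(_ At).
  move=> ni; split => //; apply: contrapT => nPt; apply: ni.
  exact: Pc.
Qed.

Lemma connected_R : connected [set: R].
Proof. by apply/connected_intervalP => x y _ _ z _. Qed.

(** The times of agreement form an open set by uniqueness in a chart and a closed set because [M] is
    Hausdorff. The differential equation is only asked for near such times. *)
Lemma flow_unique G (al be : R -> M) (t0 : R) : smooth_fun G ->
  continuous al -> continuous be -> al t0 = be t0 ->
  (forall t : R, al t = be t -> exists c,
     \forall s \near t, solves G al s c /\ solves G be s c) ->
  al = be.
Proof.
move=> Gs alc bec e0 H; apply/funext => t.
apply: (@connected_all R setT (fun t => al t = be t)) => //.
- exact: connected_R.
- by exists t0.
- move=> {}t _ et; have [c Hc] := H t et.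
  have [[ca cat alt] [_ cbt bet]] := nbhs_singleton Hc.
  have ci := chart_imgP cat.
  have [l1 l2] := hvec_loclip Gs ca ci.
  have := @ode_local_unique R (hvec G c) (c (al t)) (c \o al) (c \o be) t l1 l2 erefl.
  rewrite /= -et => /(_ erefl) h.
  have N1 : \forall s \near t, is_derive (s : R) 1 (c \o al) (hvec G c (c (al s))).
    by apply: filterS Hc => s [[_ _ ?] _].
  have N2 : \forall s \near t, is_derive (s : R) 1 (c \o be) (hvec G c (c (be s))).
    by apply: filterS Hc => s [_ [_ _ ?]].
  apply: filterS2 Hc (h N1 N2) => s [[_ c1 _] [_ c2 _]] E _.
  by rewrite -(chart_mapK c1) E chart_mapK.
- move=> {}t _ net.
  have := hausdorff_eq_closed alc bec; rewrite -openC => o.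
  by apply: filterS (open_nbhs_nbhs (conj o net)) => s /= + _.
Qed.

Lemma flow_solves G phi p c (t : R) : smooth_fun G -> ham_flow G phi -> atlas c ->
  chart_dom c (phi t p) -> solves G (phi ^~ p) t c.
Proof.
move=> Gs Gf ca cp; have [_ _ /(_ t c ca cp)[X HX dX]] := Gf p.
by move/(ham_vectorP X Gs ca (chart_imgP cp)): HX => HX; split => //; rewrite -HX.
Qed.

Lemma near_flow_solves G phi p c (t : R) : smooth_fun G -> ham_flow G phi ->
  atlas c -> chart_dom c (phi t p) -> \forall s \near t, solves G (phi ^~ p) s c.
Proof.
move=> Gs Gf ca cp; have [_ pc _] := Gf p.
have n : \forall s \near t, chart_dom c (phi s p) := pc t _ (near_chart_dom cp).
by apply: filterS n => s; exact: flow_solves.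
Qed.

Lemma flow_fixed G phi p c (t : R) : smooth_fun G -> ham_flow G phi -> atlas c ->
  chart_dom c p -> hvec G c (c p) = 0 -> phi t p = p.
Proof.
move=> Gs Gf ca cp h0; have [p0 pc _] := Gf p.
suff E : phi ^~ p = cst p by rewrite -[LHS]/((phi ^~ p) t) E.
apply: (@flow_unique G _ _ 0 Gs pc) => //; first exact: cst_continuous.
move=> s E; exists c.
have cps : chart_dom c (phi s p) by move: E => /= ->.
have := near_flow_solves Gs Gf ca cps.
apply: filterS => r Gr; split => //; split => //.
by rewrite /= /cst h0; exact: is_derive_cst.
Qed.

(** Uniqueness started at the time [t] of arrival instead of time 0: an orbit that reaches a zero of
    the field has always been there. *)
Lemma flow_not_fixed G phi p q c (t : R) : smooth_fun G -> ham_flow G phi ->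
  atlas c -> chart_dom c q -> hvec G c (c q) = 0 -> phi t p = q -> p = q.
Proof.
move=> Gs Gf ca cq h0 pq; have [p0 pc _] := Gf p.
suff E : phi ^~ p = cst q by rewrite -p0 -[LHS]/((phi ^~ p) 0) E.
apply: (@flow_unique G _ _ t Gs pc) => //; first exact: cst_continuous.
move=> s E; exists c.
have cps : chart_dom c (phi s p) by move: E => /= ->.
have := near_flow_solves Gs Gf ca cps.
apply: filterS => r Gr; split => //; split => //.
by rewrite /= /cst h0; exact: is_derive_cst.
Qed.

Lemma hvec_near_cst G c z (a : R) : (\forall w \near z, G (chart_inv c w) = a) ->
  hvec G c z = 0.
Proof.
move=> Ga; have D0 v : 'D_v (G \o chart_inv c) z = 0.
  rewrite (near_eq_derive _ (g := cst a)) ?derive_cst//.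
by rewrite /hvec !D0 oppr0 !mul0r.
Qed.

Lemma is_derive_min (f : R -> R) (a t : R) : is_derive t 1 f a ->
  (\forall s \near t, f t <= f s) -> a = 0.
Proof.
move=> /is_derive1P fa fmin.
have fmin0 : \forall h \near (0 : R), f t <= f (h + t).
  have ct : (fun h : R => h + t) @ (0 : R) --> t.
    rewrite -[X in _ --> X]add0r.
    by apply: cvgD; [exact: cvg_id|exact: cvg_cst].
  exact: (ct _ fmin).
apply/eqP; rewrite eq_le; apply/andP; split.
  apply: (cvgr_to_le (cvg_dnbhs_at_left fa)).
  have n1 : \forall h \near (0 : R)^'-, f t <= f (h + t) by exact: cvg_within.
  apply: filterS2 n1 (nbhs_left_lt (0 : R)) => h fh h0.
  by rewrite -[_ *: _]/(_ * _) nmulr_rle0 ?invr_lt0// subr_ge0.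
apply: (cvgr_to_ge (cvg_dnbhs_at_right fa)).
have n1 : \forall h \near (0 : R)^'+, f t <= f (h + t) by exact: cvg_within.
apply: filterS2 n1 (nbhs_right_gt (0 : R)) => h fh h0.
by rewrite -[_ *: _]/(_ * _) pmulr_rge0 ?invr_gt0// subr_ge0.
Qed.

(** Meant for [H] at the origin, where [phi_rho] need not be differentiable and the chain rule gives
    nothing. *)
Lemma hvec_min G c z : smooth_fun G -> atlas c -> chart_img c z ->
  (\forall w \near z, G (chart_inv c z) <= G (chart_inv c w)) ->
  hvec G c z = 0.
Proof.
move=> Gs ca cz zmin.
have D0 v : 'D_v (G \o chart_inv c) z = 0.
  have := sdiff_derive v (smooth_sdiff Gs ca cz).
  move=> /[dup] Dv [_ ->]; have zE : z = z + (0 : R) *: v by rewrite scale0r addr0.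
  rewrite {1}zE in Dv; move/is_derive_line: Dv => Dv.
  apply: (is_derive_min Dv); rewrite scale0r addr0.
  have c0 : (fun s : R => z + s *: v) @ (0 : R) --> (z + (0 : R) *: v).
    exact: is_derive_cvg (is_derive_affine z v (0 : R)).
  have zm : \forall w \near (z + (0 : R) *: v),
    G (chart_inv c z) <= G (chart_inv c w) by rewrite -zE.
  exact: (c0 _ zm).
by rewrite /hvec !D0 oppr0 !mul0r.
Qed.

End HamiltonianFlow.

(** * The elliptic model: level sets, angular velocity and explicit orbits *)

Section LocalModel.
Context {R : realType}.
Implicit Types (z v w : plane R) (a q s t : R).

Lemma is_derive_inv (f : R -> R) t d : f t != 0 -> is_derive t 1 f d ->
  is_derive t 1 (fun s => (f s)^-1) (- d / f t ^+ 2).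
Proof.
move=> ft0 [fd <-]; have h := derivableP (derivableV ft0 fd).
apply: is_derive_ext h _ _ => //; rewrite (deriveV ft0 fd).
by rewrite -[_ *: _]/(_ * _) mulNr mulrC mulNr.
Qed.

Lemma is_derive_cosM (k s : R) :
  is_derive s 1 (fun s => cos (k * s)) (- k * sin (k * s)).
Proof.
have h : is_derive s 1 (fun s : R => k * s) k.
  by have := is_derive_affine (0 : R) k s; under eq_fun do rewrite add0r [_ *: _]mulrC.
apply: is_derive_ext (is_derive1_comp (is_derive_cos (k * s)) h) _ _ => //.
by rewrite mulNr mulrC mulNr.
Qed.

Lemma is_derive_sinM (k s : R) :
  is_derive s 1 (fun s => sin (k * s)) (k * cos (k * s)).
Proof.
have h : is_derive s 1 (fun s : R => k * s) k.
  by have := is_derive_affine (0 : R) k s; under eq_fun do rewrite add0r [_ *: _]mulrC.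
apply: is_derive_ext (is_derive1_comp (is_derive_sin (k * s)) h) _ _ => //.
by rewrite mulrC.
Qed.

Lemma normr_fst_le z : `|z.1| <= enorm z.
Proof. by rewrite -sqrtr_sqr ler_wsqrtr// lerDl sqr_ge0. Qed.

Lemma normr_snd_le z : `|z.2| <= enorm z.
Proof. by rewrite -sqrtr_sqr ler_wsqrtr// lerDr sqr_ge0. Qed.

Lemma polar_enorm z : exists theta, z = polar (enorm z) theta.
Proof.
have [->|/eqP/enorm_gt0 r0] := eqVneq z 0.
  by exists 0; rewrite enorm0 /polar !mul0r.
set r := enorm z in r0 *.
have zr : z.1 ^+ 2 + z.2 ^+ 2 = r ^+ 2 by rewrite sqr_enorm.
have x1 : -1 <= z.1 / r <= 1.
  by rewrite -ler_norml normrM normfV (gtr0_norm r0) ler_pdivrMr// mul1r normr_fst_le.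
have s0 : sin (acos (z.1 / r)) = `|z.2| / r.
  rewrite sin_acos// (_ : 1 - _ = (z.2 / r) ^+ 2).
    by rewrite sqrtr_sqr normrM normfV (gtr0_norm r0).
  rewrite !exprMn exprVn -(divff (lt0r_neq0 (exprn_gt0 2 r0))) -mulrBl -zr.
  by rewrite addrAC subrr add0r.
have mk (x : R) : r * (x / r) = x by rewrite mulrC divfK// lt0r_neq0.
have [z2|z2] := leP 0 z.2.
  exists (acos (z.1 / r)); rewrite /polar s0 acosK ?in_itv//= ger0_norm//.
  rewrite !mk; exact: surjective_pairing.
exists (- acos (z.1 / r)); rewrite /polar sinN cosN s0 acosK ?in_itv//= ltr0_norm//.
rewrite mulNr opprK !mk; exact: surjective_pairing.
Qed.

(* lmap takes the level ellipses of F to circles. *)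
Definition lmap z : plane R := (2 * z.1, z.2 / 2).
Definition linv z : plane R := (z.1 / 2, 2 * z.2).
(** This is 1 / f for the f of the statement, so that [F] is exp (- 1 / [qform]) near the origin. *)
Definition qform z : R := enorm (lmap z) ^+ 2.

Lemma lmapK : cancel lmap linv.
Proof. by case=> x y; rewrite /lmap /linv /=; congr pair; field. Qed.

Lemma linvK : cancel linv lmap.
Proof. by case=> x y; rewrite /lmap /linv /=; congr pair; field. Qed.

Lemma qformE z : qform z = 4 * z.1 ^+ 2 + z.2 ^+ 2 / 4.
Proof. by rewrite /qform sqr_enorm /lmap /=; field. Qed.

Lemma qform_ge0 z : 0 <= qform z. Proof. exact: sqr_ge0. Qed.

Lemma qform_gt0 z : z <> 0 -> 0 < qform z.
Proof.
move=> z0; rewrite exprn_gt0// enorm_gt0// => lz0; apply: z0.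
by rewrite -(lmapK z) lz0 /linv /= mul0r mulr0.
Qed.

Lemma qform0 : qform 0 = 0.
Proof. by rewrite qformE /= expr0n/= mulr0 mul0r addr0. Qed.

Lemma qform_neq0 z : 0 < qform z -> z <> 0.
Proof. by move=> + z0; rewrite z0 qform0 ltxx. Qed.

Lemma qform_le z : qform z <= 4 * enorm z ^+ 2.
Proof.
by rewrite qformE sqr_enorm; have := sqr_ge0 z.1; have := sqr_ge0 z.2; lra.
Qed.

Lemma le_qform z : enorm z ^+ 2 <= 4 * qform z.
Proof.
by rewrite qformE sqr_enorm; have := sqr_ge0 z.1; have := sqr_ge0 z.2; lra.
Qed.

Lemma qform_continuous : continuous qform.
Proof.
move=> z; have -> : qform = fun z => 4 * z.1 ^+ 2 + z.2 ^+ 2 / 4.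
  by apply/funext => w; rewrite qformE.
apply: cvgD.
  by apply: cvgM; [exact: cvg_cst|apply: cvgM; exact: cvg_fst].
by apply: cvgM; [apply: cvgM; exact: cvg_snd|exact: cvg_cst].
Qed.

(** Runs along the ellipses, clockwise: with iota_X omega = dG, the field of an increasing function
    of [qform] turns this way. *)
Definition efl a z : plane R := linv (rot (- a) (lmap z)).

Lemma lmap_efl a z : lmap (efl a z) = rot (- a) (lmap z).
Proof. exact: linvK. Qed.

Lemma qform_efl a z : qform (efl a z) = qform z.
Proof. by rewrite /qform lmap_efl enorm_rot. Qed.

Lemma efl_2pi z : efl (pi *+ 2) z = z.
Proof.
by rewrite /efl /rot cosN sinN cos2pi sin2pi oppr0 !mulr0 !mulr1 subr0 add0r
  -surjective_pairing lmapK.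
Qed.

Lemma efl_fixed a z : 0 < a < pi *+ 2 -> efl a z = z -> z = 0.
Proof.
move=> /andP[a0 a2] /(congr1 lmap); rewrite lmap_efl => E.
have [//|/eqP/qform_gt0 q0] := eqVneq z 0.
have ha : a = a / 2 + a / 2 by exact: splitr.
have s0 : 0 < sin (a / 2).
  by rewrite sin_gt0_pi// divr_gt0//= ltr_pdivrMr// mulr_natr.
(* The scalar product of both sides of [E] with [lmap z] is taken; the sine terms cancel. *)
have c1 : cos a = 1.
  apply: (mulfI (lt0r_neq0 q0)); rewrite mulr1 /qform sqr_enorm.
  move: E; rewrite /rot sinN cosN; case: (lmap z) => x y /= [E1 E2].
  transitivity (x * (x * cos a - y * - sin a) + y * (x * - sin a + y * cos a)).
    by ring.
  by rewrite E1 E2.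
have : 1 - cos a = 2 * sin (a / 2) ^+ 2.
  have -> : cos a = cos (a / 2) ^+ 2 - sin (a / 2) ^+ 2 by rewrite {1}ha cosD -!expr2.
  by rewrite cos2sin2; ring.
rewrite c1 subrr => /esym/eqP; rewrite mulf_eq0 pnatr_eq0 /= sqrf_eq0.
by rewrite gt_eqF.
Qed.

Lemma lmap_rot_exists z w : enorm z = enorm w -> exists a, w = rot a z.
Proof.
move=> zw; have [a ->] := polar_enorm z; have [b ->] := polar_enorm w.
exists (b - a); rewrite zw; set r := enorm w.
rewrite /rot /polar /= cosB sinB.
have c2 := cos2sin2 a; congr pair; apply/eqP; rewrite -subr_eq0; apply/eqP.
  transitivity (r * cos b * (1 - sin a ^+ 2 - cos a ^+ 2)); first by ring.
  by rewrite c2; ring.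
transitivity (r * sin b * (1 - sin a ^+ 2 - cos a ^+ 2)); first by ring.
by rewrite c2; ring.
Qed.

Lemma efl_exists z w : qform z = qform w -> exists a, w = efl a z.
Proof.
move=> zw; have [|a E] := @lmap_rot_exists (lmap z) (lmap w).
  by apply/eqP; rewrite -(@eqrXn2 _ 2)// ?enorm_ge0//; exact/eqP.
by exists (- a); rewrite /efl opprK -E lmapK.
Qed.

(* Angular velocity of the flow of exp (- 1 / qform), up to a factor 2. *)
Definition wfun q := expR (- q^-1) / q ^+ 2.

Lemma wfun_gt0 q : 0 < q -> 0 < wfun q.
Proof. by move=> q0; rewrite divr_gt0 ?expR_gt0// exprn_gt0. Qed.

(** In the variable t = 1 / q this is the decrease of t^2 exp (- t) for t >= 2, whence the bound
    [2^-1]. For t > s >= 2 one has t / s <= 1 + (t - s) / 2 < exp ((t - s) / 2), and this is then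
    squared. *)
Lemma wfun_lt q q' : 0 < q -> q < q' -> q' <= 2^-1 -> wfun q < wfun q'.
Proof.
move=> q0 qq' q'2; have q'0 : 0 < q' by exact: lt_trans qq'.
rewrite /wfun -!exprVn.
have st : q'^-1 < q^-1 by rewrite ltf_pV2.
have s2 : 2 <= q'^-1 by rewrite -[leLHS]invrK lef_pV2// posrE.
move: (q^-1) (q'^-1) st s2 => t s st s2.
have s0 : 0 < s by exact: lt_le_trans s2.
have h : t / s < expR ((t - s) / 2).
  have d0 : 0 < (t - s) / 2 by rewrite divr_gt0// subr_gt0.
  apply: le_lt_trans (expR_gt1Dx (lt0r_neq0 d0)).
  rewrite ler_pdivrMr// -subr_ge0.
  rewrite (_ : _ - _ = (s - 2) * ((t - s) / 2)); last by field.
  by rewrite mulr_ge0 ?subr_ge0// ltW.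
have t0 : 0 < t by exact: lt_trans st.
have h2 : (t / s) ^+ 2 < expR (t - s).
  have -> : expR (t - s) = expR ((t - s) / 2) ^+ 2.
    by rewrite expr2 -expRD -splitr.
  by rewrite ltr_pXn2r ?nnegrE ?divr_ge0 ?expR_ge0 ?(ltW s0) ?(ltW t0).
rewrite -(ltr_pM2l (expR_gt0 t)) !mulrA -!expRD subrr expR0 mul1r.
by move: h2; rewrite expr_div_n ltr_pdivrMr ?exprn_gt0// !expr2 mulrA.
Qed.

Lemma wfun_inj q q' : 0 < q <= 2^-1 -> 0 < q' <= 2^-1 -> wfun q = wfun q' -> q = q'.
Proof.
move=> /andP[q0 q2] /andP[q'0 q'2] E.
have [lt|lt|//] := ltgtP q q'.
  by have := wfun_lt q0 lt q'2; rewrite E ltxx.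
by have := wfun_lt q'0 lt q2; rewrite E ltxx.
Qed.

Lemma is_derive_model w v : 0 < qform w ->
  is_derive w v (fun z => expR (- (qform z)^-1))
    (wfun (qform w) * (8 * w.1 * v.1 + w.2 * v.2 / 2)).
Proof.
move=> qw; have wE : w = w + (0 : R) *: v by rewrite scale0r addr0.
rewrite {1}wE; apply/is_derive_line.
pose p s := 4 * (w.1 + s * v.1) ^+ 2 + (w.2 + s * v.2) ^+ 2 / 4.
have pE s : qform (w + s *: v) = p s by rewrite qformE.
have aff (x y : R) : is_derive (0 : R) 1 (fun s : R => x + s * y) y.
  exact: (is_derive_affine x y (0 : R)).
have pd : is_derive (0 : R) 1 p (8 * w.1 * v.1 + w.2 * v.2 / 2).
  have c4 : is_derive (0 : R) 1 (fun=> 4 : R) (0 : R) by exact: is_derive_cst.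
  have c4' : is_derive (0 : R) 1 (fun=> 4^-1 : R) (0 : R) by exact: is_derive_cst.
  have m1 := is_deriveM (aff w.1 v.1) (aff w.1 v.1).
  have m2 := is_deriveM (aff w.2 v.2) (aff w.2 v.2).
  have := is_deriveD (is_deriveM c4 m1) (is_deriveM m2 c4') => h.
  apply: (is_derive_ext h) => [s|].
    by rewrite /p !expr2.
  rewrite -![_ *: _]/(_ * _) /= !mul0r !addr0 !mulr0 !add0r; by field.
have p0 : p 0 = qform w by rewrite -pE scale0r addr0.
have p0n : p 0 != 0 by rewrite p0 gt_eqF.
have nd := is_deriveN (is_derive_inv p0n pd).
apply: (is_derive_ext (is_derive1_comp (is_derive_expR _) nd)) => [s|].
  by rewrite pE.
rewrite -[(- _ : R -> R) 0]/(- (p 0)^-1) p0 /wfun.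
by field; rewrite gt_eqF.
Qed.

Lemma is_derive_efl (k t : R) z :
  is_derive t 1 (fun t => efl (k * t) z)
    (k / 4 * (efl (k * t) z).2, - (4 * k) * (efl (k * t) z).1).
Proof.
apply/is_derive_pairP; rewrite /efl /linv /rot /=; split.
- set u := 2 * z.1; set v := z.2 / 2.
  have cu : is_derive t 1 (fun=> u / 2) (0 : R) by exact: is_derive_cst.
  have cv : is_derive t 1 (fun=> v / 2) (0 : R) by exact: is_derive_cst.
  have h := is_deriveD (is_deriveM cu (is_derive_cosM k t)) (is_deriveM cv (is_derive_sinM k t)).
  apply: (is_derive_ext h) => [s|].
    by rewrite cosN sinN /=; rewrite -[LHS]/(u / 2 * cos (k * s) + v / 2 * sin (k * s)); field.
  by rewrite cosN sinN -![_ *: _]/(_ * _) /=; field.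
- set u := 2 * z.1; set v := z.2 / 2.
  have cu : is_derive t 1 (fun=> - 2 * u) (0 : R) by exact: is_derive_cst.
  have cv : is_derive t 1 (fun=> 2 * v) (0 : R) by exact: is_derive_cst.
  have h := is_deriveD (is_deriveM cu (is_derive_sinM k t)) (is_deriveM cv (is_derive_cosM k t)).
  apply: (is_derive_ext h) => [s|].
    by rewrite cosN sinN /=; rewrite -[LHS]/(- 2 * u * sin (k * s) + 2 * v * cos (k * s)); ring.
  by rewrite cosN sinN -![_ *: _]/(_ * _) /=; field.
Qed.

Lemma linv_continuous : continuous linv.
Proof.
apply: continuous_plane => z; first by apply: cvgM; [exact: cvg_fst|exact: cvg_cst].
by apply: cvgM; [exact: cvg_cst|exact: cvg_snd].
Qed.

End LocalModel.

(** * The flow of F on the punctured elliptic disk *)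

Section ModelFlow.
Context {R : realType} (M : symplectic_surface R) (c : chart R M).
Context (c_darboux : darboux_chart c).
Context (F : M -> R) (F_smooth : smooth_fun F) (phiF : R -> M -> M).
Context (phiF_flow : ham_flow F phiF) (q0 : R).

Definition vset : set (plane R) := [set z | 0 < qform z < q0].

Context (vset_img : vset `<=` chart_img c).
Context (F_model : forall z, vset z -> F (chart_inv c z) = expR (- (qform z)^-1)).

Lemma vset_open : open vset.
Proof.
have -> : vset = qform @^-1` [set q | 0 < q] `&` qform @^-1` [set q | q < q0].
  apply/seteqP; split => z; rewrite /vset /=; first by move=> /andP[].
  by move=> [-> ->].
apply: openI; (apply: open_comp; first by move=> z _; exact: qform_continuous).
  exact: open_gt.
exact: open_lt.
Qed.

Lemma vset_efl a z : vset z -> vset (efl a z).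
Proof. by rewrite /vset /= qform_efl. Qed.

Lemma hvec_model w : vset w -> hvec F c w =
  (wfun (qform w) / 2 * w.2, - (8 * wfun (qform w)) * w.1).
Proof.
move=> Vw; have [ca w1] := c_darboux.
have nV : \forall z \near w, vset z by apply: open_nbhs_nbhs; split => //; exact: vset_open.
have D v : 'D_v (F \o chart_inv c) w =
    wfun (qform w) * (8 * w.1 * v.1 + w.2 * v.2 / 2).
  have /andP[qw _] := Vw; have [_ <-] := is_derive_model v qw.
  by apply: near_eq_derive; apply: filterS nV => z /= /F_model.
rewrite /hvec !D w1 /=; last exact: vset_img.
by congr pair; field.
Qed.

(** Since [qform] is constant along [efl], so is the angular velocity; the explicit curve solves the
    equation and uniqueness identifies it with the orbit. *)
Lemma flow_model t z : vset z ->
  phiF t (chart_inv c z) = chart_inv c (efl (2 * wfun (qform z) * t) z).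
Proof.
move=> Vz; have [ca _] := c_darboux.
have [f0 fc _] := phiF_flow (chart_inv c z).
pose be (s : R) := chart_inv c (efl (2 * wfun (qform z) * s) z).
have bV s : vset (efl (2 * wfun (qform z) * s) z) by exact: vset_efl.
have bec : continuous be.
  move=> s; have h := is_derive_cvg (is_derive_efl (2 * wfun (qform z)) s z).
  apply: (continuous_comp h); apply: chart_inv_continuous.
  by have := vset_img (bV s).
have dom s : chart_dom c (be s) by exact/chart_inv_dom/vset_img.
suff E : phiF ^~ (chart_inv c z) = be by rewrite -[LHS]/((phiF ^~ _) t) E.
apply: (@flow_unique R M F _ _ 0 F_smooth fc bec).
  by rewrite f0 /be mulr0 /efl oppr0 rot0 lmapK.
move=> s E; exists c.
have ds : chart_dom c (phiF s (chart_inv c z)) by rewrite E.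
have := near_flow_solves F_smooth phiF_flow ca ds.
apply: filterS => r Fr; split => //; split => //.
have cbe x : c (be x) = efl (2 * wfun (qform z) * x) z.
  by rewrite chart_invK//; exact: vset_img.
rewrite cbe hvec_model// qform_efl.
apply: (is_derive_ext (is_derive_efl (2 * wfun (qform z)) r z)) => //.
by congr pair; field.
Qed.

End ModelFlow.

(** * The differential of a twist off the origin *)

Section TwistDerivative.
Context {R : realType} (rho : R -> R).
Context (rho_derivable : forall r : R, 0 < r -> derivable rho r 1).
Implicit Types (z v w X : plane R) (t : R).

Lemma is_derive_enorm (g : R -> plane R) t X : is_derive t 1 g X -> g t <> 0 ->
  is_derive t 1 (fun s => enorm (g s))
    (((g t).1 * X.1 + (g t).2 * X.2) / enorm (g t)).
Proof.
move=> gX gt0; have n0 := enorm_gt0 gt0; have gc := is_derive_cvg gX.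
move/is_derive_pairP: gX => [g1 g2].
pose S s := (g s).1 * (g s).1 + (g s).2 * (g s).2.
have Sd : is_derive t 1 S (2 * ((g t).1 * X.1 + (g t).2 * X.2)).
  apply: (is_derive_ext (is_deriveD (is_deriveM g1 g1) (is_deriveM g2 g2))) => //.
  by rewrite -![_ *: _]/(_ * _); ring.
have SE s : enorm (g s) ^+ 2 = S s by rewrite sqr_enorm !expr2.
move/is_derive1P: Sd => Sd; apply/is_derive1P.
have ec : (fun h => enorm (g (h + t))) @ (0 : R)^' --> enorm (g t).
  have h : (fun h : R => h + t) @ (0 : R) --> t.
    by rewrite -[X in _ --> X]add0r; apply: cvgD; [exact: cvg_id|exact: cvg_cst].
  have h2 := cvg_comp _ _ (cvg_comp _ _ h gc) (@enorm_continuous R (g t)).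
  by apply: (cvg_trans _ h2); apply: cvg_app; exact: cvg_within.
have nn : enorm (g t) + enorm (g t) != 0 by rewrite gt_eqF// addr_gt0.
have iv : (fun h => (enorm (g (h + t)) + enorm (g t))^-1) @ (0 : R)^' -->
    (enorm (g t) + enorm (g t))^-1.
  by apply: cvgV => //; apply: cvgD => //; exact: cvg_cst.
rewrite (_ : _ / _ = 2 * ((g t).1 * X.1 + (g t).2 * X.2) / (enorm (g t) + enorm (g t))).
  apply: cvg_trans (cvgM Sd iv); apply: near_eq_cvg; apply: nearW => h.
  have nz : enorm (g (h + t)) + enorm (g t) != 0.
    by rewrite gt_eqF// ltr_wpDl// enorm_ge0.
  suff : h^-1 * (S (h + t) - S t) * (enorm (g (h + t)) + enorm (g t))^-1 =
    h^-1 * (enorm (g (h + t)) - enorm (g t)) by [].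
  by rewrite -!SE subr_sqr -!mulrA divff// mulr1.
by field; rewrite nn gt_eqF.
Qed.

(** The differential of the twist: the rotated vector [X], plus [k] times the rotated [z] turned by
    a right angle, where [k] is the rate of change of the twisting angle along [X]. *)
Definition dtwist z X : plane R :=
  let a := rho (enorm z) in
  let k := derive1 rho (enorm z) / enorm z * (z.1 * X.1 + z.2 * X.2) in
  ((rot a X).1 - k * (rot a z).2, (rot a X).2 + k * (rot a z).1).

Lemma twist_curve (g : R -> plane R) t X : is_derive t 1 g X -> g t <> 0 ->
  is_derive t 1 (fun s => twist rho (g s)) (dtwist (g t) X).
Proof.
move=> gX gt0; have en := is_derive_enorm gX gt0.
have rd : is_derive (enorm (g t)) 1 rho (derive1 rho (enorm (g t))).
  by rewrite derive1E; exact/derivableP/rho_derivable/enorm_gt0.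
have ad := @is_derive1_comp R rho (fun s => enorm (g s)) t _ _ rd en.
have cd := @is_derive1_comp R cos (fun s => rho (enorm (g s))) t _ _ (is_derive_cos _) ad.
have sd := @is_derive1_comp R sin (fun s => rho (enorm (g s))) t _ _ (is_derive_sin _) ad.
have n0 := enorm_gt0 gt0.
move/is_derive_pairP: gX => [g1 g2].
apply/is_derive_pairP; split.
  apply: (is_derive_ext (is_deriveB (is_deriveM g1 cd) (is_deriveM g2 sd))) => //.
  rewrite -![_ *: _]/(_ * _) /dtwist /rot /=; field; by rewrite gt_eqF.
apply: (is_derive_ext (is_deriveD (is_deriveM g1 sd) (is_deriveM g2 cd))) => //.
rewrite -![_ *: _]/(_ * _) /dtwist /rot /=; field; by rewrite gt_eqF.
Qed.

Lemma dtwist_area z X v :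
  (dtwist z X).1 * (dtwist z v).2 - (dtwist z X).2 * (dtwist z v).1 =
  X.1 * v.2 - X.2 * v.1.
Proof.
rewrite /dtwist /rot /=; set k := derive1 rho _ / _; set a := rho _.
transitivity ((X.1 * v.2 - X.2 * v.1) * (cos a ^+ 2 + sin a ^+ 2)).
  by ring.
by rewrite cos2Dsin2 mulr1.
Qed.

(** The correction of [u] is orthogonal to [z], hence does not change the rate [k] that it has to
    compensate. *)
Lemma dtwist_surj z w : exists v, dtwist z v = w.
Proof.
pose a := rho (enorm z); pose u := rot (- a) w.
pose k := derive1 rho (enorm z) / enorm z * (z.1 * u.1 + z.2 * u.2).
exists (u.1 + k * z.2, u.2 - k * z.1); rewrite -[RHS](rotNK a) -/u.
rewrite /dtwist -/a (_ : _ / _ * _ = k); last by rewrite /k /=; ring.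
by rewrite /rot /=; congr pair; ring.
Qed.

Lemma derivable_pos_continuous : {in [pred r | 0 < r], continuous rho}.
Proof.
move=> r; rewrite inE => r0; apply: differentiable_continuous.
exact/derivable1_diffP/rho_derivable.
Qed.

End TwistDerivative.

(** * The twist as a homeomorphism of the surface *)

Section TwistOnSurface.
Context {R : realType} (M : symplectic_surface R) (c : chart R M).
Context (c_disk : [set z | enorm z <= 1] `<=` chart_img c).

(** Twists the whole chart, with no case distinction at the unit circle. For a [rho] vanishing
    beyond 1 it is the identity off the disk. *)
Definition ctwist (rho : R -> R) (p : M) : M :=
  if `[< chart_dom c p >] then chart_inv c (twist rho (c p)) else p.

Section Twist.
Context (rho : R -> R) (rho_supp : forall r : R, 1 <= r -> rho r = 0).

Lemma twist_out z : 1 <= enorm z -> twist rho z = z.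
Proof. by move=> z1; rewrite twistE rho_supp// rot0. Qed.

Lemma twist_img z : chart_img c z -> chart_img c (twist rho z).
Proof.
move=> cz; have [z1|/ltW z1] := leP (enorm z) 1; last by rewrite twist_out.
by apply: c_disk; rewrite /= enorm_twist.
Qed.

Lemma ctwist_in p : chart_dom c p -> ctwist rho p = chart_inv c (twist rho (c p)).
Proof. by move=> cp; rewrite /ctwist asboolT. Qed.

Lemma ctwist_out p : ~ chart_dom c p -> ctwist rho p = p.
Proof. by move=> cp; rewrite /ctwist asboolF. Qed.

Lemma chart_ctwist p : chart_dom c p -> c (ctwist rho p) = twist rho (c p).
Proof. by move=> cp; rewrite ctwist_in// chart_invK//; exact/twist_img/chart_imgP. Qed.

Lemma ctwist_dom p : chart_dom c p -> chart_dom c (ctwist rho p).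
Proof. by move=> cp; rewrite ctwist_in//; exact/chart_inv_dom/twist_img/chart_imgP. Qed.

Lemma ctwist_inv z : chart_img c z ->
  ctwist rho (chart_inv c z) = chart_inv c (twist rho z).
Proof. by move=> cz; rewrite ctwist_in ?chart_invK//; exact: chart_inv_dom. Qed.

Lemma compact_disk : compact (chart_inv c @` [set z : plane R | enorm z <= 1]).
Proof.
have cd : compact [set z : plane R | enorm z <= 1].
  apply: (@subclosed_compact _ _ (`[(-1 : R), 1] `*` `[(-1 : R), 1])).
  - apply: (@closed_comp _ _ (@enorm R) [set x | x <= 1]); last exact: closed_le.
    by move=> z _; exact: enorm_continuous.
  - by apply: compact_setX; exact: segment_compact.
  - move=> z /= z1; rewrite !in_itv /= -!ler_norml.
    by split; apply: le_trans z1; [exact: normr_fst_le|exact: normr_snd_le].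
apply: continuous_compact => //; apply: continuous_in_subspaceT => z /set_mem z1.
by apply: chart_inv_continuous; exact: c_disk.
Qed.

(** Points of the chart may accumulate at [p], but the closed unit disk is compact, hence closed in
    the Hausdorff surface, and stays away from [p]. *)
Lemma ctwist_near_out p : ~ chart_dom c p -> \forall q \near p, ctwist rho q = q.
Proof.
move=> cp; set D := chart_inv c @` [set z : plane R | enorm z <= 1].
have Dc : closed D by apply: compact_closed; [exact: surface_hausdorff|exact: compact_disk].
have nD : (~` D) p by move=> -[z /c_disk cz zp]; apply: cp; rewrite -zp; exact: chart_inv_dom.
have := open_nbhs_nbhs (conj (closed_openC Dc) nD); apply: filterS => q /= nDq.
have [cq|] := pselect (chart_dom c q); last exact: ctwist_out.
rewrite ctwist_in// twist_out ?chart_mapK//.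
rewrite leNgt; apply/negP => q1; apply: nDq; exists (c q); last exact: chart_mapK.
exact: ltW.
Qed.

Lemma ctwist_continuous : {in [pred r : R | 0 < r], continuous rho} ->
  continuous (ctwist rho).
Proof.
move=> rhoc p; have [cp|ncp] := pselect (chart_dom c p).
  rewrite /continuous_at (ctwist_in cp).
  have : (fun q => chart_inv c (twist rho (c q))) @ p --> chart_inv c (twist rho (c p)).
    have tc := cvg_comp _ _ (chart_map_continuous cp) (@twist_continuous R rho rhoc (c p)).
    have ic := chart_inv_continuous (twist_img (chart_imgP cp)).
    exact: (cvg_comp _ _ tc ic).
  apply: cvg_trans; apply: near_eq_cvg.
  by apply: filterS (near_chart_dom cp) => q cq; rewrite ctwist_in.
rewrite /continuous_at (ctwist_out ncp).
apply: (cvg_trans _ (@cvg_id _ (nbhs p))); apply: near_eq_cvg.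
by apply: filterS (ctwist_near_out ncp) => q ->.
Qed.

End Twist.

Lemma ctwistK rho : (forall r, 1 <= r -> rho r = 0) ->
  cancel (ctwist rho) (ctwist (\- rho)).
Proof.
move=> r1 p; have [cp|ncp] := pselect (chart_dom c p); last by rewrite !ctwist_out.
by rewrite (ctwist_in _ (ctwist_dom r1 cp)) chart_ctwist// twistK chart_mapK.
Qed.

Lemma ctwistNK rho : (forall r, 1 <= r -> rho r = 0) ->
  cancel (ctwist (\- rho)) (ctwist rho).
Proof.
move=> r1 p; have [cp|ncp] := pselect (chart_dom c p); last by rewrite !ctwist_out.
have r1' r : 1 <= r -> (\- rho) r = 0 by move=> /r1 /= ->; rewrite oppr0.
by rewrite (ctwist_in _ (ctwist_dom r1' cp)) chart_ctwist// twistNK chart_mapK.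
Qed.

End TwistOnSurface.

(** * The twist conjugates the flow of H to that of F *)

Section TwistConjugation.
Context {R : realType} (M : symplectic_surface R) (c : chart R M).
Context (c_darboux : darboux_chart c).
Context (c_disk : [set z | enorm z <= 1] `<=` chart_img c).
Context (rho : R -> R) (rho_supp : forall r : R, 1 <= r -> rho r = 0).
Context (rho_derivable : forall r : R, 0 < r -> derivable rho r 1).
Context (F H : M -> R) (HE : forall p, H p = F (ctwist c rho p)).
Context (F_smooth : smooth_fun F) (H_smooth : smooth_fun H).

(** Off the origin the twist is a diffeomorphism preserving the area form, so it pushes X_H to X_F:
    the differential of [F] is tested on images of vectors under [dtwist]. *)
Lemma hvec_twist z : chart_img c z -> z <> 0 ->
  hvec F c (twist rho z) = dtwist rho z (hvec H c z).
Proof.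
move=> cz z0; have [ca w1] := c_darboux.
have cTz : chart_img c (twist rho z) by exact: twist_img.
apply/esym; apply/(ham_vectorP _ F_smooth ca cTz) => v'.
have [v <-] := dtwist_surj rho z v'.
rewrite /omega w1// mul1r dtwist_area.
have -> : (hvec H c z).1 * v.2 - (hvec H c z).2 * v.1 = 'D_v (H \o chart_inv c) z.
  have /(ham_vectorP _ H_smooth ca cz)/(_ v) <- := erefl (hvec H c z).
  by rewrite /omega w1// mul1r.
have sF := smooth_sdiff F_smooth ca cTz.
have [_ ->] := sdiff_derive (dtwist rho z v) sF.
have lc := is_derive_affine z v (0 : R).
have lz : z + (0 : R) *: v = z by rewrite scale0r addr0.
have tc := twist_curve rho_derivable lc; rewrite lz in tc; have {}tc := tc z0.
have sF' : sdiff (F \o chart_inv c) (twist rho (z + (0 : R) *: v))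
  ('D_(1, 0) (F \o chart_inv c) (twist rho z))
  ('D_(0, 1) (F \o chart_inv c) (twist rho z)) by rewrite lz.
have Fd := sdiff_curve (g := fun s : R => twist rho (z + s *: v)) sF' tc.
have ln : \forall s \near (0 : R), chart_img c (z + s *: v).
  apply: (is_derive_cvg lc); rewrite lz; exact: near_chart_img.
have ev : \forall s \near (0 : R),
    ((F \o chart_inv c) \o (fun s : R => twist rho (z + s *: v))) s =
    (H \o chart_inv c) (z + s *: v).
  by apply: filterS ln => s cs /=; rewrite HE ctwist_inv.
by have /is_derive_line := near_eq_is_derive ev Fd; rewrite lz => -[_ ->].
Qed.

Context (F0 : hvec F c 0 = 0) (H0 : hvec H c 0 = 0).
Context (phiF phiH : R -> M -> M).
Context (phiF_flow : ham_flow F phiF) (phiH_flow : ham_flow H phiH).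

Let c0 : chart_img c (0 : plane R).
Proof. by apply: c_disk; rewrite /= enorm0. Qed.

(** The singular point of the twist is harmless: both flows fix it, and no other orbit reaches
    it. *)
Lemma ctwist_flow t p : ctwist c rho (phiH t p) = phiF t (ctwist c rho p).
Proof.
have [ca w1] := c_darboux; pose o := chart_inv c 0.
have co : chart_dom c o by exact: chart_inv_dom.
have coE : c o = 0 by rewrite chart_invK.
have To : ctwist c rho o = o by rewrite ctwist_inv// twist0.
have [po|po] := pselect (p = o).
  rewrite po To (flow_fixed t H_smooth phiH_flow ca co) ?coE// To.
  by rewrite (flow_fixed t F_smooth phiF_flow ca co) ?coE.
have nv s : phiH s p <> o.
  by move=> /(flow_not_fixed H_smooth phiH_flow ca co); rewrite coE => /(_ H0).
have [h0 hc _] := phiH_flow p.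
have [f0 fc _] := phiF_flow (ctwist c rho p).
have Tc := ctwist_continuous c_disk rho_supp (derivable_pos_continuous rho_derivable).
suff E : (fun s => ctwist c rho (phiH s p)) = phiF ^~ (ctwist c rho p).
  by rewrite -[LHS]/((fun s => ctwist c rho (phiH s p)) t) E.
apply: (@flow_unique R M F _ _ 0 F_smooth _ fc).
- by move=> s; apply: continuous_comp; [exact: hc|exact: Tc].
- by rewrite h0 f0.
move=> s E; have [cs|ncs] := pselect (chart_dom c (phiH s p)).
  exists c; have cTs : chart_dom c (phiF s (ctwist c rho p)).
    by rewrite -E; exact: ctwist_dom.
  have Fs := near_flow_solves F_smooth phiF_flow ca cTs.
  have Hs := near_flow_solves H_smooth phiH_flow ca cs.
  have nd : \forall x \near s, chart_dom c (phiH x p) := hc s _ (near_chart_dom cs).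
  have Hn : \forall x \near s, solves H (phiH ^~ p) x c /\
      \forall y \near x, chart_dom c (phiH y p).
    by apply: filterS2 Hs (near_join nd) => x; split.
  apply: filterS2 Fs Hn => x Fx [[_ cx dx] ndx]; split => //; split => //.
    exact: ctwist_dom.
  have ci := chart_imgP cx.
  have z0 : c (phiH x p) <> 0.
    by move=> cx0; apply: (nv x); rewrite -(chart_mapK cx) cx0.
  rewrite chart_ctwist// (hvec_twist ci z0).
  have := twist_curve rho_derivable dx z0.
  apply: near_eq_is_derive; apply: filterS ndx => y cy.
  by rewrite chart_ctwist.
(* Outside the chart the twist is the identity near the point, so [F] and [H] coincide there and
   have the same field. *)
have [c' ca' c's] := atlas_cover (phiH s p).
exists c'.
have c'Ts : chart_dom c' (phiF s (ctwist c rho p)) by rewrite -E ctwist_out.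
have Fs := near_flow_solves F_smooth phiF_flow ca' c'Ts.
have Hs := near_flow_solves H_smooth phiH_flow ca' c's.
have nid := ctwist_near_out c_disk rho_supp ncs.
have nx : \forall x \near s, \forall q \near phiH x p, ctwist c rho q = q :=
  hc s _ (near_join nid).
near=> x.
have Fx : solves F (phiF ^~ (ctwist c rho p)) x c' by near: x.
have [_ cx dx] : solves H (phiH ^~ p) x c' by near: x.
have nxx : \forall q \near phiH x p, ctwist c rho q = q by near: x.
have idx : ctwist c rho (phiH x p) = phiH x p by exact: nbhs_singleton nxx.
split => //; split => //; first by rewrite idx.
rewrite idx; have ci := chart_imgP cx.
have -> : hvec F c' (c' (phiH x p)) = hvec H c' (c' (phiH x p)).
  have nn : \forall z \near c' (phiH x p), (F \o chart_inv c') z = (H \o chart_inv c') z.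
    have ic : chart_inv c' @ c' (phiH x p) --> phiH x p.
      by rewrite -{2}(chart_mapK cx); exact: (chart_inv_continuous ci).
    have nz : \forall z \near c' (phiH x p),
      ctwist c rho (chart_inv c' z) = chart_inv c' z := ic _ nxx.
    by apply: filterS nz => z /= zz; rewrite HE zz.
  by rewrite /hvec !(near_eq_derive _ nn).
apply: near_eq_is_derive dx.
have ny : \forall y \near x, ctwist c rho (phiH y p) = phiH y p := hc x _ nxx.
by apply: filterS ny => y ->.
Unshelve. all: by end_near. Qed.

End TwistConjugation.

(** * Injective continuous maps commuting with the flow of F *)

Section Commutant.
Context {R : realType} (M : symplectic_surface R) (c : chart R M).
Context (c_darboux : darboux_chart c).
Context (c_disk : [set z | enorm z <= 1] `<=` chart_img c).
Context (F : M -> R) (F_smooth : smooth_fun F) (phiF : R -> M -> M).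
Context (phiF_flow : ham_flow F phiF) (q0 : R) (q0_gt0 : 0 < q0) (q0_le : q0 <= 4^-1).
Context (F_model : forall z, vset q0 z -> F (chart_inv c z) = expR (- (qform z)^-1)).
Implicit Types (p : M) (z w : plane R) (t s q : R).

Lemma qform_lt_img z : qform z < q0 -> chart_img c z.
Proof.
move=> zq; apply: c_disk => /=.
rewrite -(@ler_pXn2r _ 2)// ?nnegrE ?enorm_ge0// expr1n (le_trans (le_qform z))//.
by have := lt_le_trans zq q0_le; lra.
Qed.

Lemma vset_img z : vset q0 z -> chart_img c z.
Proof. by move=> /andP[_ /qform_lt_img]. Qed.

Definition in_model p := chart_dom c p /\ vset q0 (c p).

Lemma in_model_inv z : vset q0 z -> in_model (chart_inv c z).
Proof.
move=> Vz; have cz := vset_img Vz; split; first exact: chart_inv_dom.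
by rewrite chart_invK.
Qed.

Lemma in_model_flow t p : in_model p ->
  phiF t p = chart_inv c (efl (2 * wfun (qform (c p)) * t) (c p)).
Proof.
move=> [cp Vp]; rewrite -{1}(chart_mapK cp).
exact: (flow_model c_darboux F_smooth phiF_flow vset_img F_model).
Qed.

Lemma in_model_flow_in t p : in_model p -> in_model (phiF t p).
Proof.
move=> ip; rewrite (in_model_flow t ip); apply/in_model_inv/vset_efl.
by case: ip.
Qed.

Lemma chart_flow t p : in_model p ->
  c (phiF t p) = efl (2 * wfun (qform (c p)) * t) (c p).
Proof.
move=> ip; rewrite (in_model_flow t ip) chart_invK//; apply/vset_img/vset_efl.
by case: ip.
Qed.

(** A full turn of 2 pi at angular velocity [2 * wfun]. *)
Let period p := pi / wfun (qform (c p)).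

Let wfun_in p : in_model p -> 0 < wfun (qform (c p)).
Proof. by move=> [_ /andP[/wfun_gt0]]. Qed.

Let flow_period p : in_model p -> phiF (period p) p = p.
Proof.
move=> ip; rewrite (in_model_flow _ ip) /period.
rewrite (_ : 2 * _ * _ = pi *+ 2).
  by rewrite efl_2pi chart_mapK//; case: ip.
by rewrite -mulr_natl; field; rewrite gt_eqF// wfun_in.
Qed.

Let flow_aperiodic p t : in_model p -> 0 < t < period p -> phiF t p <> p.
Proof.
move=> ip /andP[t0 tp] /(congr1 c); rewrite chart_flow//.
have w0 := wfun_in ip.
have a2 : 0 < 2 * wfun (qform (c p)) * t < pi *+ 2.
  apply/andP; split; first by apply: mulr_gt0 => //; exact: mulr_gt0.
  by rewrite -[pi *+ 2]mulr_natl -mulrA ltr_pM2l// mulrC -ltr_pdivlMr.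
move=> /(efl_fixed a2) z0; case: ip => _ /andP[].
by rewrite z0 qform0 ltxx.
Qed.

Let qform_half p : in_model p -> 0 < qform (c p) <= 2^-1.
Proof.
move=> [_ /andP[-> q1]] /=; rewrite (le_trans (ltW q1))// (le_trans q0_le)//.
by lra.
Qed.

Section Map.
Context (g : M -> M) (g_inj : injective g) (g_cont : continuous g).
Context (g_flow : forall t p, g (phiF t p) = phiF t (g p)).

(* The period of an orbit in the model determines the ellipse it runs on. *)
Lemma commute_qform p : in_model p -> in_model (g p) ->
  qform (c (g p)) = qform (c p).
Proof.
move=> ip igp; have w0 := wfun_in ip; have w1 := wfun_in igp.
apply: wfun_inj; [exact: qform_half|exact: qform_half|].
have Tp := flow_period ip; have Tgp := flow_period igp.
have pgt0 p' : in_model p' -> 0 < period p' by move=> /wfun_in ?; rewrite divr_gt0// pi_gt0.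
apply/eqP; rewrite eq_le; apply/andP; split; rewrite leNgt; apply/negP => lt.
  apply: (@flow_aperiodic p (period (g p)) ip).
    by rewrite pgt0//= ltr_pM2l ?pi_gt0// ltf_pV2.
  by apply: g_inj; rewrite g_flow.
apply: (@flow_aperiodic (g p) (period p) igp).
  by rewrite pgt0//= ltr_pM2l ?pi_gt0// ltf_pV2.
by rewrite -g_flow Tp.
Qed.

Let orbit_exists p p' : in_model p -> in_model p' ->
  qform (c p) = qform (c p') -> exists t, p' = phiF t p.
Proof.
move=> ip ip' /efl_exists[a E]; have w0 := wfun_in ip.
exists (a / (2 * wfun (qform (c p)))); rewrite in_model_flow//.
rewrite (_ : _ * _ * _ = a); first by rewrite -E chart_mapK//; case: ip'.
by field; rewrite gt_eqF.
Qed.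

Let orbit_in_model p p' : in_model p -> in_model p' ->
  qform (c p) = qform (c p') -> in_model (g p) -> in_model (g p').
Proof.
move=> ip ip' /(orbit_exists ip ip')[t ->] igp.
by rewrite g_flow; exact: in_model_flow_in.
Qed.

Lemma closed_shell q1 q2 : q2 < q0 ->
  closed (chart_inv c @` [set z | q1 <= qform z <= q2]).
Proof.
move=> q20; apply: compact_closed; first exact: surface_hausdorff.
have cs : compact [set z : plane R | q1 <= qform z <= q2].
  apply: (@subclosed_compact _ _ (`[(-1 : R), 1] `*` `[(-1 : R), 1])).
  - have -> : [set z : plane R | q1 <= qform z <= q2] =
        qform @^-1` [set q | q1 <= q] `&` qform @^-1` [set q | q <= q2].
      by apply/seteqP; split => z /=; [move=> /andP[]|move=> [-> ->]].
    apply: closedI; (apply: closed_comp; first by move=> z _; exact: qform_continuous).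
      exact: closed_ge.
    exact: closed_le.
  - by apply: compact_setX; exact: segment_compact.
  - move=> z /= /andP[_ zq].
    have z1 : enorm z <= 1.
      rewrite -(@ler_pXn2r _ 2)// ?nnegrE ?enorm_ge0// expr1n (le_trans (le_qform z))//.
      by have := lt_le_trans q20 q0_le; lra.
    rewrite !in_itv /= -!ler_norml.
    by split; apply: le_trans z1; [exact: normr_fst_le|exact: normr_snd_le].
apply: continuous_compact => //; apply: continuous_in_subspaceT => z /set_mem/= /andP[_ zq].
by apply/chart_inv_continuous/qform_lt_img; exact: le_lt_trans q20.
Qed.

Let ray s : plane R := linv (s, 0).

Let qform_ray s : qform (ray s) = s ^+ 2.
Proof. by rewrite /qform linvK sqr_enorm /= expr0n addr0. Qed.

Let ray_continuous : continuous ray.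
Proof.
move=> s; apply: (@continuous_comp _ _ _ (fun s : R => (s, 0) : plane R) linv).
  by apply: cvg_plane; [exact: cvg_id|exact: cvg_cst].
exact: linv_continuous.
Qed.

Let A := [set s : R | 0 < s /\ s ^+ 2 < q0].

Let ray_vset s : A s -> vset q0 (ray s).
Proof. by move=> [s0 s1]; rewrite /vset /= qform_ray s1 exprn_gt0. Qed.

Let g_ray_continuous s : A s -> {for s, continuous (fun s => g (chart_inv c (ray s)))}.
Proof.
move=> As; apply: (@continuous_comp _ _ _ (fun s => chart_inv c (ray s)) g); last exact: g_cont.
apply: (@continuous_comp _ _ _ ray (chart_inv c)); first exact: ray_continuous.
by apply/chart_inv_continuous/vset_img/ray_vset.
Qed.

Lemma near_in_model p : in_model p -> \forall p' \near p, in_model p'.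
Proof.
move=> [cp Vp]; have h := near_chart_dom cp.
have nV : \forall z \near c p, vset q0 z.
  by apply: open_nbhs_nbhs; split => //; exact: vset_open.
have h2 : \forall p' \near p, vset q0 (c p') := chart_map_continuous cp nV.
by apply: filterS2 h h2 => p'; split.
Qed.

(** The flow reduces the claim to a ray that meets each ellipse once, at [qform = s ^+ 2]. On this
    interval of parameters the images in the model form an open set, and a closed one: as [qform] is
    preserved, they stay in a compact shell and cannot escape in the limit. *)
Lemma commute_in_model p0 p : in_model p0 -> in_model (g p0) ->
  in_model p -> in_model (g p).
Proof.
move=> ip0 igp0 ip.
have rayE p' : in_model p' -> exists2 s, A s & s ^+ 2 = qform (c p').
  move=> [_ /andP[q1 q2]]; exists (Num.sqrt (qform (c p'))); last by rewrite sqr_sqrtr// ltW.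
  by split; rewrite ?sqrtr_gt0// sqr_sqrtr// ltW.
have ray_c s : A s -> in_model (chart_inv c (ray s)) by move=> /ray_vset/in_model_inv.
have qr s : A s -> qform (c (chart_inv c (ray s))) = s ^+ 2.
  by move=> As; rewrite chart_invK ?qform_ray//; exact/vset_img/ray_vset.
have [s As sp] := rayE _ ip; have [s0 As0 sp0] := rayE _ ip0.
apply: (orbit_in_model (ray_c _ As) ip); first by rewrite qr.
move: s As {sp}; apply: (@connected_all R A (fun s => in_model (g (chart_inv c (ray s))))).
- apply/connected_intervalP => x y [x0 x1] [y0 y1] z /andP[xz zy].
  split; first exact: lt_le_trans xz.
  apply: le_lt_trans y1; rewrite ler_pXn2r ?nnegrE// ltW//.
  exact: lt_le_trans xz.
- exists s0 => //; apply: (orbit_in_model ip0 (ray_c _ As0)) => //.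
  by rewrite qr.
- move=> s As ig; have h : \forall x \near s, in_model (g (chart_inv c (ray x))).
    exact: (g_ray_continuous As (near_in_model ig)).
  by apply: filterS h => x + _.
- move=> s As nig; have [s_gt0 s_lt] := As.
  (* The shell contains the ellipses of all parameters near [s] and lies in the model. *)
  pose q1 := s ^+ 2 / 2; pose q2 := (s ^+ 2 + q0) / 2.
  have sq0 : 0 < s ^+ 2 by rewrite exprn_gt0.
  have q20 : q2 < q0 by rewrite /q2; lra.
  have q10 : 0 < q1 by rewrite /q1; lra.
  have cl := @closed_shell q1 q2 q20.
  have nK : ~ (chart_inv c @` [set z | q1 <= qform z <= q2]) (g (chart_inv c (ray s))).
    move=> [z /andP[z1 z2] E]; apply: nig; rewrite -E; apply: in_model_inv.
    by rewrite /vset /= (lt_le_trans q10 z1) (le_lt_trans z2 q20).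
  have n1 : \forall x \near s, (~` (chart_inv c @` [set z | q1 <= qform z <= q2]))
      (g (chart_inv c (ray x))).
    apply: (g_ray_continuous As); apply: open_nbhs_nbhs; split => //.
    exact: closed_openC.
  have xs : (fun x : R => x ^+ 2) @ s --> s ^+ 2 by apply: cvgM; exact: cvg_id.
  have n2 : \forall x \near s, q1 < x ^+ 2 by apply: (cvgr_gt _ xs); rewrite /q1; lra.
  have n3 : \forall x \near s, x ^+ 2 < q2 by apply: (cvgr_lt _ xs); rewrite /q2; lra.
  near=> x => Ax ig.
  have : (~` (chart_inv c @` [set z | q1 <= qform z <= q2])) (g (chart_inv c (ray x))).
    by near: x.
  apply; exists (c (g (chart_inv c (ray x)))); last by rewrite chart_mapK//; case: ig.
  rewrite /= (commute_qform (ray_c _ Ax) ig) qr//.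
  by apply/andP; split; apply: ltW; near: x.
Unshelve. all: by end_near. Qed.

(** Small ellipses are mapped to themselves, so by continuity the image of the origin lies in every
    closed elliptic disk around it. *)
Lemma commute_fix0 : (forall p, in_model p -> in_model (g p)) ->
  g (chart_inv c 0) = chart_inv c 0.
Proof.
move=> gm.
have c0 : chart_img c (0 : plane R) by apply: qform_lt_img; rewrite qform0.
have r0 : ray 0 = 0 by rewrite /ray /linv /= mul0r mulr0.
have gc : (fun s => g (chart_inv c (ray s))) @ (0 : R)^'+ --> g (chart_inv c 0).
  have rc : ray @ (0 : R) --> (0 : plane R) by rewrite -[X in _ --> X]r0; exact: ray_continuous.
  have h := cvg_comp _ _ (cvg_comp _ _ rc (chart_inv_continuous c0)) (@g_cont (chart_inv c 0)).
  by apply: (cvg_trans _ h); apply: cvg_app; exact: cvg_within.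
have small q : 0 < q -> q < q0 ->
    (chart_inv c @` [set z | 0 <= qform z <= q]) (g (chart_inv c 0)).
  move=> q_gt0 q_lt; apply: (closed_cvg _ (@closed_shell 0 q q_lt) _ _ gc).
  have xs : (fun x : R => x ^+ 2) @ (0 : R)^'+ --> (0 : R).
    have h : (fun x : R => x ^+ 2) @ (0 : R) --> (0 : R).
      by rewrite -[X in _ --> X](mulr0 0); apply: cvgM; exact: cvg_id.
    by apply: (cvg_trans _ h); apply: cvg_app; exact: cvg_within.
  have n1 : \forall x \near (0 : R)^'+, x ^+ 2 < q by apply: (cvgr_lt _ xs).
  apply: filterS2 n1 (nbhs_right_gt (0 : R)) => s sq s_gt0.
  have As : A s by split => //; exact: lt_trans q_lt.
  have im := in_model_inv (ray_vset As).
  exists (c (g (chart_inv c (ray s)))); last by rewrite chart_mapK//; case: (gm _ im).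
  rewrite /= qform_ge0 (commute_qform im (gm _ im)) chart_invK ?qform_ray ?ltW//.
  exact/vset_img/ray_vset.
have q02 : q0 / 2 < q0 by rewrite ltr_pdivrMr// ltr_pMr// ltr1n.
have [z /andP[_ zq] zE] := small (q0 / 2) (divr_gt0 q0_gt0 (ltr0n _ 2)) q02.
have cz : chart_img c z by apply: qform_lt_img; exact: le_lt_trans q02.
suff z0 : z = 0 by rewrite -zE z0.
have [//|/eqP/qform_gt0 z0] := eqVneq z 0.
(* Were [z] not the origin, it would have to lie in an elliptic disk too small to contain it. *)
pose q := Num.min (qform z / 2) (q0 / 2).
have q_gt0 : 0 < q by rewrite lt_min !divr_gt0.
have q_lt : q < q0 by rewrite gt_min; apply/orP; right; lra.
have [w /andP[_ wq] wE] := small q q_gt0 q_lt.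
have cw : chart_img c w by apply: qform_lt_img; rewrite (le_lt_trans wq).
have wz : w = z by rewrite -(chart_invK cw) wE -zE chart_invK.
move: wq; rewrite wz le_min => /andP[+ _].
by rewrite ler_pdivlMr// mulr_natr mulr2n gerDl leNgt z0.
Qed.

(** The flow is transitive on each ellipse, so a map that commutes with it there is determined by
    the image of one point, and is a rotation of the ellipse. *)
Lemma commute_rotation : (forall p, in_model p -> in_model (g p)) ->
  exists al : R -> R, forall z, vset q0 z ->
    g (chart_inv c z) = chart_inv c (efl (al (qform z)) z).
Proof.
move=> gm.
have H q : exists a, forall z, vset q0 z -> qform z = q ->
    g (chart_inv c z) = chart_inv c (efl a z).
  have [[z0 [Vz0 qz0]]|no] := pselect (exists z, vset q0 z /\ qform z = q); last first.
    (* No point of the model has this value of [qform], and any angle does. *)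
    by exists 0 => z Vz qz; exfalso; apply: no; exists z.
  have im0 := in_model_inv Vz0; have igm0 := gm _ im0.
  have cz0 : c (chart_inv c z0) = z0 by apply/chart_invK/vset_img.
  have [a E] : exists a, c (g (chart_inv c z0)) = efl a z0.
    by apply: efl_exists; rewrite (commute_qform im0 igm0) cz0.
  exists a => z Vz qz; have im := in_model_inv Vz.
  have cz : c (chart_inv c z) = z by apply/chart_invK/vset_img.
  have [t tE] : exists t, chart_inv c z = phiF t (chart_inv c z0).
    by apply: orbit_exists => //; rewrite cz cz0 qz.
  have zE : z = efl (2 * wfun q * t) z0.
    by rewrite -cz tE chart_flow// cz0 qz0.
  rewrite tE g_flow in_model_flow// E qform_efl qz0 zE; congr (chart_inv c _).
  by rewrite /efl !linvK !rotD addrC.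
by have [al alE] := choice H; exists al => z Vz; exact: alE.
Qed.

End Map.

End Commutant.

(** * A Lipschitz bound on rotated ellipses bounds the derivative of the twisting angle *)

Section RotationModulus.
Context {R : realType}.
Implicit Types (z w u v : plane R) (r q t : R).

(** Complex multiplication. A rotation is then linear in its unit vector, which sees the angle
    modulo 2 pi only. *)
Definition cmul u w : plane R := (u.1 * w.1 - u.2 * w.2, u.1 * w.2 + u.2 * w.1).

Lemma cmulBr u v w : cmul u v - cmul u w = cmul u (v - w).
Proof. by rewrite /cmul; congr pair => /=; ring. Qed.

Lemma cmulBl u v w : cmul u w - cmul v w = cmul (u - v) w.
Proof. by rewrite /cmul; congr pair => /=; ring. Qed.

Lemma rot_cmul t z : rot t z = cmul (cos t, sin t) z.
Proof. by rewrite /rot /cmul /=; congr pair; ring. Qed.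

Lemma rotB t z w : rot t z - rot t w = rot t (z - w).
Proof. by rewrite !rot_cmul cmulBr. Qed.

Lemma lmapB z w : lmap z - lmap w = lmap (z - w).
Proof. by rewrite /lmap; congr pair => /=; ring. Qed.

Lemma norm_le_enorm z : `|z| <= enorm z.
Proof. by rewrite plane_normE ge_max normr_fst_le normr_snd_le. Qed.

Lemma enorm_le_norm z : enorm z <= 2 * `|z|.
Proof.
rewrite -(@ler_pXn2r _ 2)// ?nnegrE ?enorm_ge0 ?mulr_ge0// sqr_enorm exprMn.
have h1 : z.1 ^+ 2 <= `|z| ^+ 2.
  rewrite -[z.1 ^+ 2]ger0_norm ?sqr_ge0// normrX.
  by rewrite ler_pXn2r ?nnegrE// plane_normE le_max lexx.
have h2 : z.2 ^+ 2 <= `|z| ^+ 2.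
  rewrite -[z.2 ^+ 2]ger0_norm ?sqr_ge0// normrX.
  by rewrite ler_pXn2r ?nnegrE// plane_normE le_max lexx orbT.
by have := sqr_ge0 `|z|; lra.
Qed.

Lemma enorm_cmul u w : enorm (cmul u w) = enorm u * enorm w.
Proof.
rewrite /enorm -sqrtrM ?addr_ge0 ?sqr_ge0//; congr Num.sqrt.
by rewrite /cmul /=; ring.
Qed.

Lemma norm_cmul_ge u w : `|u| * `|w| <= 2 * `|cmul u w|.
Proof.
apply: le_trans (enorm_le_norm _); rewrite enorm_cmul.
by apply: ler_pM => //; exact: norm_le_enorm.
Qed.

Lemma norm_cmul_le u w : `|cmul u w| <= enorm u * enorm w.
Proof. by rewrite -enorm_cmul norm_le_enorm. Qed.

Lemma norm_rot_le t z : `|rot t z| <= enorm z.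
Proof. by rewrite -(enorm_rot t) norm_le_enorm. Qed.

Lemma norm_lmap_le z : `|lmap z| <= 2 * `|z|.
Proof.
have h1 : `|z.1| <= `|z| by rewrite plane_normE le_max lexx.
have h2 : `|z.2| <= `|z| by rewrite plane_normE le_max lexx orbT.
rewrite [leLHS]plane_normE ge_max; apply/andP; split.
  by rewrite (_ : (lmap z).1 = 2 * z.1)// normrM (ger0_norm (ler0n _ 2)) ler_pM2l.
rewrite (_ : (lmap z).2 = z.2 / 2)// normrM normfV (ger0_norm (ler0n _ 2)).
apply: (@le_trans _ _ `|z.2|).
  by rewrite ler_pdivrMr// ler_peMr ?normr_ge0// ler1n.
by apply: (le_trans h2); rewrite ler_peMl ?normr_ge0// ler1n.
Qed.

Lemma enorm_lmap_le z : enorm (lmap z) <= 2 * enorm z.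
Proof.
rewrite -(@ler_pXn2r _ 2)// ?nnegrE ?enorm_ge0 ?mulr_ge0 ?enorm_ge0//.
by rewrite exprMn -natrX -[leLHS]/(qform z) qform_le.
Qed.

Lemma sqrt_modulus (A B : R) : 0 <= A -> 0 <= B ->
  `|Num.sqrt A - Num.sqrt B| * Num.sqrt B <= `|A - B|.
Proof.
move=> A0 B0; rewrite -{2}(sqr_sqrtr A0) -{3}(sqr_sqrtr B0) subr_sqr normrM.
by rewrite ler_wpM2l// (le_trans _ (ler_norm _))// lerDr sqrtr_ge0.
Qed.

Context (rho al : R -> R) (C d : R) (C_ge0 : 0 <= C) (d_gt0 : 0 < d).

(** The local form of a power of the commuting map composed with [phi_rho]. *)
Let psi z := efl (al (qform (twist rho z))) (twist rho z).

Context (psi_lip : forall z z' : plane R, 0 < enorm z < d -> 0 < enorm z' < d ->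
  `|psi z - psi z'| <= C * `|z - z'|).

Let beta q : plane R := (cos (- al q), sin (- al q)).

Let enorm_beta q : enorm (beta q) = 1.
Proof. by rewrite /enorm /beta /= cos2Dsin2 sqrtr1. Qed.

Let lmap_psi z w : twist rho z = w -> lmap (psi z) = cmul (beta (qform w)) (lmap w).
Proof. by move=> <-; rewrite /psi lmap_efl rot_cmul. Qed.

(** On one circle the twist is a rigid rotation, however large [rho] is there. The preimages of [w]
    and [w'] are thus as close as these points, and the Lipschitz bound is one on the change of
    [beta] between the two ellipses. *)
Lemma circle_modulus w w' : enorm w = enorm w' -> 0 < enorm w < d ->
  `|beta (qform w) - beta (qform w')| * `|lmap w'| <= 8 * (C + 1) * `|w - w'|.
Proof.
move=> ww' wd; pose z := twist (\- rho) w; pose z' := twist (\- rho) w'.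
have Tz : twist rho z = w by exact: twistNK.
have Tz' : twist rho z' = w' by exact: twistNK.
have zd : 0 < enorm z < d by rewrite enorm_twist.
have z'd : 0 < enorm z' < d by rewrite enorm_twist -ww'.
have zz' : `|z - z'| <= 2 * `|w - w'|.
  rewrite /z /z' !twistE ww' rotB (le_trans (norm_rot_le _ _))//.
  exact: enorm_le_norm.
set b := beta _; set b' := beta _; set u' := lmap w'; pose u := lmap w.
have h1 : `|cmul b u - cmul b' u'| <= 2 * (C * (2 * `|w - w'|)).
  rewrite -(lmap_psi Tz) -(lmap_psi Tz') lmapB (le_trans (norm_lmap_le _))//.
  by rewrite ler_pM2l// (le_trans (psi_lip zd z'd))// ler_wpM2l.
have h2 : `|cmul b (u - u')| <= 4 * `|w - w'|.
  rewrite (le_trans (norm_cmul_le _ _))// enorm_beta mul1r lmapB.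
  rewrite (le_trans (enorm_lmap_le _))//.
  by rewrite (_ : 4 * _ = 2 * (2 * `|w - w'|)) ?ler_pM2l ?enorm_le_norm//; ring.
have -> : 8 * (C + 1) * `|w - w'| = 2 * (2 * (C * (2 * `|w - w'|)) + 4 * `|w - w'|).
  by ring.
rewrite (le_trans (norm_cmul_ge _ _))// ler_pM2l// -cmulBl.
have -> : cmul b u' - cmul b' u' = cmul b u - cmul b' u' - cmul b (u - u').
  by rewrite /cmul; congr pair => /=; ring.
by rewrite (le_trans (ler_normB _ _))// lerD.
Qed.

(** The circle of radius sqrt q' meets both ellipses, since [qform] takes on it all values from q' /
    4 to 4 q'. The result is a Lipschitz bound in the logarithm of [q]. *)
Lemma beta_modulus q q' : 0 < q' -> q' < d ^+ 2 -> q' / 4 <= q -> q <= 4 * q' ->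
  `|beta q - beta q'| <= 16 * (C + 1) * (`|q - q'| / q').
Proof.
move=> q'0 q'd q4 q4'.
(* The squared coordinates of the points with x^2 + y^2 = q' and 4 x^2 + y^2 / 4 equal to [q],
   respectively to q' for [B1] and [B2]. *)
pose A1 := 4 / 15 * (q - q' / 4); pose A2 := q' - A1.
pose B1 := q' / 5; pose B2 := 4 / 5 * q'.
have A10 : 0 <= A1 by rewrite /A1; lra.
have A20 : 0 <= A2 by rewrite /A2 /A1; lra.
have B10 : 0 <= B1 by rewrite /B1; lra.
have B20 : 0 <= B2 by rewrite /B2; lra.
pose w : plane R := (Num.sqrt A1, Num.sqrt A2).
pose w' : plane R := (Num.sqrt B1, Num.sqrt B2).
have ew : enorm w = Num.sqrt q'.
  by rewrite /enorm /= !sqr_sqrtr// /A2 addrC subrK.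
have ew' : enorm w' = Num.sqrt q'.
  by rewrite /enorm /= !sqr_sqrtr//; congr Num.sqrt; rewrite /B1 /B2; field.
have qw : qform w = q by rewrite qformE /= !sqr_sqrtr// /A2 /A1; field.
have qw' : qform w' = q' by rewrite qformE /= !sqr_sqrtr// /B1 /B2; field.
have r0 : 0 < Num.sqrt q' by rewrite sqrtr_gt0.
set r := Num.sqrt q' in ew ew' r0.
have rr : r ^+ 2 = q' by rewrite sqr_sqrtr// ltW.
have rd : 0 < enorm w < d.
  by rewrite ew r0 -(@ltr_pXn2r _ 2)// ?nnegrE ?(ltW r0) ?(ltW d_gt0)// rr.
have := circle_modulus (etrans ew (esym ew')) rd; rewrite qw qw'.
(* Both coordinates of [w'] are at least r / 3, which keeps the square roots away from their
   singularity at 0. *)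
have big B : q' / 9 <= B -> r / 3 <= Num.sqrt B.
  move=> qB; have B0 : 0 <= B by lra.
  rewrite -(@ler_pXn2r _ 2)// ?nnegrE ?sqrtr_ge0 ?divr_ge0 ?(ltW r0)//.
  by rewrite sqr_sqrtr// expr_div_n rr -natrX.
have c415 : 0 <= 4 / 15 :> R by lra.
have sq A B : 0 <= A -> 0 <= B -> q' / 9 <= B -> `|A - B| = 4 / 15 * `|q - q'| ->
    `|Num.sqrt A - Num.sqrt B| <= `|q - q'| / r.
  move=> A0 B0 /big rB E.
  have h : `|Num.sqrt A - Num.sqrt B| * (r / 3) <= 4 / 15 * `|q - q'|.
    by rewrite -E (le_trans _ (sqrt_modulus A0 B0))// ler_wpM2l.
  rewrite ler_pdivlMr//; have := normr_ge0 (q - q'); lra.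
have wE : `|w - w'| <= `|q - q'| / r.
  rewrite plane_normE ge_max /=; apply/andP; split; apply: sq => //.
  - by rewrite /B1; lra.
  - rewrite (_ : A1 - B1 = 4 / 15 * (q - q')); last by rewrite /A1 /B1; field.
    by rewrite normrM (ger0_norm c415).
  - by rewrite /B2; lra.
  - rewrite (_ : A2 - B2 = - (4 / 15 * (q - q'))).
      by rewrite normrN normrM (ger0_norm c415).
    by rewrite /A2 /A1 /B2; field.
have lw : r / 2 <= `|lmap w'|.
  rewrite ler_pdivrMr// mulrC; apply: le_trans (enorm_le_norm _).
  rewrite -(@ler_pXn2r _ 2)// ?nnegrE ?enorm_ge0 ?(ltW r0)// rr.
  by rewrite -[leRHS]/(qform w') qw'.
move=> h.
have h1 : `|beta q - beta q'| * (r / 2) <= 8 * (C + 1) * (`|q - q'| / r).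
  apply: (@le_trans _ _ (`|beta q - beta q'| * `|lmap w'|)).
    by rewrite ler_wpM2l.
  by rewrite (le_trans h)// ler_wpM2l// mulr_ge0// addr_ge0.
have r20 : 0 < r / 2 by rewrite divr_gt0.
rewrite -(ler_pM2r r20) (le_trans h1)// le_eqVlt; apply/orP; left; apply/eqP.
by rewrite -rr; field; rewrite gt_eqF.
Qed.

(** Two points at distance at most |h| on one ray are twisted to [(0, r)] and to [(0, h + r)] turned
    by [eta (h + r)]. The axis is chosen because [qform] is stationary there along circles: the turn
    changes [qform] only by a multiple of sin^2 [eta]. By [beta_modulus], the contribution of [rho]
    to the rotation of the ellipses is then of second order, and cannot compensate the displacement
    x |sin [eta]|. Dividing by |h| and letting h tend to 0 gives the bound. *)
Lemma derive_twist_bound r : 0 < r < d -> derivable rho r 1 ->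
  r * `|derive1 rho r| <= 2 * C + 128 * (C + 1).
Proof.
move=> /andP[r0 rd] rder.
have rD : is_derive r 1 rho (derive1 rho r) by rewrite derive1E; exact: derivableP.
pose eta x := rho x - rho r.
have etaD : is_derive r 1 eta (derive1 rho r).
  have k : is_derive r 1 (fun=> rho r : R) (0 : R) by exact: is_derive_cst.
  by apply: (is_derive_ext (is_deriveB rD k)) => //; rewrite subr0.
have eta0 : eta r = 0 by rewrite /eta subrr.
(* The sine is what the position of the twisted point shows; at [r] it has the same derivative as
   the angle. *)
have sD : is_derive r 1 (fun x => sin (eta x)) (derive1 rho r).
  apply: (is_derive_ext (@is_derive1_comp R sin eta r _ _ (is_derive_sin _) etaD)) => //.
  by rewrite eta0 cos0 mul1r.
pose S h := h^-1 * (sin (eta (h + r)) - sin (eta r)).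
have Sc : S h @[h --> (0 : R)^'] --> derive1 rho r by move/is_derive1P: sD.
have idc : (fun h : R => h + r) @ (0 : R)^' --> r.
  have h : (fun h : R => h + r) @ (0 : R) --> r.
    by rewrite -[X in _ --> X]add0r; apply: cvgD; [exact: cvg_id|exact: cvg_cst].
  by apply: (cvg_trans _ h); apply: cvg_app; exact: cvg_within.
have sc : sin (eta (h + r)) @[h --> (0 : R)^'] --> (0 : R).
  have ec : {for r, continuous (fun x => sin (eta x))}.
    by apply: differentiable_continuous; apply/derivable1_diffP; case: sD.
  have := cvg_comp _ _ idc ec; by rewrite eta0 sin0.
pose Q h := (h + r) ^+ 2 * (4^-1 + 15 / 4 * sin (eta (h + r)) ^+ 2).
have Qc : Q h @[h --> (0 : R)^'] --> r ^+ 2 / 4.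
  have -> : r ^+ 2 / 4 = r * r * (4^-1 + 15 / 4 * (0 * 0)) by rewrite mulr0 mulr0 addr0 expr2.
  apply: cvgM; first by apply: cvgM.
  apply: cvgD; first exact: cvg_cst.
  by apply: cvgM; [exact: cvg_cst|apply: cvgM].
pose K := 16 * (C + 1).
have K0 : 0 <= K by rewrite mulr_ge0// addr_ge0.
(* [f1] and [f2] are the two sides after division by |h|. The term of [f2] that contains [S] carries
   a factor sin [eta] and vanishes in the limit, leaving 2 C + 8 K with K = 16 (C + 1). *)
pose f1 h := (h + r) * `|S h|.
pose f2 h := 2 * C + 16 * (h + r) * K / r ^+ 2 *
   ((h + r + r) / 4 + 15 / 4 * ((h + r) ^+ 2 * (`|S h| * `|sin (eta (h + r))|))).
have f1c : f1 h @[h --> (0 : R)^'] --> r * `|derive1 rho r|.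
  by apply: cvgM => //; exact: cvg_norm.
have f2c : f2 h @[h --> (0 : R)^'] --> 2 * C + 16 * r * K / r ^+ 2 *
   ((r + r) / 4 + 15 / 4 * (r * r * (`|derive1 rho r| * `|0 : R|))).
  apply: cvgD; first exact: cvg_cst.
  apply: cvgM.
    by apply: cvgM; [apply: cvgM; [apply: cvgM => //|]|]; exact: cvg_cst.
  apply: cvgD.
    by apply: cvgM; [apply: cvgD => //|]; exact: cvg_cst.
  apply: cvgM; first exact: cvg_cst.
  apply: cvgM; first by apply: cvgM.
  by apply: cvgM; exact: cvg_norm.
have -> : 2 * C + 128 * (C + 1) = 2 * C + 16 * r * K / r ^+ 2 *
   ((r + r) / 4 + 15 / 4 * (r * r * (`|derive1 rho r| * `|0 : R|))).
  by rewrite normr0 /K; field; rewrite gt_eqF.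
apply: (ler_cvg_to f1c f2c).
have r24 : 0 < r ^+ 2 / 4 by rewrite divr_gt0// exprn_gt0.
near=> h.
have h0 : h != 0 by near: h; exact: nbhs_dnbhs_neq.
have x0 : 0 < h + r by near: h; exact: (cvgr_gt _ idc).
have xd : h + r < d by near: h; exact: (cvgr_lt _ idc).
(* Eventually the two ellipses are within the factor 4 that [beta_modulus] allows. *)
have q1 : r ^+ 2 / 4 / 4 <= Q h.
  by near: h; apply: (cvgr_ge _ Qc); rewrite ltr_pdivrMr// ltr_pMr// ltr1n.
have q2 : Q h <= 4 * (r ^+ 2 / 4).
  by near: h; apply: (cvgr_le _ Qc); rewrite ltr_pMl// ltr1n.
set x := h + r in x0 xd *.
pose z0 := rot (- rho r) (0, r) : plane R; pose z := rot (- rho r) (0, x) : plane R.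
have en (y : R) : 0 < y -> enorm ((0, y) : plane R) = y.
  by move=> y0; rewrite /enorm /= expr0n add0r sqrtr_sqr gtr0_norm.
have Tz0 : twist rho z0 = (0, r) by rewrite twistE enorm_rot en// rotNK.
have Tz : twist rho z = rot (eta x) (0, x) by rewrite twistE enorm_rot en// rotD.
have z0d : 0 < enorm z0 < d by rewrite enorm_rot en// r0.
have zd : 0 < enorm z < d by rewrite enorm_rot en// x0.
have zz0 : `|z - z0| <= `|h|.
  rewrite /z /z0 rotB (le_trans (norm_rot_le _ _))//.
  by rewrite /enorm /= subrr expr0n add0r /x addrK sqrtr_sqr.
pose w := rot (eta x) (0, x) : plane R; pose u := lmap w; pose u0 := lmap (0, r) : plane R.
have Qw : qform w = Q h.
  rewrite qformE /w /rot /= /Q -/x !mul0r sub0r add0r sqrrN !exprMn cos2sin2; by field.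
have Qw0 : qform (0, r) = r ^+ 2 / 4 by rewrite qformE /= expr0n mulr0 add0r.
set D := beta (Q h) - beta (r ^+ 2 / 4).
have DK : `|D| <= K * (`|Q h - r ^+ 2 / 4| / (r ^+ 2 / 4)).
  apply: beta_modulus => //.
  rewrite (@lt_trans _ _ (r ^+ 2))//; last by rewrite ltr_pXn2r ?nnegrE ?ltW.
  by rewrite ltr_pdivrMr// ltr_pMr ?exprn_gt0// ltr1n.
have QQ : `|Q h - r ^+ 2 / 4| <= `|h| * (x + r) / 4 + 15 / 4 * (x ^+ 2 * sin (eta x) ^+ 2).
  rewrite (_ : Q h - _ = h * (x + r) / 4 + 15 / 4 * (x ^+ 2 * sin (eta x) ^+ 2)).
    have c154 : 0 <= 15 / 4 :> R by lra.
    rewrite (le_trans (ler_normD _ _))// lerD//.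
      by rewrite !normrM (ger0_norm (ltW (addr_gt0 x0 r0))) normfV (ger0_norm (ler0n _ 4)).
    by rewrite ger0_norm// mulr_ge0// mulr_ge0// sqr_ge0.
  by rewrite /Q /x; field.
have main : x * `|sin (eta x)| <= 2 * C * `|h| + 4 * x * `|D|.
  have uu0 : 2 * (x * `|sin (eta x)|) <= `|u - u0|.
    rewrite plane_normE le_max /u /u0 /w /lmap /rot /=; apply/orP; left.
    by rewrite mulr0 subr0 mul0r sub0r mulrN normrN !normrM (gtr0_norm x0) ger0_norm.
  have e1 : cmul (beta (r ^+ 2 / 4)) (u - u0) =
     cmul (beta (Q h)) u - cmul (beta (r ^+ 2 / 4)) u0 - cmul D u.
    by rewrite /cmul /D; congr pair => /=; ring.
  have h1 : `|cmul (beta (Q h)) u - cmul (beta (r ^+ 2 / 4)) u0| <= 2 * (C * `|h|).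
    rewrite -Qw -Qw0 -(lmap_psi Tz) -(lmap_psi Tz0) lmapB (le_trans (norm_lmap_le _))//.
    by rewrite ler_pM2l// (le_trans (psi_lip zd z0d))// ler_wpM2l.
  have h2 : `|cmul D u| <= 2 * `|D| * (2 * x).
    rewrite (le_trans (norm_cmul_le _ _))//; apply: ler_pM; rewrite ?enorm_ge0//.
      exact: enorm_le_norm.
    by rewrite (le_trans (enorm_lmap_le _))// enorm_rot en.
  have h3 : `|u - u0| <= 2 * (2 * (C * `|h|) + 2 * `|D| * (2 * x)).
    apply: (@le_trans _ _ (2 * `|cmul (beta (r ^+ 2 / 4)) (u - u0)|)).
      rewrite (le_trans (norm_le_enorm _))//.
      have -> : enorm (u - u0) = enorm (cmul (beta (r ^+ 2 / 4)) (u - u0)).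
        by rewrite enorm_cmul enorm_beta mul1r.
      exact: enorm_le_norm.
    by rewrite ler_pM2l// e1 (le_trans (ler_normB _ _))// lerD.
  by have := le_trans uu0 h3; lra.
have hp : 0 < `|h| by rewrite normr_gt0.
have SE : `|h| * `|S h| = `|sin (eta x)|.
  by rewrite -normrM /S eta0 sin0 subr0 mulrA divff// mul1r.
rewrite -(ler_pM2l hp) /f1 -/x mulrCA SE (le_trans main)//.
have c16 : 0 <= 16 * x * K / r ^+ 2.
  apply: divr_ge0; last by apply: exprn_ge0; exact: ltW.
  by apply: mulr_ge0 => //; apply: mulr_ge0 => //; exact: ltW.
have DK2 : 4 * x * `|D| <= 16 * x * K / r ^+ 2 *
    (`|h| * (x + r) / 4 + 15 / 4 * (x ^+ 2 * sin (eta x) ^+ 2)).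
  apply: (@le_trans _ _ (4 * x * (K * (`|Q h - r ^+ 2 / 4| / (r ^+ 2 / 4))))).
    by rewrite ler_wpM2l// mulr_ge0// ltW.
  rewrite (_ : 4 * x * _ = 16 * x * K / r ^+ 2 * `|Q h - r ^+ 2 / 4|).
    exact: ler_wpM2l.
  by field; rewrite gt_eqF.
rewrite /f2 -/x [leRHS]mulrDr; apply: lerD; first by rewrite mulrC.
rewrite (le_trans DK2)// [leRHS]mulrCA.
rewrite ler_wpM2l//.
rewrite [leRHS](_ : _ = `|h| * (x + r) / 4 +
    15 / 4 * (x ^+ 2 * ((`|h| * `|S h|) * `|sin (eta x)|))); last by ring.
by rewrite SE -normrM -expr2 ger0_norm// sqr_ge0.
Unshelve. all: by end_near. Qed.

End RotationModulus.

(** * Growth of the twisting angle *)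

Section Growth.
Context {R : realType}.

(** The mean value theorem with the crude bound |rho'| <= B / r makes r |rho r| bounded near 0,
    whereas r times r^(-a-1) is r^(-a), which is unbounded. *)
Lemma powR_growth (rho : R -> R) (a d B : R) : 0 < a -> 0 < d ->
  (forall r, 0 < r < d -> derivable rho r 1) ->
  (forall r, 0 < r < d -> r * `|derive1 rho r| <= B) ->
  ~ (rho =Theta_(0^'+) (fun r : R => r `^ (- a - 1))).
Proof.
move=> a0 d0 rder rB Th.
have [k k0 Hk] : exists2 k : R, 0 < k &
    \forall r \near 0^'+, k * r `^ (- a - 1) <= `|rho r|.
  rewrite Th; case: bigTheta => f k1 k2 H _.
  exists k1%:num => //; apply: filterS H => r.
  by rewrite (ger0_norm (powR_ge0 _ _)).
have B0 : 0 <= B.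
  have d2 : 0 < d / 2 < d by rewrite divr_gt0//= ltr_pdivrMr// ltr_pMr// ltr1n.
  by apply: le_trans (rB _ d2); rewrite mulr_ge0// divr_ge0// ltW.
pose e := d / 2.
have e0 : 0 < e by rewrite divr_gt0.
have ed : e < d by rewrite ltr_pdivrMr// ltr_pMr// ltr1n.
have bound r : 0 < r < e -> `|rho r| <= `|rho e| + e * B / r.
  move=> /andP[r0 re].
  have [s|s sin] := @partial_MVT R rho (derive1 rho) r e.
    rewrite (min_idPl (ltW re)) (max_idPr (ltW re)) => /andP[rs se].
    rewrite derive1E; apply/derivableP/rder.
    by rewrite (lt_le_trans r0)//= (le_lt_trans se).
  move: sin; rewrite (min_idPl (ltW re)) (max_idPr (ltW re)) => /andP[rs se] E.
  have s0 : 0 < s by exact: lt_le_trans rs.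
  rewrite -[rho r](subrK (rho e)) addrC (le_trans (ler_normD _ _))// lerD2l E normrM.
  rewrite -mulrA; apply: ler_pM => //.
    by rewrite ler_norml; apply/andP; split; lra.
  rewrite ler_pdivlMr// mulrC.
  have sd : 0 < s < d by rewrite s0 (le_lt_trans se).
  by apply: le_trans (rB s sd); rewrite ler_wpM2r.
have /nbhs_ballP[dl /= dl0 Hdl] := Hk.
pose m := Num.min dl e; have m0 : 0 < m by rewrite lt_min dl0.
pose L : R := (`|rho e| + e * B) / k.
have L0 : 0 <= L by rewrite divr_ge0 ?(ltW k0)// addr_ge0// mulr_ge0// ltW.
(* By exp y > 1 + y, the first summand makes [expR (a * x)] exceed [L] and the second makes
   [expR (- x)] smaller than [m]. *)
pose x : R := L / a + m^-1.
have x0 : 0 < x by apply: ltr_wpDl; [exact: divr_ge0 L0 (ltW a0)|rewrite invr_gt0].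
pose r := expR (- x).
have r0 : 0 < r by exact: expR_gt0.
have r1 : r <= 1 by rewrite -expR0 ler_expR oppr_le0 ltW.
have rm : r < m.
  rewrite /r expRN -[m]invrK ltf_pV2 ?posrE ?expR_gt0 ?invr_gt0//.
  apply: lt_trans (expR_gt1Dx (lt0r_neq0 x0)).
  by rewrite /x; have := divr_ge0 L0 (ltW a0); lra.
have rdl : ball 0 dl r.
  by rewrite /ball/= sub0r normrN gtr0_norm// (lt_le_trans rm)// ge_min lexx.
have := Hdl r rdl r0; rewrite /= => lo.
have re : 0 < r < e by rewrite r0 (lt_le_trans rm)// ge_min lexx orbT.
have := le_trans lo (bound r re) => {lo}.
have -> : r `^ (- a - 1) = expR (a * x) / r.
  rewrite /powR gt_eqF// /r expRK -expRN opprK -expRD; congr expR; ring.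
rewrite -(ler_pM2r r0) mulrDl divfK ?gt_eqF//.
rewrite (_ : k * (expR (a * x) / r) * r = k * expR (a * x)); last first.
  by rewrite -mulrA divfK// gt_eqF.
move=> h.
have h2 : k * expR (a * x) <= `|rho e| + e * B.
  by rewrite (le_trans h)// lerD2r ler_piMr.
have : L < expR (a * x).
  apply: lt_trans (expR_gt1Dx _); last by rewrite gt_eqF// mulr_gt0.
  rewrite /x mulrDr mulrCA divff ?gt_eqF// mulr1.
  by have : 0 < a / m; [rewrite divr_gt0|lra].
rewrite -(ltr_pM2l k0) mulrC {1}/L divfK ?gt_eqF// => /lt_le_trans/(_ h2).
by rewrite ltxx.
Qed.

End Growth.

(** * Recurrence from the area *)

Section Recurrence.
Local Open Scope ereal_scope.
Context {R : realType} (M : symplectic_surface R).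
Context (mu : {measure set (borel M) -> \bar R}) (mu_area : area_measure mu).
Context (c : chart R M) (c_darboux : darboux_chart c).
Implicit Types (U : set M).

Lemma open_chart_image (c' : chart R M) U : open U -> U `<=` chart_dom c' ->
  open (c' @` U).
Proof.
move=> Uo Uc; rewrite openE => _ [p Up <-]; rewrite /interior.
have cp := chart_imgP (Uc _ Up).
have n1 : \forall z \near c' p, U (chart_inv c' z).
  have ic : chart_inv c' @ c' p --> p.
    by rewrite -{2}(chart_mapK (Uc _ Up)); exact: (chart_inv_continuous cp).
  by apply: ic; exact: open_nbhs_nbhs.
apply: filterS2 n1 (near_chart_img cp) => z Uz cz.
by exists (chart_inv c' z) => //; rewrite chart_invK.
Qed.

Lemma open_borel U : open U -> measurable (U : set (borel M)).
Proof. by move=> Uo; exact: sub_sigma_algebra. Qed.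

Lemma mu_chart U : open U -> U `<=` chart_dom c -> mu U = leb2 (c @` U).
Proof.
move=> Uo Uc; have [ca w1] := c_darboux.
rewrite (mu_area ca (open_borel Uo) Uc).
have mU := open_measurable2 (open_chart_image Uo Uc).
rewrite (eq_integral (cst 1)); last first.
  by move=> z /set_mem[p Up <-] /=; rewrite w1 ?normr1//; exact/chart_imgP/Uc.
by rewrite integral_cst// mul1e.
Qed.

Lemma leb2_bounded (B : R) : (0 <= B)%R ->
  leb2 [set z | (`|z| <= B)%R] <= ((2 * B) ^+ 2)%:E.
Proof.
move=> B0.
have -> : [set z : plane R | (`|z| <= B)%R] =
    `[(- B)%R, B]%classic `*` `[(- B)%R, B]%classic.
  apply/seteqP; split => z /=; rewrite plane_normE ge_max !in_itv/= -!ler_norml.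
    by move=> /andP[].
  by move=> [-> ->].
have -> : leb2 (`[(- B)%R, B]%classic `*` `[(- B)%R, B]%classic) =
    lebesgue_measure `[(- B)%R, B]%classic * lebesgue_measure `[(- B)%R, B]%classic.
  by apply: product_measure1E; exact: measurable_itv.
rewrite !lebesgue_measure_itv /= lte_fin; case: ifP => _; last first.
  by rewrite mul0e lee_fin sqr_ge0.
by rewrite -EFinB -EFinM lee_fin opprK expr2 -mulr2n mulr_natl.
Qed.

Lemma leb2_gt0 (U : set (plane R)) : open U -> U !=set0 -> 0 < leb2 U.
Proof.
move=> Uo [z Uz].
have /nbhs_ballP[e /= e0 zU] : \near z, U z by exact: open_nbhs_nbhs.
apply: (@lt_le_trans _ _ (leb2 (ball z.1 e `*` ball z.2 e))).
  rewrite /leb2 /= product_measure1E; [|exact: measurable_ball|exact: measurable_ball].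
  rewrite /= !lebesgue_measure_ball ?ltW// -EFinM lte_fin mulr_gt0//;
  by rewrite mulrn_wgt0.
apply: le_measure; rewrite ?inE.
- by apply: measurableX; exact: measurable_ball.
- exact: open_measurable2.
- by move=> p [/= p1 p2]; apply: zU; split.
Qed.

Lemma mu_gt0 U : open U -> U `<=` chart_dom c -> U !=set0 -> 0 < mu U.
Proof.
move=> Uo Uc [p Up]; rewrite mu_chart//; apply: leb2_gt0; first exact: open_chart_image.
by exists (c p); exists p.
Qed.

(** The area of [M] may be infinite; in Darboux coordinates a compact subset of the chart fits into
    a square. *)
Lemma mu_compact_bound (K : set M) : compact K -> K `<=` chart_dom c ->
  exists b : R, forall U, open U -> U `<=` K -> mu U <= b%:E.
Proof.
move=> Kc Kd.
have cK : compact (c @` K).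
  apply: continuous_compact => //; apply: continuous_in_subspaceT => p /set_mem Kp.
  exact/chart_map_continuous/Kd.
have [B [_ HB]] := compact_bounded cK.
pose b : R := (`|B| + 1)%R; have b0 : (0 <= b)%R by rewrite addr_ge0.
have Bb : (B < b)%R by rewrite (le_lt_trans (ler_norm _))// ltrDl.
have KB z : (c @` K) z -> (`|z| <= b)%R by exact: HB Bb z.
exists ((2 * b) ^+ 2)%R => U Uo UK.
have Ud : U `<=` chart_dom c by exact: subset_trans Kd.
rewrite mu_chart//; apply: le_trans (leb2_bounded b0).
apply: le_measure; rewrite ?inE.
- by apply: open_measurable2; exact: open_chart_image.
- have -> : [set z : plane R | (`|z| <= b)%R] =
      `[(- b)%R, b]%classic `*` `[(- b)%R, b]%classic.
    apply/seteqP; split => z /=; rewrite plane_normE ge_max !in_itv/= -!ler_norml.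
      by move=> /andP[].
    by move=> [-> ->].
  by apply: measurableX; exact: measurable_itv.
- by move=> _ [p Up <-]; apply: KB; exists p => //; exact: UK.
Qed.

Lemma iter_image (T : Type) (g : T -> T) k (U : set T) :
  iter k.+1 g @` U = g @` (iter k g @` U).
Proof.
by apply/seteqP; split => [_ [p Up <-]|_ [_ [p Up <-] <-]]; [exists (iter k g p) => //; exists p|exists p].
Qed.

(** Poincare recurrence, run forwards on images. If no point of [U] came back, the images of [U]
    would be disjoint subsets of [K], each of measure at least [mu U] > 0, while open subsets of [K]
    have bounded measure. *)
Lemma measure_recurrence (g : M -> M) (K U : set M) : injective g ->
  (forall V, open V -> open (g @` V)) ->
  compact K -> K `<=` chart_dom c ->
  (forall V, open V -> V `<=` K -> mu V <= mu (g @` V)) ->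
  open U -> U !=set0 -> (forall k, iter k g @` U `<=` K) ->
  exists n p, [/\ (0 < n)%N, U p & U (iter n g p)].
Proof.
move=> g_inj g_open Kc Kd g_mu Uo U0 UK; apply: contrapT => no.
pose W k := iter k g @` U.
have Wo k : open (W k).
  elim: k => [|k IH]; first by rewrite /W image_id.
  by rewrite /W iter_image; exact: g_open.
have it_inj k : injective (iter k g).
  by elim: k => [//|k IH] x y /= /g_inj/IH.
(* Cancelling [iter i g] in a common point of two images would give a point of [U] that returns
   after [j - i] steps. *)
have Wt : trivIset setT (W : nat -> set (borel M)).
  move=> i j _ _ [_ [[x Ux <-] [y Uy E]]].
  wlog ij : i j x y Ux Uy E / (i <= j)%N => [hw|].
    have [ij|/ltnW ji] := leqP i j; first exact: (hw i j x y).
    by apply/esym; exact: (hw j i y x).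
  apply/eqP; rewrite eqn_leq ij /= leqNgt; apply/negP => ltij.
  apply: no; exists (j - i)%N, y; split => //; first by rewrite subn_gt0.
  have /it_inj <- // : iter i g x = iter i g (iter (j - i) g y).
  by rewrite -iterD subnKC.
have [b muK] := mu_compact_bound Kc Kd.
have Ud : U `<=` chart_dom c.
  by move=> p Up; apply/Kd/(UK 0%N); exists p.
have m0 := mu_gt0 Uo Ud U0.
have muW k : mu U <= mu (W k).
  elim: k => [|k IH]; first by rewrite /W image_id.
  by rewrite (le_trans IH)// /W iter_image; apply: g_mu; [exact: Wo|exact: UK].
have total : \sum_(k <oo) mu (W k) <= b%:E.
  have <- : mu (\bigcup_k W k) = \sum_(k <oo) mu (W k).
    apply: measure_semi_bigcup => [k||]; first exact: open_borel.
      exact: Wt.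
    by apply: bigcupT_measurable => k; exact: open_borel.
  apply: muK; first by apply: bigcup_open => k _; exact: Wo.
  by move=> p [k _ /UK].
have Uf : mu U \is a fin_num.
  rewrite ge0_fin_numE; last exact: measure_ge0.
  apply: (le_lt_trans _ (ltry b)); apply: muK => //.
  by move=> p Up; apply: (UK 0%N); exists p.
have fm0 : (0 < fine (mu U))%R by rewrite fine_gt0// m0 ltey_eq Uf.
pose N := (Num.truncn (`|b| / fine (mu U))).+1.
have : (`|b| / fine (mu U) < N%:R)%R.
  by have /andP[_] := @truncn_itv R (`|b| / fine (mu U))%R (divr_ge0 (normr_ge0 _) (ltW fm0)).
rewrite ltr_pdivrMr// => bN.
have : \sum_(0 <= k < N) mu (W k) <= b%:E.
  apply: le_trans total; apply: nneseries_lim_ge => k _ _; exact: measure_ge0.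
have : \sum_(0 <= k < N) mu U <= \sum_(0 <= k < N) mu (W k).
  by apply: lee_sum => k _; exact: muW.
move=> /le_trans/[apply].
rewrite -(fineK Uf) sumEFin lee_fin big_const_nat subn0 iter_addr_0 => h.
have := lt_le_trans bN (le_trans _ (ler_norm b)).
rewrite mulr_natl => /(_ h).
by rewrite ltxx.
Qed.

End Recurrence.

(** * Area and the inverse twist on the surface *)

Section TwistArea.
Context {R : realType} (M : symplectic_surface R).
Context (mu : {measure set (borel M) -> \bar R}) (mu_area : area_measure mu).
Context (c : chart R M) (c_darboux : darboux_chart c).
Context (c_disk : [set z | (enorm z <= 1)%R] `<=` chart_img c).
Context (rho : R -> R) (rho_supp : forall r : R, (1 <= r)%R -> rho r = 0%R).
Context (rho_cont : {in [pred r : R | (0 < r)%R], continuous rho}).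

Let rhoN_supp (r : R) : (1 <= r)%R -> (\- rho) r = 0%R.
Proof. by move=> /rho_supp /= ->; rewrite oppr0. Qed.

Let rhoN_cont : {in [pred r : R | (0 < r)%R], continuous (\- rho)%R}.
Proof. by move=> r r0; apply: cvgN; exact: rho_cont. Qed.

Lemma ctwistN_image U : ctwist c (\- rho)%R @` U = ctwist c rho @^-1` U.
Proof.
apply/seteqP; split => [_ [p Up <-]|p Up] /=.
  by rewrite (ctwistNK c_disk rho_supp).
by exists (ctwist c rho p) => //; rewrite (ctwistK c_disk rho_supp).
Qed.

Lemma ctwistN_open (U : set M) : open U -> open (ctwist c (\- rho)%R @` U).
Proof.
move=> Uo; rewrite ctwistN_image; apply: open_comp => // p _.
exact: (ctwist_continuous c_disk rho_supp rho_cont).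
Qed.

(** Fatou's inequality, applied to [\- rho] and the image of [U], goes in the direction that
    recurrence asks for. *)
Lemma ctwistN_area (U : set M) : open U -> U `<=` chart_dom c ->
  (mu U <= mu (ctwist c (\- rho)%R @` U))%E.
Proof.
move=> Uo Uc; have TUo := ctwistN_open Uo.
have TUc : ctwist c (\- rho)%R @` U `<=` chart_dom c.
  by move=> _ [p Up <-]; apply: (ctwist_dom c_disk rhoN_supp); exact: Uc.
rewrite !(mu_chart mu_area c_darboux)//.
apply: le_trans (leb2_twist_le rhoN_cont (open_chart_image TUo TUc)).
rewrite le_eqVlt; apply/orP; left; apply/eqP; congr (leb2 _).
apply/seteqP; split => [_ [p Up <-]|z [_ [p Up <-]]] /=.
  exists (ctwist c (\- rho)%R p); first by exists p.
  by rewrite (chart_ctwist c_disk rhoN_supp)//; exact: Uc.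
rewrite (chart_ctwist c_disk rhoN_supp); last exact: Uc.
by move=> /(can_inj (twistNK rho)) <-; exists p.
Qed.

End TwistArea.

(** * Maps of class C^1 and local Lipschitz estimates *)

Section C1Maps.
Context {R : realType}.
Implicit Types (U : set (plane R)) (f : plane R -> plane R) (z v X : plane R).

Lemma Cn0_comp U f (p : plane R -> R) (h : plane R -> R) : open U -> continuous p ->
  Cn_on 0 U f -> (forall z, U z -> h z = p (f z)) -> Cn_on 0 U h.
Proof.
move=> Uo pc fc E z Uz.
suff : h @ z --> p (f z) by rewrite -E.
have hh : (fun w => p (f w)) @ z --> p (f z).
  by apply: (@continuous_comp _ _ _ f p); [exact: fc|exact: pc].
apply: cvg_trans hh; apply: near_eq_cvg.
have := open_nbhs_nbhs (conj Uo Uz); apply: filterS => w Uw.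
by rewrite E.
Qed.

Lemma Cn1_pair U f : open U -> Cn_on 1 U f ->
  Cn_on 1 U (fun z => (f z).1) /\ Cn_on 1 U (fun z => (f z).2).
Proof.
move=> Uo [fd c1 c2].
have D1 v z : derivable f z v -> is_derive z v (fun z => (f z).1) ('D_v f z).1 /\
    is_derive z v (fun z => (f z).2) ('D_v f z).2.
  by move=> /derivableP/is_derive_pairP.
have fstc : continuous (fst : plane R -> R) by move=> z; exact: cvg_fst.
have sndc : continuous (snd : plane R -> R) by move=> z; exact: cvg_snd.
split; split.
- by move=> z /fd[/D1[[d1 _] _] /D1[[d2 _] _]].
- apply: (Cn0_comp Uo fstc c1) => z Uz.
  by have [/D1[[_ E] _] _] := fd z Uz.
- apply: (Cn0_comp Uo fstc c2) => z Uz.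
  by have [_ /D1[[_ E] _]] := fd z Uz.
- by move=> z /fd[/D1[_ [d1 _]] /D1[_ [d2 _]]].
- apply: (Cn0_comp Uo sndc c1) => z Uz.
  by have [/D1[_ [_ E]] _] := fd z Uz.
- apply: (Cn0_comp Uo sndc c2) => z Uz.
  by have [_ /D1[_ [_ E]]] := fd z Uz.
Qed.

Lemma C1_curve U f (g : R -> plane R) (t : R) X : open U -> Cn_on 1 U f ->
  U (g t) -> is_derive t 1 g X -> is_derive t 1 (fun s => f (g s)) ('D_X f (g t)).
Proof.
move=> Uo /(Cn1_pair Uo)[f1 f2] Ug gX.
have s1 := Cn1_sdiff Uo Ug f1; have s2 := Cn1_sdiff Uo Ug f2.
have d1 := sdiff_derive X s1; have d2 := sdiff_derive X s2.
set a := _ + _ in d1; set b := _ + _ in d2.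
have fX : is_derive (g t) X f (a, b) by exact/is_derive_pairP.
have [_ ->] := fX; apply/is_derive_pairP; split => /=.
  exact: (sdiff_curve (f := fun z => (f z).1) s1 gX).
exact: (sdiff_curve (f := fun z => (f z).2) s2 gX).
Qed.

(** A form of [lipschitz_on f (nbhs (z, z))] with explicit radius and constant, stable under
    composition. *)
Definition loclip2 f z := exists d L : R, [/\ 0 < d, 0 < L &
  forall p q, ball z d p -> ball z d q -> `|f p - f q| <= L * `|p - q|].

Lemma C1_loclip2 U f z : open U -> Cn_on 1 U f -> U z -> loclip2 f z.
Proof.
move=> Uo /(Cn1_pair Uo)[f1 f2] Uz.
have [d1 [L1 [d10 L10 H1]]] := sdiff_loclip (Cn1_sdiff Uo Uz f1).
have [d2 [L2 [d20 d21 L20 H2]]] := loclipS d10 (sdiff_loclip (Cn1_sdiff Uo Uz f2)).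
exists d2, (2 * (L1 + L2)); split => //.
  by rewrite mulr_gt0// addr_gt0.
move=> p q zp zq.
have h1 := H1 p q (le_ball d21 zp) (le_ball d21 zq); have h2 := H2 p q zp zq.
have n1 : `|p.1 - q.1| <= `|p - q| by rewrite [leRHS]plane_normE le_max lexx.
have n2 : `|p.2 - q.2| <= `|p - q| by rewrite [leRHS]plane_normE le_max lexx orbT.
have nn : `|p.1 - q.1| + `|p.2 - q.2| <= 2 * `|p - q|.
  by rewrite mulr_natl mulr2n lerD.
rewrite [leLHS]plane_normE ge_max; apply/andP; split.
  apply: (le_trans h1); apply: (@le_trans _ _ (L1 * (2 * `|p - q|))).
    by rewrite ler_pM2l.
  rewrite mulrCA mulrA ler_wpM2r// ler_pM2l// lerDl; exact: ltW.
apply: (le_trans h2); apply: (@le_trans _ _ (L2 * (2 * `|p - q|))).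
  by rewrite ler_pM2l.
rewrite mulrCA mulrA ler_wpM2r// ler_pM2l// lerDr; exact: ltW.
Qed.

Lemma loclip2_lipschitz f z : loclip2 f z -> lipschitz_on f (nbhs (z, z)).
Proof.
move=> [d [L [d0 L0 H]]]; exists L; split; first exact: gtr0_real.
move=> k Lk; exists (ball z d, ball z d); first by split; exact: nbhsx_ballx.
move=> [p q] [/= zp zq]; apply: (le_trans (H p q zp zq)).
by rewrite /self_sub /=; apply: ler_wpM2r => //; exact: ltW.
Qed.

Lemma lipschitz_loclip2 f z : lipschitz_on f (nbhs (z, z)) -> loclip2 f z.
Proof.
move=> [L [_ HL]]; pose k := `|L| + 1.
have Lk : L < k by rewrite (le_lt_trans (ler_norm _))// ltrDl.
have [[A B] [/= zA zB] AB] := HL k Lk.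
have zAB : \forall w \near z, A w /\ B w by exact: filterI.
move/nbhs_ballP: zAB => [d /= d0 zd].
exists d, k; split => //; first by rewrite ltr_wpDl.
by move=> p q /zd[Ap _] /zd[_ Bq]; exact: (AB (p, q) (conj Ap Bq)).
Qed.

Lemma loclip2_comp f (h : plane R -> plane R) z : loclip2 f z -> loclip2 h (f z) ->
  loclip2 (fun p => h (f p)) z.
Proof.
move=> [d [L [d0 L0 H]]] [e [K [e0 K0 Hh]]].
exists (Num.min d (e / L)), (K * L); split.
- by rewrite lt_min d0 divr_gt0.
- exact: mulr_gt0.
have fb p : ball z (Num.min d (e / L)) p -> ball (f z) e (f p).
  move=> zp; have zp1 : ball z d p by apply: le_ball zp; rewrite ge_min lexx.
  have : ball z (e / L) p by apply: le_ball zp; rewrite ge_min lexx orbT.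
  have := H z p (ballxx _ d0) zp1.
  have bE (x y : plane R) (r : R) : ball x r y <-> `|x - y| < r.
    by rewrite plane_ballE plane_normE gt_max; split => /andP.
  move=> h1 /bE h2; apply/bE; apply: (le_lt_trans h1).
  by rewrite mulrC -ltr_pdivlMr.
move=> p q zp zq; apply: (le_trans (Hh _ _ (fb p zp) (fb q zq))).
rewrite -mulrA ler_pM2l//; apply: H.
  by apply: le_ball zp; rewrite ge_min lexx.
by apply: le_ball zq; rewrite ge_min lexx.
Qed.

Lemma loclip2_near f h z : (\forall p \near z, f p = h p) -> loclip2 f z -> loclip2 h z.
Proof.
move=> /nbhs_ballP[e /= e0 E] [d [L [d0 L0 H]]].
exists (Num.min d e), L; split => //; first by rewrite lt_min d0.
move=> p q zp zq; rewrite -!E; first apply: H.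
- by apply: le_ball zp; rewrite ge_min lexx.
- by apply: le_ball zq; rewrite ge_min lexx.
- by apply: le_ball zq; rewrite ge_min lexx orbT.
- by apply: le_ball zp; rewrite ge_min lexx orbT.
Qed.

Lemma near_cst (h : plane R -> R) z :
  (\forall w \near z, forall v, is_derive w v h 0) -> \forall w \near z, h w = h z.
Proof.
move=> /nbhs_ballP[e /= e0 H]; apply/nbhs_ballP; exists e => // w zw.
have seg (s : R) : 0 <= s <= 1 -> ball z e (z + s *: (w - z)).
  move=> /andP[s0 s1]; move/plane_ballE: zw => [z1 z2]; apply/plane_ballE.
  have aux (x y : R) : `|x - y| < e -> `|x - (x + s * (y - x))| < e.
    move=> xy; rewrite opprD addrA subrr add0r normrN normrM (ger0_norm s0).
    by rewrite distrC (le_lt_trans _ xy)// ler_piMl.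
  by split; apply: aux.
have [s|s _ E] := @partial_MVT R (fun s : R => h (z + s *: (w - z))) (fun=> 0) 1 0.
  rewrite minC maxC (min_idPl (@ler01 R)) (max_idPr (@ler01 R)) => /seg/H/(_ (w - z)).
  by move=> /is_derive_line.
have wz : z + (w - z) = w :> plane R by rewrite addrC; exact: subrK.
by move: E; rewrite mulr0 scale1r scale0r addr0 wz => /eqP; rewrite subr_eq0 => /eqP.
Qed.

End C1Maps.

(** * C^1 symplectic conjugacies of the vector fields *)

Section C1Conjugacy.
Context {R : realType} (M : symplectic_surface R).
Context (F H : M -> R) (F_smooth : smooth_fun F) (H_smooth : smooth_fun H).
Context (psi psi_inv : M -> M) (psi_diffeo : C1_symplectic_diffeo psi psi_inv).
Context (psi_fields : conjugates_ham_fields psi H F).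

Let psi_cont : continuous psi.
Proof. by case: psi_diffeo => _ _ []. Qed.

Let psi_C1 (c c' : chart R M) : atlas c -> atlas c' ->
  Cn_on 1 (rep_dom c c' psi) (rep c c' psi).
Proof. by case: psi_diffeo => _ _ [_ h] _ _; exact: h. Qed.

Lemma rep_dom_open (g : M -> M) (c c' : chart R M) : continuous g ->
  open (rep_dom c c' g).
Proof.
move=> gc; apply: open_chart_image; last by move=> p [].
apply: openI; first exact: chart_dom_open.
by apply: open_comp; [move=> p _; exact: gc|exact: chart_dom_open].
Qed.

Lemma rep_domP (g : M -> M) (c c' : chart R M) p :
  chart_dom c p -> chart_dom c' (g p) -> rep_dom c c' g (c p).
Proof. by move=> cp cgp; exists p. Qed.

Lemma C1_conjugates_flows phiF phiH : ham_flow F phiF -> ham_flow H phiH ->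
  forall t p, psi (phiH t p) = phiF t (psi p).
Proof.
move=> Ff Hf t p.
have [h0 hc _] := Hf p; have [f0 fc _] := Ff (psi p).
suff E : (fun s => psi (phiH s p)) = phiF ^~ (psi p).
  by rewrite -[LHS]/((fun s => psi (phiH s p)) t) E.
apply: (@flow_unique R M F _ _ 0 F_smooth _ fc).
- by move=> s; apply: continuous_comp; [exact: hc|exact: psi_cont].
- by rewrite h0 f0.
move=> s E; have [c1 ca1 c1s] := atlas_cover (phiH s p).
have [c2 ca2 c2s] := atlas_cover (psi (phiH s p)).
exists c2; have c2F : chart_dom c2 (phiF s (psi p)) by rewrite -E.
have Fs := near_flow_solves F_smooth Ff ca2 c2F.
have Hs := near_flow_solves H_smooth Hf ca1 c1s.
have pc : {for s, continuous (fun s => psi (phiH s p))}.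
  by apply: continuous_comp; [exact: hc|exact: psi_cont].
have n2 : \forall x \near s, chart_dom c2 (psi (phiH x p)) := pc _ (near_chart_dom c2s).
have n1 : \forall x \near s, chart_dom c1 (phiH x p) := hc s _ (near_chart_dom c1s).
have nn := near_join n1.
near=> x; have Fx : solves F (phiF ^~ (psi p)) x c2 by near: x.
have [_ c1x dx] : solves H (phiH ^~ p) x c1 by near: x.
have c2x : chart_dom c2 (psi (phiH x p)) by near: x.
split => //; split => //.
have rd := rep_domP c1x c2x.
have HX := (ham_vectorP _ H_smooth ca1 (chart_imgP c1x)).2 erefl.
have := psi_fields ca1 ca2 rd HX.
have rE : rep c1 c2 psi (c1 (phiH x p)) = c2 (psi (phiH x p)) by rewrite /rep chart_mapK.
rewrite rE => /(ham_vectorP _ F_smooth ca2 (chart_imgP c2x)) <-.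
have := C1_curve (@rep_dom_open psi c1 c2 psi_cont) (psi_C1 ca1 ca2) rd dx.
apply: near_eq_is_derive.
have nx : \forall y \near x, chart_dom c1 (phiH y p) by near: x.
by apply: filterS nx => y cy; rewrite /rep chart_mapK.
Unshelve. all: by end_near. Qed.

Lemma C1_Lipschitz : Lipschitz psi.
Proof.
move=> c c' ca ca' z zr; apply: loclip2_lipschitz.
exact: (C1_loclip2 (@rep_dom_open psi c c' psi_cont) (psi_C1 ca ca') zr).
Qed.

(** dF (dpsi v) = omega (X_F, dpsi v) = omega (dpsi X_H, dpsi v) = omega (X_H, v) = dH v, so F o psi
    - H has zero differential. It is only locally constant, as [M] is not assumed connected. *)
Lemma C1_hamiltonian_near_cst p :
  \forall q \near p, F (psi q) - H q = F (psi p) - H p.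
Proof.
have [c1 ca1 c1p] := atlas_cover p; have [c2 ca2 c2p] := atlas_cover (psi p).
pose h z := F (chart_inv c2 (rep c1 c2 psi z)) - H (chart_inv c1 z).
have rd := rep_domP c1p c2p.
have ro : open (rep_dom c1 c2 psi) := @rep_dom_open psi c1 c2 psi_cont.
have hd : \forall w \near c1 p, forall v, is_derive w v h 0.
  have := open_nbhs_nbhs (conj ro rd); apply: filterS => w wr v.
  have [q [c1q c2q] qw] := wr.
  have c1w : chart_img c1 w by rewrite -qw; exact: chart_imgP.
  have rw : rep c1 c2 psi w = c2 (psi q) by rewrite /rep -qw chart_mapK.
  have c2w : chart_img c2 (rep c1 c2 psi w) by rewrite rw; exact: chart_imgP.
  have sF := smooth_sdiff F_smooth ca2 c2w.
  have sH := smooth_sdiff H_smooth ca1 c1w.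
  have HX := (ham_vectorP _ H_smooth ca1 c1w).2 erefl.
  have FX := psi_fields ca1 ca2 wr HX.
  have [_ _ _ _ sym] := psi_diffeo.
  have E := sym _ _ ca1 ca2 w wr (hvec H c1 w) v.
  rewrite FX HX in E.
  have wE : w = w + (0 : R) *: v by rewrite scale0r addr0.
  have ld := is_derive_affine w v (0 : R).
  have wr0 : rep_dom c1 c2 psi (w + (0 : R) *: v) by rewrite -wE.
  have rc := C1_curve ro (psi_C1 ca1 ca2) wr0 ld; rewrite -wE in rc.
  have sF0 : sdiff (F \o chart_inv c2) (rep c1 c2 psi (w + (0 : R) *: v))
    ('D_(1, 0) (F \o chart_inv c2) (rep c1 c2 psi w))
    ('D_(0, 1) (F \o chart_inv c2) (rep c1 c2 psi w)) by rewrite -wE.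
  have d1 := sdiff_curve (g := fun s : R => rep c1 c2 psi (w + s *: v)) sF0 rc.
  have [_ dF] := sdiff_derive ('D_v (rep c1 c2 psi) w) sF.
  rewrite -dF E in d1.
  have sH0 : sdiff (H \o chart_inv c1) (w + (0 : R) *: v)
    ('D_(1, 0) (H \o chart_inv c1) w) ('D_(0, 1) (H \o chart_inv c1) w) by rewrite -wE.
  have d2 := sdiff_curve (g := fun s : R => w + s *: v) sH0 ld.
  have [_ dH] := sdiff_derive v sH.
  rewrite -dH in d2.
  rewrite {1}wE; apply/is_derive_line.
  by apply: (is_derive_ext (is_deriveB d1 d2)) => //; rewrite subrr.
have nh : \forall q \near p, h (c1 q) = h (c1 p) := chart_map_continuous c1p (near_cst hd).
have n2 : \forall q \near p, chart_dom c2 (psi q) := psi_cont (near_chart_dom c2p).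
have hE q : chart_dom c1 q -> chart_dom c2 (psi q) -> h (c1 q) = F (psi q) - H q.
  by move=> c1q c2q; rewrite /h /rep !chart_mapK.
near=> q; rewrite -!hE//; [by near: q|by near: q; exact: near_chart_dom|by near: q].
Unshelve. all: by end_near. Qed.

End C1Conjugacy.

(** * Recurrence from the values of F *)

Lemma iter_continuous (T : topologicalType) (f : T -> T) k :
  continuous f -> continuous (iter k f).
Proof.
move=> fc; elim: k => [|k IH] p; first exact: cvg_id.
by apply: (@continuous_comp _ _ _ (iter k f) f); [exact: IH|exact: fc].
Qed.

Section TopologicalRecurrence.
Context {R : realType} (M : symplectic_surface R) (c : chart R M).
Context (c_disk : [set z | enorm z <= 1] `<=` chart_img c).
Context (F : M -> R) (F_cont : continuous F).
Context (q0 : R) (q0_gt0 : 0 < q0) (q0_le : q0 <= 4^-1).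
Context (F_model : forall z, vset q0 z -> F (chart_inv c z) = expR (- (qform z)^-1)).
Context (F0 : F (chart_inv c 0) = 0).
Context (g g_inv : M -> M) (gK : cancel g g_inv) (g_invK : cancel g_inv g).
Context (g_cont : continuous g) (g_inv_cont : continuous g_inv).
Context (ka : M -> R) (kaE : forall p, F (g p) = F p + ka p).
Context (ka_near : forall p, \forall q \near p, ka q = ka p).
Context (K : set M) (K_compact : compact K) (K_dom : K `<=` chart_dom c).
Context (K_orbit : forall k, K (iter k g (chart_inv c 0))).

Let o := chart_inv c 0.

Let iter_gK k : cancel (iter k g) (iter k g_inv).
Proof. by elim: k => [//|k IH] p; rewrite iterSr iterS gK IH. Qed.

Let iter_g_invK k : cancel (iter k g_inv) (iter k g).
Proof. by elim: k => [//|k IH] p; rewrite iterSr iterS g_invK IH. Qed.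

Let Fk_near k p : \forall q \near p,
  F (iter k g q) - F q = F (iter k g p) - F p.
Proof.
elim: k => [|k IH]; first by near=> q; rewrite !subrr.
have h : \forall q \near p, ka (iter k g q) = ka (iter k g p) :=
  @iter_continuous _ g k g_cont p _ (ka_near (iter k g p)).
apply: filterS2 IH h => q E1 E2; rewrite !iterS !kaE E2.
by rewrite addrAC E1 addrAC.
Unshelve. all: by end_near. Qed.

(** The increment of [F] under [iter k g] is locally constant, hence constant along the segment from
    the origin, where [F] vanishes. *)
Let Fk k z : qform z < q0 -> F (iter k g (chart_inv c z)) = F (chart_inv c z) + F (iter k g o).
Proof.
move=> zq; pose u (s : R) := chart_inv c (0 + s *: z).
have sz (s : R) : 0 <= s <= 1 -> chart_img c (0 + s *: z).
  rewrite add0r => /andP[s0 s1]; apply: (qform_lt_img c_disk q0_le); apply: le_lt_trans zq.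
  rewrite !qformE /=; have s2 : s ^+ 2 <= 1 by rewrite expr_le1.
  rewrite !exprMn; have := sqr_ge0 z.1; have := sqr_ge0 z.2.
  have := sqr_ge0 s; move: (s ^+ 2) (z.1 ^+ 2) (z.2 ^+ 2) s2 => a x y a1 a0 y0 x0.
  by have := ler_piMl x0 a1; have := ler_piMl y0 a1; lra.
pose P s := F (iter k g (u s)) - F (u s) = F (iter k g (u 0)) - F (u 0).
have uc (s : R) : 0 <= s <= 1 -> {for s, continuous u}.
  move=> s01; apply: (@continuous_comp _ _ _ (fun s : R => 0 + s *: z) (chart_inv c)).
    exact: is_derive_cvg (is_derive_affine (0 : plane R) z s).
  exact/chart_inv_continuous/sz.
have near_u (s : R) : 0 <= s <= 1 -> \forall x \near s,
    F (iter k g (u x)) - F (u x) = F (iter k g (u s)) - F (u s).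
  by move=> s01; exact: (uc s s01 _ (Fk_near k (u s))).
have conn : connected [set s : R | 0 <= s <= 1].
  apply/connected_intervalP => x y /andP[x0 x1] /andP[y0 y1] w /andP[xw wy].
  by rewrite /= (le_trans x0 xw) (le_trans wy y1).
have P1 : P 1.
  apply: (@connected_all R _ P conn); rewrite /= ?lexx ?ler01//.
  - by exists 0; rewrite //= lexx ler01.
  - by move=> s s01 Ps; apply: filterS (near_u s s01) => x E _; rewrite /P E.
  - move=> s s01 nPs; apply: filterS (near_u s s01) => x E _ Px.
    by apply: nPs; rewrite /P -E.
move: P1; rewrite /P /u scale1r scale0r !add0r -/o F0 subr0 => <-.
by rewrite addrC subrK.
Qed.

(** Let p' be a cluster point of the orbit of [o] and [B] a neighbourhood of p' on which [F] hardly
    varies. If [iter k g o] is in [B], the image under [iter k g] of the elliptic disk [E] covers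
    [B], since on the image of the boundary of [E] the value of [F] is too large. Two visits of the
    orbit to [B] then give a return to [E]. *)
Lemma topological_recurrence : exists n p,
  [/\ (0 < n)%N, qform (c p) < q0, chart_dom c p & p = iter n g o].
Proof.
pose q1 := q0 / 2.
have q1_gt0 : 0 < q1 by rewrite divr_gt0.
have q1_lt : q1 < q0 by rewrite ltr_pdivrMr// ltr_pMr// ltr1n.
(* The gap between the value of [F] at the origin and on the ellipse [qform = q1]. *)
pose e1 := expR (- q1^-1).
have e1_gt0 : 0 < e1 by exact: expR_gt0.
have FK : ((fun k => iter k g o) @ \oo) K by exists 0%N => // k _; exact: K_orbit.
have [p' [Kp' cl]] := K_compact _ FK.
have cp' := K_dom Kp'.
pose z' := c p'; have cz' : chart_img c z' by exact: chart_imgP.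
have zK : chart_inv c z' = p' by rewrite chart_mapK.
have Fc : (F \o chart_inv c) @ z' --> F p'.
  apply: (@cvg_comp _ _ _ (chart_inv c) F); first exact: chart_inv_continuous.
  by rewrite zK; exact: F_cont.
have e12 : 0 < e1 / 2 by rewrite divr_gt0.
move/cvgrPdist_lt: Fc => /(_ _ e12) Fn.
have Gn : \forall w \near z', `|F p' - F (chart_inv c w)| < e1 / 2 /\ chart_img c w.
  by apply: filterS2 Fn (near_chart_img cz') => w; split.
move/nbhs_ballP: Gn => [d /= d0 Hd].
pose B := [set p | chart_dom c p /\ ball z' d (c p)].
have Bn : \forall p \near p', B p.
  have h : \forall p \near p', ball z' d (c p).
    by apply: (chart_map_continuous cp'); exact: nbhsx_ballx.
  by apply: filterS2 (near_chart_dom cp') h => p; split.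
have FB p q : B p -> B q -> `|F p - F q| < e1.
  move=> [cp /Hd[/= hp _]] [cq /Hd[/= hq _]]; rewrite !chart_mapK// in hp hq.
  rewrite (_ : F p - F q = - (F p' - F p) + (F p' - F q)); last by ring.
  by rewrite (le_lt_trans (ler_normD _ _))// normrN (splitr e1) ltrD.
have inf N : exists2 k, (N <= k)%N & B (iter k g o).
  have [] := cl [set p | exists2 k, (N <= k)%N & p = iter k g o] B.
  - by exists N => // k /= Nk; exists k.
  - exact: Bn.
  - by move=> _ [[k Nk ->] Bk]; exists k.
pose E := [set p | chart_dom c p /\ qform (c p) < q1].
have Eo p : E p -> \forall q \near p, E q.
  move=> [cp Ep]; have h : \forall q \near p, qform (c q) < q1.
    have := cvg_comp _ _ (chart_map_continuous cp) (@qform_continuous R (c p)).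
    by move=> h; exact: (cvgr_lt _ h).
  by apply: filterS2 (near_chart_dom cp) h => q; split.
have cls : closed (chart_inv c @` [set z | 0 <= qform z <= q1]).
  exact: (closed_shell c_disk q0_le).
have c0 : chart_img c (0 : plane R) by apply: c_disk; rewrite /= enorm0.
(* Along the segment from [iter k g o] to [p] in the chart, the preimage under [iter k g] starts at
   [o] and has to stay in [E]. *)
have cov k : B (iter k g o) -> forall p, B p -> E (iter k g_inv p).
  move=> Bk p [cp Bp]; have [ck Bck] := Bk.
  pose x0 := c (iter k g o); pose x1 := c p.
  pose u (s : R) := x0 + s *: (x1 - x0).
  have ub (s : R) : 0 <= s <= 1 -> ball z' d (u s).
    move=> /andP[s0 s1]; apply/plane_ballE; move/plane_ballE: Bp => [a1 a2].
    move/plane_ballE: Bck => [b1 b2].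
    have aux (x a b : R) : `|x - a| < d -> `|x - b| < d -> `|x - (b + s * (a - b))| < d.
      move=> xa xb; rewrite (_ : _ - _ = s * (x - a) + (1 - s) * (x - b)); last by ring.
      rewrite (le_lt_trans (ler_normD _ _))// !normrM (ger0_norm s0).
      rewrite (ger0_norm (_ : 0 <= 1 - s)) ?subr_ge0//.
      by have [s0'|s0'] := ltP 0 s; nra.
    by split; apply: aux.
  have uB (s : R) : 0 <= s <= 1 -> B (chart_inv c (u s)).
    move=> /ub us; have [_ cu] := Hd _ us.
    by split; [exact: chart_inv_dom|rewrite chart_invK].
  have uc (s : R) : 0 <= s <= 1 -> {for s, continuous (fun s => iter k g_inv (chart_inv c (u s)))}.
    move=> s01; apply: (@continuous_comp _ _ _ (fun s => chart_inv c (u s)) (iter k g_inv)).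
      apply: (@continuous_comp _ _ _ u (chart_inv c)).
        exact: is_derive_cvg (is_derive_affine x0 (x1 - x0) s).
      by apply: chart_inv_continuous; have [_] := Hd _ (ub s s01).
    exact: iter_continuous.
  have conn : connected [set s : R | 0 <= s <= 1].
    apply/connected_intervalP => x y /andP[xx0 xx1] /andP[y0 y1] w /andP[xw wy].
    by rewrite /= (le_trans xx0 xw) (le_trans wy y1).
  have P1 : E (iter k g_inv (chart_inv c (u 1))).
    apply: (@connected_all R _ (fun s => E (iter k g_inv (chart_inv c (u s)))) conn);
      rewrite /= ?lexx ?ler01//.
    - exists 0; rewrite /= ?lexx ?ler01//.
      rewrite /u scale0r addr0 chart_mapK// iter_gK.
      by split; [exact: chart_inv_dom|rewrite chart_invK// qform0].
    - move=> s s01 Es.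
      have h : \forall x \near s, E (iter k g_inv (chart_inv c (u x))) := uc s s01 _ (Eo _ Es).
      by apply: filterS h => x.
    - move=> s s01 nEs; set y := iter k g_inv (chart_inv c (u s)) in nEs *.
      have yE : iter k g y = chart_inv c (u s) by rewrite /y iter_g_invK.
      (* A preimage outside [E] but in the closed disk has [qform] equal to [q1]; by [Fk] its image
         differs from [iter k g o] in the value of [F] by exactly [e1], too much for two points of
         [B]. *)
      have nin : ~ (chart_inv c @` [set z | 0 <= qform z <= q1]) y.
        move=> [z /andP[_ zq] zy]; apply: nEs.
        have zq0 := le_lt_trans zq q1_lt.
        have cz : chart_img c z := qform_lt_img c_disk q0_le zq0.
        rewrite -zy; split; first exact: chart_inv_dom.
        rewrite chart_invK// lt_neqAle zq andbT; apply/eqP => zE.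
        have := FB _ _ (uB s s01) Bk; rewrite -yE -zy Fk// addrK F_model.
          by rewrite zE -/e1 gtr0_norm// ltxx.
        by rewrite /vset /= zE q1_gt0.
      have n1 : \forall x \near s, (~` (chart_inv c @` [set z | 0 <= qform z <= q1]))
          (iter k g_inv (chart_inv c (u x))).
        apply: (uc s s01); apply: open_nbhs_nbhs; split => //.
        exact: closed_openC.
      apply: filterS n1 => x nx _ [cx Ex]; apply: nx.
      exists (c (iter k g_inv (chart_inv c (u x)))); last exact: chart_mapK.
      by rewrite /= qform_ge0 ltW.
  by move: P1; rewrite /u scale1r addrC subrK chart_mapK.
have [k _ Bk] := inf 0%N; have [k' kk' Bk'] := inf k.+1.
have [cE qE] := cov k Bk _ Bk'.
have E1 : iter k g_inv (iter k' g o) = iter (k' - k) g o.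
  by rewrite -{1}(subnKC (ltnW kk')) iterD iter_gK.
exists (k' - k)%N, (iter (k' - k) g o); rewrite -E1; split => //.
  by rewrite subn_gt0.
by rewrite (lt_trans qE).
Unshelve. all: by end_near. Qed.

End TopologicalRecurrence.

(** * Lipschitz estimates for twists off the origin *)

Section TwistLipschitz.
Context {R : realType}.
Implicit Types (f rho : R -> R) (z : plane R).

Definition lip_at f (x : R) := exists d L : R, [/\ 0 < d, 0 < L &
  forall y y', ball x d y -> ball x d y' -> `|f y - f y'| <= L * `|y - y'|].

Lemma C1_lip_at f x : (\forall y \near x, derivable f y 1) ->
  {for x, continuous (derive1 f)} -> lip_at f x.
Proof.
move=> df cf.
have Bd : \forall y \near x, `|derive1 f y| <= `|derive1 f x| + 1.
  move/cvgrPdist_lt: cf => /(_ _ ltr01); apply: filterS => y xy.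
  rewrite -lerBlDl (le_trans _ (ltW xy))// distrC.
  exact: lerB_dist.
have Cd : \forall y \near x, derivable f y 1 /\ `|derive1 f y| <= `|derive1 f x| + 1.
  by apply: filterS2 df Bd => y; split.
move/nbhs_ballP: Cd => [d /= d0 Hd].
have B0 : 0 < `|derive1 f x| + 1 by apply: ltr_wpDl; rewrite ?normr_ge0 ?ltr01.
exists d, (`|derive1 f x| + 1); split => // y y' xy xy'.
have bs s : Num.min y y' <= s <= Num.max y y' -> ball x d s.
  rewrite /ball /= !ltr_distl in xy xy' *.
  move: xy xy' => /andP[a1 a2] /andP[b1 b2] /andP[]; rewrite ge_min le_max.
  move=> /orP[h1|h1] /orP[h2|h2]; apply/andP; split; lra.
have [s /bs/Hd[/derivableP]|s /bs sin ->] := @partial_MVT R f (derive1 f) y y'.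
  by rewrite derive1E.
by rewrite normrM mulrC ler_wpM2r//; have [] := Hd _ sin.
Qed.

Lemma lip_atN f x : lip_at f x -> lip_at (\- f) x.
Proof.
move=> [d [L [d0 L0 H]]]; exists d, L; split => // y y' xy xy'.
by rewrite /= -opprD normrN; exact: H.
Qed.

Lemma enorm_lip (p q : plane R) :
  `|enorm p - enorm q| <= `|p.1 - q.1| + `|p.2 - q.2|.
Proof.
have p0 := enorm_ge0 p; have q0 := enorm_ge0 q.
have [s0|s0] := eqVneq (enorm p + enorm q) 0.
  have -> : enorm p = 0 by lra.
  by have -> : enorm q = 0; [lra|rewrite subrr normr0 addr_ge0].
have sgt : 0 < enorm p + enorm q by rewrite lt_neqAle eq_sym s0 addr_ge0.
rewrite -(ler_pM2r sgt) -{1}(ger0_norm (ltW sgt)) -normrM -subr_sqr !sqr_enorm.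
have -> : p.1 ^+ 2 + p.2 ^+ 2 - (q.1 ^+ 2 + q.2 ^+ 2) =
  (p.1 - q.1) * (p.1 + q.1) + (p.2 - q.2) * (p.2 + q.2) by ring.
rewrite (le_trans (ler_normD _ _))// !normrM mulrDl lerD// ler_wpM2l//;
by rewrite (le_trans (ler_normD _ _))// lerD// ?normr_fst_le ?normr_snd_le.
Qed.

Lemma cos_lip (x y : R) : `|cos x - cos y| <= `|x - y|.
Proof.
have [s _ ->] := @partial_MVT R cos (fun s => - sin s) x y.
by rewrite normrM normrN ler_piMr// ler_norml sin_geN1 sin_le1.
Qed.

Lemma sin_lip (x y : R) : `|sin x - sin y| <= `|x - y|.
Proof.
have [s _ ->] := @partial_MVT R sin cos x y.
by rewrite normrM ler_piMr// ler_norml cos_geN1 cos_le1.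
Qed.

(** Changing the point costs a rotation, which is bounded; changing the angle costs the Lipschitz
    constant of [rho] times the radius, at most [B] near [z]. *)
Lemma twist_loclip2 rho z : lip_at rho (enorm z) -> loclip2 (twist rho) z.
Proof.
move=> [d [L [d0 L0 H]]].
pose B := enorm z + d.
have B0 : 0 < B by rewrite ltr_wpDl// enorm_ge0.
exists (d / 2), (2 + 4 * B * L); split.
- by rewrite divr_gt0.
- by rewrite addr_gt0// !mulr_gt0.
move=> p q zp zq.
have nn (u v : plane R) : `|u.1 - v.1| + `|u.2 - v.2| <= 2 * `|u - v|.
  rewrite [in leRHS]plane_normE mulr_natl mulr2n lerD//.
    by rewrite le_max lexx.
  by rewrite le_max lexx orbT.
have zb u : ball z (d / 2) u -> ball (enorm z) d (enorm u).
  move=> /plane_ballE[u1 u2]; rewrite /ball /=.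
  by rewrite (le_lt_trans (enorm_lip z u))// (splitr d) ltrD.
have hr : `|rho (enorm p) - rho (enorm q)| <= L * (2 * `|p - q|).
  rewrite (le_trans (H _ _ (zb _ zp) (zb _ zq)))// ler_pM2l//.
  exact: (le_trans (enorm_lip p q)).
have qB : enorm q <= B.
  have := zb _ zq; rewrite /ball /= distrC ltr_distl => /andP[_ h].
  exact: ltW.
rewrite !twistE; set t := rho (enorm p) in hr *; set s := rho (enorm q) in hr *.
have -> : rot t p - rot s q = rot t (p - q) + cmul ((cos t, sin t) - (cos s, sin s)) q.
  by rewrite -rotB -cmulBl -!rot_cmul addrA subrK.
rewrite (le_trans (ler_normD _ _))// mulrDl lerD//.
  exact: le_trans (norm_rot_le _ _) (enorm_le_norm _).
apply: (le_trans (norm_cmul_le _ _)).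
have h1 : enorm ((cos t, sin t) - (cos s, sin s)) <= 2 * (L * (2 * `|p - q|)).
  apply: (le_trans (enorm_le_norm _)); rewrite ler_pM2l// (le_trans _ hr)//.
  by rewrite [leLHS]plane_normE /= ge_max cos_lip sin_lip.
apply: (le_trans (ler_pM (enorm_ge0 _) (enorm_ge0 _) h1 qB)).
by rewrite le_eqVlt; apply/orP; left; apply/eqP; ring.
Qed.

End TwistLipschitz.

(** * Extending the twisting angle by zero beyond the unit circle *)

Section RadialCutoff.
Context {R : realType} (rho : R -> R).
Context (rho_smooth : forall (n : nat) (r : R), 0 < r < 1 ->
  derivable (derive1n n rho) r 1).
Context (rho_supp : \forall r \near (1 : R), r <= 1 -> rho r = 0).

(* The values of rho beyond 1 are irrelevant to phi_rho. *)
Definition cutoff (r : R) := if r < 1 then rho r else 0.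

Lemma cutoff_ge1 (r : R) : 1 <= r -> cutoff r = 0.
Proof. by rewrite /cutoff ltNge => ->. Qed.

Let cutoff_near_lt (r : R) : r < 1 -> \forall s \near r, cutoff s = rho s.
Proof.
move=> r1; have h : \forall s \near r, s < 1 by exact: lt_nbhsl.
apply: filterS h => s s1.
by rewrite /cutoff s1.
Qed.

Let cutoff_near_ge (r : R) : 1 <= r -> \forall s \near r, cutoff s = 0.
Proof.
rewrite le_eqVlt => /predU1P[<-|r1].
  apply: filterS rho_supp => s h; rewrite /cutoff; case: ifP => // s1.
  by rewrite h// ltW.
have h : \forall s \near r, 1 < s by exact: lt_nbhsr.
apply: filterS h => s s1.
by rewrite cutoff_ge1// ltW.
Qed.

Lemma cutoff_derivable (r : R) : 0 < r -> derivable cutoff r 1.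
Proof.
move=> r0; have [r1|r1] := ltP r 1.
  have r01 : 0 < r < 1 by rewrite r0.
  apply: near_eq_derivable (@rho_smooth 0%N r r01).
  by apply: filterS (cutoff_near_lt r1) => s ->.
apply: (@near_eq_derivable _ _ _ (fun=> 0)).
  by apply: filterS (cutoff_near_ge r1) => s ->.
exact: derivable_cst.
Qed.

Lemma cutoff_lip_at (r : R) : 0 < r -> lip_at cutoff r.
Proof.
move=> r0; have [r1|r1] := ltP r 1; last first.
  have /nbhs_ballP[d /= d0 Hd] := cutoff_near_ge r1.
  by exists d, 1; split => // y y' /Hd-> /Hd->; rewrite subrr normr0 mul1r.
have near01 : \forall s \near r, 0 < s < 1.
  have h1 : \forall s \near r, s < 1 by exact: lt_nbhsl.
  have h0 : \forall s \near r, 0 < s by exact: lt_nbhsr.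
  apply: filterS2 h1 h0 => s s1 s0.
  by rewrite s0.
have lr : lip_at rho r.
  apply: C1_lip_at.
    by apply: filterS near01 => s; exact: (@rho_smooth 0%N s).
  have r01 : 0 < r < 1 by rewrite r0.
  have := @rho_smooth 1%N r r01; rewrite derive1n1 => h.
  exact/differentiable_continuous/derivable1_diffP.
have /nbhs_ballP[e /= e0 He] := cutoff_near_lt r1.
have [d [L [d0 L0 H]]] := lr.
exists (Num.min d e), L; split => //; first by rewrite lt_min d0.
move=> y y' ry ry'; rewrite !He; first apply: H.
- by apply: le_ball ry; rewrite ge_min lexx.
- by apply: le_ball ry'; rewrite ge_min lexx.
- by apply: le_ball ry'; rewrite ge_min lexx orbT.
- by apply: le_ball ry; rewrite ge_min lexx orbT.
Qed.

Lemma phi_rho_ctwist (M : symplectic_surface R) (c : chart R M) :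
  phi_rho c rho = ctwist c cutoff.
Proof.
apply/funext => p; rewrite /phi_rho.
have [cp|cp] := pselect (chart_dom c p); last first.
  by rewrite ctwist_out// asboolF// => -[].
rewrite ctwist_in//; have [r1|r1] := leP (enorm (c p)) 1.
  rewrite asboolT//; congr chart_inv; rewrite !twistE; congr rot.
  rewrite /cutoff; case: ltP => // r1'.
  (* On the unit circle itself [phi_rho] still reads [rho], whose value at 1 is 0 because [rho_supp]
     includes the point 1. *)
  have -> : enorm (c p) = 1 by apply/eqP; rewrite eq_le r1.
  by have := nbhs_singleton rho_supp; exact.
rewrite asboolF; last by move=> [].
by rewrite twistE cutoff_ge1 ?ltW// rot0 chart_mapK.
Qed.

Lemma cutoff_derive1 (r : R) : 0 < r < 1 -> derive1 cutoff r = derive1 rho r.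
Proof.
move=> /andP[_ r1]; rewrite !derive1E; apply: near_eq_derive.
by apply: filterS (cutoff_near_lt r1) => s ->.
Qed.

End RadialCutoff.

(** * Orbits of the origin and of the model under the commuting map *)

Section CommutantOrbit.
Context {R : realType} (M : symplectic_surface R) (c : chart R M).
Context (c_darboux : darboux_chart c).
Context (c_disk : [set z | enorm z <= 1] `<=` chart_img c).
Context (F : M -> R) (F_smooth : smooth_fun F) (phiF : R -> M -> M).
Context (phiF_flow : ham_flow F phiF) (q0 : R) (q0_gt0 : 0 < q0) (q0_le : q0 <= 4^-1).
Context (F_model : forall z, vset q0 z -> F (chart_inv c z) = expR (- (qform z)^-1)).
Context (F0 : hvec F c 0 = 0).
Context (K : set M) (K_compact : compact K) (K_dom : K `<=` chart_dom c).
Context (K_supp : forall p, ~ K p -> F p = 0).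
Context (g : M -> M) (g_inj : injective g) (g_cont : continuous g).
Context (g_flow : forall t p, g (phiF t p) = phiF t (g p)).
Implicit Types (p : M) (z : plane R).

Let o := chart_inv c 0.

Let img0 : chart_img c (0 : plane R).
Proof. by apply: c_disk; rewrite /= enorm0. Qed.

Let iter_inj k : injective (iter k g).
Proof. by elim: k => [|k IH] p q //= /g_inj/IH. Qed.

Let iter_flow k t p : iter k g (phiF t p) = phiF t (iter k g p).
Proof. by elim: k => [//|k IH]; rewrite !iterS IH g_flow. Qed.

Let in_model_moves p : in_model c q0 p -> exists t, phiF t p <> p.
Proof.
move=> mp; have [cp /andP[q_gt0 _]] := mp.
have w0 := wfun_gt0 q_gt0.
exists (pi / (2 * wfun (qform (c p)))) => E.
have := chart_flow c_darboux c_disk F_smooth phiF_flow q0_le F_model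
  (pi / (2 * wfun (qform (c p)))) mp.
rewrite E mulrCA divff ?mulr1; last by rewrite mulf_neq0 ?gt_eqF.
move=> /esym/efl_fixed cp0; have := qform_neq0 q_gt0; apply; apply: cp0.
by rewrite pi_gt0 mulr2n ltrDl pi_gt0.
Qed.

Let origin_flow t : phiF t o = o.
Proof.
have [ca _] := c_darboux.
apply: (flow_fixed t F_smooth phiF_flow ca (chart_inv_dom img0)).
by rewrite chart_invK.
Qed.

Let model_near_origin (P : M -> Prop) : (\forall p \near o, P p) ->
  exists2 p, in_model c q0 p & P p.
Proof.
(* The point [(e, 0)] has [qform] 4 e^2, and e <= q0 / 2 <= 1 / 8 makes this at most q0 / 4. *)
move=> /(chart_inv_continuous img0) /nbhs_ballP[d /= d0 Hd].
have [e [e0 ed eq0]] : exists e : R, [/\ 0 < e, e < d & e <= q0 / 2].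
  have m0 : 0 < Num.min d q0 by rewrite lt_min d0.
  exists (Num.min d q0 / 2); split; first by rewrite divr_gt0.
    by rewrite ltr_pdivrMr// (@le_lt_trans _ _ d) ?ge_min ?lexx// ltr_pMr// ltr1n.
  by rewrite ler_pM2r// ge_min lexx orbT.
exists (chart_inv c (e, 0)).
  apply: (in_model_inv c_disk q0_le); rewrite /vset /= qformE /= expr0n /= mul0r addr0.
  have := mulr_gt0 e0 e0; have q8 := ler_wpM2l (ltW e0) eq0.
  rewrite expr2 => ee; apply/andP; split; first lra.
  have e8 : e <= 8^-1 by have := q0_le; lra.
  have : e * (q0 / 2) <= 8^-1 * (q0 / 2) by rewrite ler_wpM2r// divr_ge0// ltW.
  by lra.
apply: Hd; apply/plane_ballE; rewrite /= sub0r normrN gtr0_norm// subrr normr0.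
by split.
Qed.

Let fixed_off_support p t : ~ K p -> phiF t p = p.
Proof.
move=> nKp; have [c' ca' c'p] := atlas_cover p.
apply: (flow_fixed t F_smooth phiF_flow ca' c'p).
apply: (@hvec_near_cst R M F c' (c' p) 0).
have nK : \forall q \near p, ~ K q.
  apply: open_nbhs_nbhs; split => //; apply: closed_openC.
  exact: compact_closed (@surface_hausdorff R M) K_compact.
have ic : chart_inv c' @ c' p --> p.
  by rewrite -{2}(chart_mapK c'p); exact: (chart_inv_continuous (chart_imgP c'p)).
have h : \forall w \near c' p, ~ K (chart_inv c' w) := ic _ nK.
by apply: filterS h => w; exact: K_supp.
Qed.

(** The flow moves [p], hence also its image under the injective [iter k g]; off the support of [F]
    the flow moves nothing. *)
Lemma commute_orbit k p : in_model c q0 p -> K (iter k g p).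
Proof.
move=> /in_model_moves[t nt]; apply: contrapT => /(fixed_off_support t) E.
by apply: nt; apply: (@iter_inj k); rewrite iter_flow.
Qed.

Lemma commute_orbit0 k : K (iter k g o).
Proof.
apply: contrapT => nK.
have nK' : \forall p \near iter k g o, ~ K p.
  apply: open_nbhs_nbhs; split => //.
  by apply: closed_openC; exact: compact_closed (@surface_hausdorff R M) K_compact.
have h : \forall p \near o, ~ K (iter k g p) := @iter_continuous _ g k g_cont o _ nK'.
by have [p /(commute_orbit k)] := model_near_origin h.
Qed.

(** Continuity brings the image of a nearby point of the model into the elliptic disk. It is not the
    centre, which the flow fixes while it moves this image. *)
Lemma commute_return n : qform (c (iter n g o)) < q0 ->
  exists2 p, in_model c q0 p & in_model c q0 (iter n g p).
Proof.
move=> qn; have cn := K_dom (commute_orbit0 n).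
have h1 : \forall p \near iter n g o, qform (c p) < q0.
  have h := cvg_comp _ _ (chart_map_continuous cn) (@qform_continuous R (c (iter n g o))).
  exact: (cvgr_lt _ h).
have h2 : \forall p \near iter n g o, chart_dom c p /\ qform (c p) < q0.
  by apply: filterS2 (near_chart_dom cn) h1 => p; split.
have h : \forall p \near o, chart_dom c (iter n g p) /\ qform (c (iter n g p)) < q0 :=
  @iter_continuous _ g n g_cont o _ h2.
have [p mp [cp qp]] := model_near_origin h.
exists p => //; split => //; rewrite /vset /= qp andbT; apply: qform_gt0 => z0.
have [t] := in_model_moves mp; apply; apply: (@iter_inj n).
have -> : iter n g p = o by rewrite -(chart_mapK cp) z0.
by rewrite iter_flow (_ : iter n g p = o) ?origin_flow// -(chart_mapK cp) z0.
Qed.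

(** The given return only shows that some power fixes [o]. The least such power [m] may be smaller
    than [n]; it brings the model back by [commute_return], as it fixes [o]. *)
Lemma commute_first_return n p0 : (0 < n)%N -> in_model c q0 p0 ->
  in_model c q0 (iter n g p0) -> exists m al,
  [/\ (0 < m)%N, forall j, (0 < j < m)%N -> iter j g o <> o &
      forall z, vset q0 z -> iter m g (chart_inv c z) = chart_inv c (efl (al (qform z)) z)].
Proof.
move=> n0 mp0 mn.
have into k : (exists2 p, in_model c q0 p & in_model c q0 (iter k g p)) ->
    forall p, in_model c q0 p -> in_model c q0 (iter k g p).
  move=> [p mp mkp] q mq.
  exact: (commute_in_model c_darboux c_disk F_smooth phiF_flow q0_le F_model
    (@iter_inj k) (@iter_continuous _ g k g_cont) (iter_flow k) mp mkp mq).
have no : iter n g o = o.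
  apply: (commute_fix0 c_darboux c_disk F_smooth phiF_flow q0_gt0 q0_le F_model
    (@iter_inj n) (@iter_continuous _ g n g_cont) (iter_flow n)).
  by apply: into; exists p0.
pose P m := (0 < m)%N && `[< iter m g o = o >].
have exP : exists m, P m by exists n; rewrite /P n0; apply/asboolP.
case: (ex_minnP exP) => m /andP[m0 /asboolP mo] mmin.
have [|al alE] := commute_rotation c_darboux c_disk F_smooth phiF_flow q0_le F_model
    (@iter_inj m) (iter_flow m).
  apply: into; apply: commute_return.
  by rewrite mo /o chart_invK// qform0.
exists m, al; split => // j /andP[j0 jm] jo.
have : P j by rewrite /P j0; apply/asboolP.
by move=> /mmin; rewrite leqNgt jm.
Qed.

Context (rho : R -> R) (rho_supp : forall r : R, 1 <= r -> rho r = 0).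
Context (rho_derivable : forall r : R, 0 < r -> derivable rho r 1).
Context (rho_lip : forall r : R, 0 < r -> lip_at rho r).
Context (psi : M -> M) (psi_cont : continuous psi) (psi_lip : Lipschitz psi).
Context (gE : forall p, g p = psi (ctwist c (\- rho) p)).

Let ctwist0 (rho' : R -> R) : ctwist c rho' o = o.
Proof. by rewrite /o ctwist_inv// twist0. Qed.

Let psiE p : psi p = g (ctwist c rho p).
Proof. by rewrite gE ctwistK. Qed.

(** The first factor g o twist is [psi] itself, so the inverse twist is never applied at the origin.
    Each later factor is [psi] after the inverse twist at an orbit point other than [o], where the
    twist is Lipschitz. *)
Let iterate_loclip2 m : (forall j, (0 < j < m)%N -> iter j g o <> o) ->
  forall j, (j < m)%N -> loclip2 (fun z => c (iter j g (psi (chart_inv c z)))) 0.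
Proof.
move=> min; have [ca _] := c_darboux.
have psi_loclip2 p : chart_dom c p -> chart_dom c (psi p) -> loclip2 (rep c c psi) (c p).
  by move=> cp cpp; apply: lipschitz_loclip2; apply: psi_lip => //; exact: rep_domP.
have psio : psi o = g o by rewrite psiE ctwist0.
elim=> [|j IH] jm.
  have := psi_loclip2 o (chart_inv_dom img0); rewrite /o chart_invK//; apply.
  by rewrite -/o psio; apply: K_dom; exact: (commute_orbit0 1).
set q := iter j g (psi o).
have qE : q = iter j.+1 g o by rewrite /q psio iterSr.
have cq : chart_dom c q by rewrite qE; apply: K_dom; exact: commute_orbit0.
have cq0 : c q <> 0.
  move=> cq0; apply: (min j.+1) => //.
  by rewrite -qE -(chart_mapK cq) cq0.
have rhoN : forall r : R, 1 <= r -> (\- rho) r = 0 by move=> r /rho_supp /= ->; rewrite oppr0.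
have lt : loclip2 (twist (\- rho)) (c q).
  by apply: twist_loclip2; apply: lip_atN; apply: rho_lip; exact: enorm_gt0.
have lp : loclip2 (rep c c psi) (twist (\- rho) (c q)).
  rewrite -(chart_ctwist c_disk rhoN cq); apply: psi_loclip2.
    exact: ctwist_dom.
  by rewrite -gE qE; apply: K_dom; exact: (commute_orbit0 j.+2).
have := loclip2_comp (IH (ltnW jm)) (loclip2_comp lt lp).
apply: loclip2_near.
have cont : {for (0 : plane R), continuous (fun z => iter j g (psi (chart_inv c z)))}.
  apply: (@continuous_comp _ _ _ (fun z => psi (chart_inv c z)) (iter j g)).
    apply: (@continuous_comp _ _ _ (chart_inv c) psi); last exact: psi_cont.
    exact: chart_inv_continuous.
  exact: iter_continuous.
have h : \forall z \near (0 : plane R), chart_dom c (iter j g (psi (chart_inv c z))) :=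
  cont _ (near_chart_dom cq).
apply: filterS h => z cz.
by rewrite /rep iterS gE ctwist_in.
Qed.

Lemma commute_derive_bound n p0 : (0 < n)%N -> in_model c q0 p0 ->
  in_model c q0 (iter n g p0) -> exists d B : R, 0 < d /\
  forall r, 0 < r < d -> r * `|derive1 rho r| <= B.
Proof.
move=> n0 mp0 /(commute_first_return n0 mp0)[m [al [m0 min alE]]].
have [d [L [d0 L0 H]]] : loclip2 (fun z => c (iter m.-1 g (psi (chart_inv c z)))) 0.
  by apply: (iterate_loclip2 min); rewrite prednK.
(* A norm below q0 <= 1 / 4 forces [qform] <= 4 q0^2 <= q0, strictly below [q0] in fact, so that the
   point is in the model. *)
pose d1 := Num.min d q0.
have d1_gt0 : 0 < d1 by rewrite lt_min d0.
exists d1, (2 * L + 128 * (L + 1)); split => // r rd.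
have vz z : 0 < enorm z < d1 -> vset q0 z.
  rewrite /d1 lt_min => /and3P[z0 _ zq]; rewrite /vset /=.
  rewrite qform_gt0; last by move=> z00; move: z0; rewrite z00 enorm0 ltxx.
  apply: (le_lt_trans (qform_le z)); rewrite expr2.
  have h1 : enorm z * enorm z < q0 * q0 by rewrite ltr_pM// ltW.
  have h2 : q0 * q0 <= 4^-1 * q0 by rewrite ler_wpM2r// ltW.
  by lra.
have bz z : 0 < enorm z < d1 -> ball (0 : plane R) d z.
  rewrite /d1 lt_min => /and3P[z0 zd _]; apply/plane_ballE; rewrite !sub0r !normrN.
  by split; [apply: le_lt_trans zd; exact: normr_fst_le|apply: le_lt_trans zd; exact: normr_snd_le].
have E z : 0 < enorm z < d1 ->
    efl (al (qform (twist rho z))) (twist rho z) = c (iter m.-1 g (psi (chart_inv c z))).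
  move=> hz; have vt : vset q0 (twist rho z) by apply: vz; rewrite enorm_twist.
  have cz := vset_img c_disk q0_le (vz _ hz).
  rewrite psiE ctwist_inv// -iterSr prednK// alE// chart_invK//.
  by apply: (vset_img c_disk q0_le); exact: vset_efl.
apply: (@derive_twist_bound R rho al L d1 (ltW L0) d1_gt0) => //.
  move=> z z' hz hz'; rewrite !E//.
  exact: H (bz _ hz) (bz _ hz').
by apply: rho_derivable; have [] := andP rd.
Qed.

End CommutantOrbit.

(** * The prescribed form of F near the origin *)

Section LocalForm.
Context {R : realType} (M : symplectic_surface R) (c : chart R M) (F : M -> R).

Lemma polar_model : (\forall r \near 0^'+, forall theta : R,
     F (chart_inv c (polar r theta)) =
     expR (- (4 / (r ^+ 2 * (1 + 15 * cos theta ^+ 2))))) ->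
  exists q0 : R, [/\ 0 < q0, q0 <= 4^-1 &
    forall z, vset q0 z -> F (chart_inv c z) = expR (- (qform z)^-1)].
Proof.
move=> /nbhs_ballP[d /= d0 Hd].
(* As enorm^2 <= 4 [qform], the second bound keeps the disk within radius [d]. The first keeps it in
   the unit disk and in the range where [wfun] is increasing. *)
exists (Num.min 4^-1 (d ^+ 2 / 4)); split.
- by rewrite lt_min invr_gt0 ltr0n divr_gt0// exprn_gt0.
- by rewrite ge_min lexx.
move=> z /andP[qz]; rewrite lt_min => /andP[_ zd].
have z0 : 0 < enorm z by apply: enorm_gt0; exact: qform_neq0.
have ed : enorm z < d.
  rewrite -(ltr_pXn2r (n := 2))// ?nnegrE ?enorm_ge0 ?ltW//.
  by rewrite (le_lt_trans (le_qform z))// mulrC -ltr_pdivlMr.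
have [theta E] := polar_enorm z.
rewrite {1}E Hd//; last by rewrite /ball /= sub0r normrN gtr0_norm.
congr (expR (- _)); rewrite -[LHS]invrK invf_div; congr (_^-1).
rewrite qformE {2 3}E /= !exprMn.
have -> : sin theta ^+ 2 = 1 - cos theta ^+ 2 by rewrite -(cos2Dsin2 theta) addrAC subrr add0r.
by field.
Qed.

Lemma smooth_continuous : smooth_fun F -> continuous F.
Proof.
move=> sF p; have [c' ca c'p] := atlas_cover p.
have h := sF c' ca 0%N (c' p) (chart_imgP c'p).
have hc : (F \o chart_inv c') (c' q) @[q --> p] --> F p.
  rewrite -{2}(chart_mapK c'p).
  exact: (@continuous_comp _ _ _ c' (F \o chart_inv c') p (chart_map_continuous c'p) h).
apply: cvg_trans hc; apply: near_eq_cvg.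
by apply: filterS (near_chart_dom c'p) => q cq /=; rewrite chart_mapK.
Qed.

Context (c_disk : [set z | enorm z <= 1] `<=` chart_img c) (c_atlas : atlas c).
Context (F_origin : F (chart_inv c 0) = 0).
Context (q0 : R) (q0_gt0 : 0 < q0) (q0_le : q0 <= 4^-1).
Context (F_model : forall z, vset q0 z -> F (chart_inv c z) = expR (- (qform z)^-1)).

(** [F] vanishes at the origin and is nonnegative nearby, and the twist preserves the distance to
    the origin; so [H] has a local minimum there. *)
Lemma hvec_twist_origin (rho : R -> R) (H : M -> R) : smooth_fun H ->
  (forall p, H p = F (ctwist c rho p)) -> hvec H c 0 = 0.
Proof.
move=> sH HE.
have img0 : chart_img c (0 : plane R) by apply: c_disk; rewrite /= enorm0.
have Hinv z : chart_img c z -> H (chart_inv c z) = F (chart_inv c (twist rho z)).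
  by move=> cz; rewrite HE ctwist_inv.
apply: hvec_min => //.
rewrite Hinv// twist0 F_origin.
have small : \forall w \near (0 : plane R), enorm w < q0.
  have h : @enorm R w @[w --> (0 : plane R)] --> (0 : R).
    by rewrite -(@enorm0 R); exact: enorm_continuous.
  exact: (cvgr_lt _ h).
apply: filterS2 small (near_chart_img img0) => w wq cw; rewrite Hinv//.
have [w0|/enorm_gt0 w0] := pselect (w = 0); first by rewrite w0 twist0 F_origin.
rewrite F_model ?expR_ge0//; rewrite /vset /=.
rewrite qform_gt0; last by move=> E; move: w0; rewrite -(enorm_twist rho) E enorm0 ltxx.
apply: (le_lt_trans (qform_le _)); rewrite enorm_twist expr2.
have h1 : enorm w * enorm w < q0 * q0 by rewrite ltr_pM// ltW.
have h2 : q0 * q0 <= 4^-1 * q0 by rewrite ler_wpM2r// ltW.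
by lra.
Qed.

End LocalForm.

(** * Return and derivative bound for a conjugacy *)

Section Conjugacy.
Context {R : realType} (M : symplectic_surface R).
Context (mu : {measure set (borel M) -> \bar R}) (mu_area : area_measure mu).
Context (c : chart R M) (c_darboux : darboux_chart c).
Context (c_disk : [set z | enorm z <= 1] `<=` chart_img c).
Context (F H : M -> R) (F_smooth : smooth_fun F) (H_smooth : smooth_fun H).
Context (K : set M) (K_compact : compact K) (K_dom : K `<=` chart_dom c).
Context (K_supp : forall p, ~ K p -> F p = 0).
Context (F_origin : F (chart_inv c 0) = 0).
Context (q0 : R) (q0_gt0 : 0 < q0) (q0_le : q0 <= 4^-1).
Context (F_model : forall z, vset q0 z -> F (chart_inv c z) = expR (- (qform z)^-1)).
Context (rho : R -> R) (rho_supp : forall r : R, 1 <= r -> rho r = 0).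
Context (rho_derivable : forall r : R, 0 < r -> derivable rho r 1).
Context (HE : forall p, H p = F (ctwist c rho p)).
Context (phiF phiH : R -> M -> M).
Context (phiF_flow : ham_flow F phiF) (phiH_flow : ham_flow H phiH).
Context (psi psi_inv : M -> M) (psi_homeo : homeomorphism psi psi_inv).
Context (psi_flow : forall t p, psi (phiH t p) = phiF t (psi p)).

Definition commutant (p : M) := psi (ctwist c (\- rho) p).

Let g := commutant.
Let g_inv p := ctwist c rho (psi_inv p).

Let F0 : hvec F c 0 = 0.
Proof.
have [ca _] := c_darboux.
(* With the zero angle the twist is the identity, so [F] itself is an instance of the lemma. *)
apply: (hvec_twist_origin c_disk ca F_origin q0_gt0 q0_le F_model (rho := fun=> 0)) => // p.
have [cp|cp] := pselect (chart_dom c p); last by rewrite ctwist_out.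
by rewrite ctwist_in// twistE rot0 chart_mapK.
Qed.

Let H0 : hvec H c 0 = 0.
Proof.
have [ca _] := c_darboux.
exact: (hvec_twist_origin c_disk ca F_origin q0_gt0 q0_le F_model H_smooth HE).
Qed.

Let rho_pos_continuous : {in [pred r : R | 0 < r], continuous rho}.
Proof. exact: derivable_pos_continuous. Qed.

Let rhoN_supp r : 1 <= r -> (\- rho) r = 0.
Proof. by move=> /rho_supp /= ->; rewrite oppr0. Qed.

Let rhoN_continuous : {in [pred r : R | 0 < r], continuous (\- rho)}.
Proof. by apply: derivable_pos_continuous => r r0; apply: derivableN; exact: rho_derivable. Qed.

Let gK : cancel g g_inv.
Proof. by case: psi_homeo => pK _ _ _ p; rewrite /g_inv /g /commutant pK ctwistNK. Qed.

Let g_invK : cancel g_inv g.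
Proof. by case: psi_homeo => _ pK _ _ p; rewrite /g_inv /g /commutant ctwistK. Qed.

Lemma commutant_continuous : continuous commutant.
Proof.
case: psi_homeo => _ _ pc _ p; apply: (@continuous_comp _ _ _ (ctwist c (\- rho)) psi).
  exact: (ctwist_continuous c_disk rhoN_supp rhoN_continuous).
exact: pc.
Qed.

Let g_inv_continuous : continuous g_inv.
Proof.
case: psi_homeo => _ _ _ pc p; apply: (@continuous_comp _ _ _ psi_inv (ctwist c rho)).
  exact: pc.
exact: (ctwist_continuous c_disk rho_supp rho_pos_continuous).
Qed.

Lemma commutant_flow t p : commutant (phiF t p) = phiF t (commutant p).
Proof.
rewrite /commutant -psi_flow; congr psi.
apply: (can_inj (ctwistK c_disk rho_supp)).
rewrite (ctwistNK c_disk rho_supp).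
rewrite (ctwist_flow c_darboux c_disk rho_supp rho_derivable HE F_smooth H_smooth F0 H0
  phiF_flow phiH_flow).
by rewrite (ctwistNK c_disk rho_supp).
Qed.

(** The inverse twist does not decrease the area of open sets in [K] and [psi] preserves it, so
    recurrence applies to the open set of points in the model, whose iterates stay in [K]. *)
Lemma area_preserving_return : area_preserving mu psi -> exists n p0,
  [/\ (0 < n)%N, in_model c q0 p0 & in_model c q0 (iter n commutant p0)].
Proof.
move=> psi_area; have [pK pK' pc pc'] := psi_homeo.
have img_psi V : psi @` V = psi_inv @^-1` V.
  apply/seteqP; split => [_ [q Vq <-] /=|p Vp]; first by rewrite pK.
  by exists (psi_inv p).
have img_g V : commutant @` V = psi @` (ctwist c (\- rho) @` V).
  by rewrite -image_comp.
apply: (measure_recurrence mu_area c_darboux (can_inj gK) _ K_compact K_dom) => //.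
- move=> V Vo; rewrite img_g img_psi; apply: open_comp; first by move=> p _; exact: pc'.
  exact: (ctwistN_open c_disk rho_supp rho_pos_continuous).
- move=> V Vo VK; rewrite img_g psi_area; last first.
    by apply: open_borel; exact: (ctwistN_open c_disk rho_supp rho_pos_continuous).
  apply: (ctwistN_area mu_area c_darboux c_disk rho_supp rho_pos_continuous Vo).
  exact: subset_trans VK K_dom.
- by rewrite openE => p mp; exact: near_in_model.
- pose z : plane R := linv (Num.sqrt (q0 / 2), 0).
  exists (chart_inv c z); apply: (in_model_inv c_disk q0_le).
  rewrite /vset /= /qform linvK sqr_enorm /= expr0n /= addr0 sqr_sqrtr ?divr_ge0 ?ltW//.
  by rewrite divr_gt0//= ltr_pdivrMr// ltr_pMr// ltr1n.
- move=> k _ [p mp <-].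
  exact: (commute_orbit c_darboux c_disk F_smooth phiF_flow q0_le F_model K_compact K_supp
    (can_inj gK) commutant_flow k mp).
Qed.

(** Since [H] at the inverse twist of p is [F p], the increment of [F] under the commutant is the
    locally constant F o psi - H, taken at the inverse twist of p. *)
Lemma locally_constant_return :
  (forall p, \forall q \near p, F (psi q) - H q = F (psi p) - H p) -> exists n p0,
  [/\ (0 < n)%N, in_model c q0 p0 & in_model c q0 (iter n commutant p0)].
Proof.
move=> near_cst.
pose ka p := F (psi (ctwist c (\- rho) p)) - H (ctwist c (\- rho) p).
have kaE p : F (g p) = F p + ka p.
  by rewrite /ka HE (ctwistNK c_disk rho_supp) addrC subrK.
have ka_near p : \forall q \near p, ka q = ka p.
  exact: (ctwist_continuous c_disk rhoN_supp rhoN_continuous (near_cst (ctwist c (\- rho) p))).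
have orb k := commute_orbit0 c_darboux c_disk F_smooth phiF_flow q0_gt0 q0_le F_model
  K_compact K_supp (can_inj gK) commutant_continuous commutant_flow k.
have [n [p [n0 qp cp pE]]] := topological_recurrence c_disk (smooth_continuous F_smooth)
  q0_gt0 q0_le F_model F_origin gK g_invK commutant_continuous g_inv_continuous
  kaE ka_near K_compact K_dom orb.
rewrite pE in qp.
have [p0 mp0 mn] := commute_return c_darboux c_disk F_smooth phiF_flow q0_gt0 q0_le F_model F0
  K_compact K_dom K_supp (can_inj gK) commutant_continuous commutant_flow qp.
by exists n, p0.
Qed.

Lemma conjugacy_derive_bound : (forall r : R, 0 < r -> lip_at rho r) -> Lipschitz psi ->
  (exists n p0,
    [/\ (0 < n)%N, in_model c q0 p0 & in_model c q0 (iter n commutant p0)]) ->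
  exists d B : R, 0 < d /\ forall r, 0 < r < d -> r * `|derive1 rho r| <= B.
Proof.
move=> rho_lip psi_lip [n [p0 [n0 mp0 mn]]]; have [_ _ psi_cont _] := psi_homeo.
exact: (commute_derive_bound c_darboux c_disk F_smooth phiF_flow q0_gt0 q0_le F_model F0
  K_compact K_dom K_supp (can_inj gK) commutant_continuous commutant_flow
  rho_supp rho_derivable rho_lip psi_cont psi_lip (fun=> erefl) n0 mp0 mn).
Qed.

End Conjugacy.

Theorem lemma11p4 (R : realType) (M : symplectic_surface R)
  (mu : {measure set (borel M) -> \bar R}) (mu_area : area_measure mu)
  (* the Darboux chart, whose image contains the closed unit disk *)
  (c : chart R M) (c_darboux : darboux_chart c)
  (c_disk : [set z | enorm z <= 1] `<=` chart_img c)
  (F : M -> R) (F_smooth : smooth_fun F)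
  (F_supp : exists K : set M,
     [/\ compact K, K `<=` chart_dom c & forall p, ~ K p -> F p = 0])
  (F_origin : F (chart_inv c 0) = 0)
  (F_polar : \forall r \near 0^'+, forall theta : R,
     F (chart_inv c (polar r theta)) =
     expR (- (4 / (r ^+ 2 * (1 + 15 * cos theta ^+ 2)))))
  (rho : R -> R)
  (rho_smooth : forall (n : nat) (r : R), 0 < r < 1 ->
     derivable (derive1n n rho) r 1)
  (rho_supp : \forall r \near (1 : R), r <= 1 -> rho r = 0)
  (H : M -> R) (H_def : H = F \o phi_rho c rho) (H_smooth : smooth_fun H)
  (a : R) (a_gt0 : 0 < a)
  (rho_growth : rho =Theta_(0^'+) (fun r : R => r `^ (- a - 1)))
  (phiF phiH : R -> M -> M)
  (phiF_flow : ham_flow F phiF) (phiH_flow : ham_flow H phiH) :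
  (forall psi psi_inv : M -> M,
     homeomorphism psi psi_inv -> area_preserving mu psi ->
     (forall t : R, psi \o phiH t \o psi_inv = phiF t) ->
     ~ Lipschitz psi) /\
  ~ (exists psi psi_inv : M -> M,
       C1_symplectic_diffeo psi psi_inv /\ conjugates_ham_fields psi H F).
Proof.
have [K [K_compact K_dom K_supp]] := F_supp.
have [q0 [q0_gt0 q0_le F_model]] := polar_model F_polar.
have HE p : H p = F (ctwist c (cutoff rho) p).
  by rewrite H_def /= (phi_rho_ctwist rho_supp).
have rs := @cutoff_ge1 R rho.
have rd := cutoff_derivable rho_smooth rho_supp.
have rl := cutoff_lip_at rho_smooth rho_supp.
(* The growth of [rho] enters only here; below 1 the cutoff has the derivative of [rho]. *)
have no_bound : ~ exists d B : R, 0 < d /\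
    forall r, 0 < r < d -> r * `|derive1 (cutoff rho) r| <= B.
  move=> [d [B [d0 HB]]]; move: rho_growth.
  have m0 : 0 < Num.min d 1 by rewrite lt_min d0 ltr01.
  apply: (@powR_growth R rho a (Num.min d 1) B a_gt0 m0) => r.
    by rewrite lt_min => /and3P[r0 _ r1]; apply: (rho_smooth 0); rewrite r0.
  rewrite lt_min => /and3P[r0 rd' r1].
  by rewrite -cutoff_derive1 ?r0//; apply: HB; rewrite r0.
split=> [psi psi_inv psi_homeo psi_area psi_flow psi_lip|].
  have conj t p : psi (phiH t p) = phiF t (psi p).
    have [pK _ _ _] := psi_homeo.
    by rewrite -(psi_flow t) /= pK.
  apply: no_bound.
  apply: (conjugacy_derive_bound c_darboux c_disk F_smooth H_smooth K_compact K_dom K_supp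
    F_origin q0_gt0 q0_le F_model rs rd HE phiF_flow phiH_flow psi_homeo conj rl psi_lip).
  exact: (area_preserving_return mu_area c_darboux c_disk F_smooth H_smooth K_compact K_dom
    K_supp F_origin q0_gt0 q0_le F_model rs rd HE phiF_flow phiH_flow psi_homeo conj psi_area).
(* A C^1 diffeomorphism is locally Lipschitz and conjugates the flows. Its symplecticity gives the
   return through the values of [F], not through [mu]. *)
move=> [psi [psi_inv [psi_diffeo psi_fields]]].
have psi_homeo : homeomorphism psi psi_inv by case: psi_diffeo => pK pK' [pc _] [pc' _] _.
have conj := C1_conjugates_flows F_smooth H_smooth psi_diffeo psi_fields phiF_flow phiH_flow.
apply: no_bound.
apply: (conjugacy_derive_bound c_darboux c_disk F_smooth H_smooth K_compact K_dom K_supp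
  F_origin q0_gt0 q0_le F_model rs rd HE phiF_flow phiH_flow psi_homeo conj rl
  (C1_Lipschitz psi_diffeo)).
exact: (locally_constant_return c_darboux c_disk F_smooth H_smooth K_compact K_dom
  K_supp F_origin q0_gt0 q0_le F_model rs rd HE phiF_flow phiH_flow psi_homeo conj
  (C1_hamiltonian_near_cst F_smooth H_smooth psi_diffeo psi_fields)).
Qed.
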